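(* If $\mathcal{F}$ is a generic element of $\mathscr{F}(2;2)$, then the closure of the orbit $\mathcal{O}(\mathcal{F})$ in $\mathscr{F}(2;2)$ contains at least seven orbits of dimension $7$ and exactly one orbit of dimension $6$, namely the orbit of the foliation $\mathcal{F}_1$ described in the affine chart $Z=1$ by $\omega_1=x^2\,\mathrm{d}x+y^2(x\,\mathrm{d}y-y\,\mathrm{d}x)$.
   Context: $\mathscr{F}(2;2)$ is the set of quadratic (degree $2$) foliations on $\mathbb{P}^2(\mathbb{C})$: a foliation of degree $N$ is given, up to a nonzero scalar, by a homogeneous $1$-form $\omega=a\,\mathrm{d}X+b\,\mathrm{d}Y+c\,\mathrm{d}Z$ with $a,b,c$ homogeneous of degree $N+1$ without common factor and $aX+bY+cZ=0$. Thus $\mathscr{F}(2;2)$ is a Zariski open subset of $\mathbb{P}^{14}(\mathbb{C})$. In the chart $Z=1$, $x=X/Z$, $y=Y/Z$, the foliation is described by the restriction of $\omega$. $\mathrm{Aut}(\mathbb{P}^2(\mathbb{C}))=\mathrm{PGL}_3(\mathbb{C})$ acts on $\mathscr{F}(2;2)$ by pullback; $\mathcal{O}(\mathcal{F})$ is the orbit of $\mathcal{F}$. Closures are taken in $\mathscr{F}(2;2)$ for the ordinary topology. Dimensions are complex dimensions. ''Generic'' means: for all elements outside some proper Zariski closed subset of $\mathscr{F}(2;2)$. *)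

(* Defs.v *)
From HB Require Import structures.
From mathcomp Require Import all_boot all_order all_algebra.
From mathcomp Require Import all_classical all_reals all_analysis.
From mathcomp Require Import complex.
From mathcomp Require mpoly.
(* The notations of mpoly clash with those of mathcomp-analysis. *)
Import -(notations) mpoly.

Set Implicit Arguments.
Unset Strict Implicit.
Unset Printing Implicit Defensive.

Import Order.TTheory GRing.Theory Num.Theory.
Import numFieldNormedType.Exports.

Local Open Scope classical_set_scope.
Local Open Scope ring_scope.

(* The constant gives access to the norm topology that mathcomp-analysis puts
   on every numClosedFieldType; R[i] itself carries no topology. *)
Definition Cplx (R : realType) : numClosedFieldType := R[i].

Section Foliations.
Variable R : realType.
Local Notation C := (Cplx R).

(* A 1-form a dX + b dY + c dZ with cubic coefficients is stored as the matrix
   whose rows 0, 1, 2 list the coefficients of a, b, c on the ten monomials of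
   degree 3. *)
Definition oneform := 'M[C]_(3, 10).

Definition cubic_exponents : seq (3.-tuple nat) :=
  [:: [tuple 3; 0; 0]; [tuple 2; 1; 0]; [tuple 2; 0; 1]; [tuple 1; 2; 0];
      [tuple 1; 1; 1]; [tuple 1; 0; 2]; [tuple 0; 3; 0]; [tuple 0; 2; 1];
      [tuple 0; 1; 2]; [tuple 0; 0; 3]]%N.

Definition cubic_monomial (k : 'I_10) : multinom 3 :=
  Multinom (nth [tuple 0; 0; 0]%N cubic_exponents k).

Definition var n (i : 'I_n) : mpoly n C := mpolyX C (mnm1 i).

Definition coef (w : oneform) (i : 'I_3) : mpoly 3 C :=
  \sum_(k < 10) w i k *: mpolyX C (cubic_monomial k).

Definition no_common_factor (a : 'I_3 -> mpoly 3 C) : Prop :=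
  forall p, (forall i, exists q, a i = p * q) -> exists c, p = mpolyC 3 c.

(* The second condition forces w to be nonzero. *)
Definition foliation_form : set oneform :=
  [set w | \sum_(i < 3) coef w i * var i = 0 /\ no_common_factor (coef w)].

Definition proportional (w w' : foliation_form) : bool :=
  `[< exists c : C, c != 0 /\ set_val w' = c *: set_val w >].

Lemma proportional_refl : reflexive proportional.
Proof. by move=> w; apply/asboolP; exists 1; rewrite oner_eq0 scale1r. Qed.

Lemma proportional_sym : ssrbool.symmetric proportional.
Proof.
move=> w w'; apply/asboolP/asboolP => -[c [c0 e]]; exists c^-1;
  by rewrite invr_eq0 e scalerA mulVf // scale1r.
Qed.

Lemma proportional_trans : transitive proportional.
Proof.
move=> w2 w1 w3 /asboolP[c [c0 e]] /asboolP[d [d0 e']]; apply/asboolP.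
by exists (d * c); rewrite mulf_neq0 // e' e scalerA.
Qed.

Canonical proportional_equiv :=
  EquivRel proportional proportional_refl proportional_sym proportional_trans.

(* The ordinary topology on F(2;2): that of the quotient of an open part of
   the punctured 15-dimensional space of 1-forms by nonzero scalars. *)
Definition foliation : Type :=
  quotient_topology {eq_quot proportional_equiv}%qT.
HB.instance Definition _ := Topological.on foliation.

Definition foliation_of (w : foliation_form) : foliation :=
  (\pi_({eq_quot proportional_equiv}%qT) w)%qT.

(* g acts by X_i |-> \sum_j g i j X_j and dX_i |-> \sum_j g i j dX_j. *)
Definition pullback (g : 'M[C]_3) (a : 'I_3 -> mpoly 3 C) : 'I_3 -> mpoly 3 C :=
  fun j => \sum_(i < 3)
    g i j *: comp_mpoly [tuple \sum_(l < 3) g m l *: var l | m < 3] (a i).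

(* GL_3 and PGL_3 have the same orbits: scalar matrices act trivially on
   forms up to scalars. *)
Definition PGL3_orbit (F : foliation) : set foliation :=
  [set F' | exists (g : 'M[C]_3) (w w' : foliation_form),
    [/\ g \in unitmx, foliation_of w = F, foliation_of w' = F' &
        coef (set_val w') =1 pullback g (coef (set_val w))]].

Definition is_orbit (O : set foliation) : Prop := exists F, O = PGL3_orbit F.

(* Zero sets of families of homogeneous polynomials in the coordinates of w. *)
Definition zariski_closed (Z : set foliation) : Prop :=
  exists S : set (mpoly (3 * 10) C),
    (forall P, S P -> exists d, P \is ishomog1 d mdeg) /\
    Z = [set F | forall w : foliation_form, foliation_of w = F ->
           forall P, S P -> meval (mxvec (set_val w) 0) P = 0].

Definition generic (Q : foliation -> Prop) : Prop :=
  exists Z, [/\ zariski_closed Z, Z != setT & forall F, ~ Z F -> Q F].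

(* S contains a complex submanifold of dimension d, given by a holomorphic
   parametrization u |-> [phi u]; over C, being differentiable on an open set
   is being holomorphic.  The kernel of the differential of w |-> [w] at phi u
   is the line spanned by phi u, so the last clause says that u |-> [phi u]
   is an immersion. *)
Definition contains_manifold (S : set foliation) (d : nat) : Prop :=
  exists (U : set 'rV[C]_d) (phi : 'rV[C]_d -> oneform),
    [/\ open U, U !=set0 &
        forall u, U u ->
          [/\ exists w : foliation_form, set_val w = phi u /\ S (foliation_of w),
              differentiable phi u &
              forall (v : 'rV[C]_d) (t : C), 'd phi u v = t *: phi u -> v = 0]].

(* Complex dimension of a set: the largest dimension of a complex submanifold
   contained in it. *)
Definition has_dim (S : set foliation) (d : nat) : Prop :=
  contains_manifold S d /\ forall e, contains_manifold S e -> (e <= d)%N.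

Definition chart_Z1 (p : mpoly 3 C) : mpoly 2 C :=
  comp_mpoly [tuple var 0; var 1; 1] p.

Definition described_in_chart_Z1 (F : foliation) (A B : mpoly 2 C) : Prop :=
  exists w : foliation_form,
    [/\ foliation_of w = F,
        chart_Z1 (coef (set_val w) 0) = A & chart_Z1 (coef (set_val w) 1) = B].

(* omega_1 = A dx + B dy with A = x^2 - y^2 y and B = y^2 x. *)
Definition omega1_dx : mpoly 2 C := var 0 ^+ 2 - var 1 ^+ 2 * var 1.
Definition omega1_dy : mpoly 2 C := var 1 ^+ 2 * var 0.

End Foliations.

(* Main.v *)
From HB Require Import structures.
Require Import Defs.
From mathcomp Require Import all_boot all_order all_fingroup all_algebra all_field.
From mathcomp Require Import all_classical all_reals all_analysis.
From mathcomp Require Import complex.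
From mathcomp Require Import ring lra zify.
From mathcomp Require mpoly.
Import -(notations) mpoly.

Set Implicit Arguments.
Unset Strict Implicit.
Unset Printing Implicit Defensive.

Import Order.TTheory GRing.Theory Num.Theory.
Import numFieldNormedType.Exports.

Local Open Scope classical_set_scope.
Local Open Scope ring_scope.

(** For forms w and w0 that represent foliations, the class of w0 is in the
closure of the orbit of that of w if and only if w degenerates to w0: forms
equivalent to w come arbitrarily close to w0. The proof classifies the degenerations of a generic w.

Classification. Gaussian elimination with complete pivoting writes an element
of GL_3 as a product of a diagonal matrix and two factors that are bounded,
with determinants of modulus one. Along an ultrafilter the bounded factors and
the quotients r, t of the diagonal entries converge, and in the limit w and w0,
after a change of coordinates, satisfy binomial relations between their
entries. If no line is invariant by w and if at every singular point the two
eigenvalues are nonzero and distinct, comparing weights leaves three cases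
([limit_cases], [degenerations]): w0 is equivalent to w, or to the form
F1 = x^2 (z dx - x dz) + y^2 (x dy - y dx), or to a form
G(al, be) = ((be - al) x y z + y^3) dx - (be x^2 z + x y^2) dy + al x^2 y dz.

Existence. At a singular point of w, a frame consisting of that point and of an
eigendirection is contracted by a one-parameter group, and the limit is the
form G(al, be) whose eigenvalues at (1, 0, 0) have the quotient of those of w
([degenerates_G]); each G(al, be) degenerates to F1 ([degenerates_G_F1]).
Equivalent forms G have the same quotient al / be ([G_conjugate]).

Dimensions. Seven infinitesimal linear transformations move G(al, be)
independently modulo scalars, and six move F1 ([G_directions],
[F1_directions]). This remains true near these forms, so that a form which
degenerates to G(al, be) has an orbit containing a manifold of dimension seven
([orbit_immersion]). Conversely, after normalising entries of the matrix by
means of the stabiliser, the cone over the orbit of G(al, be), respectively F1,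
is covered by finitely many images of polynomial maps in eight, respectively
seven, variables. A submanifold of dimension e of the orbit yields e + 1 entries
of the forms that are analytically independent on its cone, while more than d
polynomials in d variables satisfy an algebraic relation ([immersed_dim_lt]).
Hence the orbits of the forms G have dimension 7, that of F1 has dimension 6,
and the orbit of w, which contains a manifold of dimension 7, is not among those
of dimension 6.

Genericity. The forms with an invariant line, with a degenerate or resonant
singular point, or with a singular point on z = 0 depend on at most fourteen
parameters, whence a hypersurface containing them ([generically_notin_image]).
For the existence of eight frames, formed by a singular point and an
eigendirection, with different quotients of eigenvalues, quantifier elimination shows that either this property or its
negation is generic, and the first holds since the forms with four
nondegenerate singular points in general position are dense
([dense_four_points]): any first order variation of such a form is the sum of
one that moves the four points linearly and of one that fixes them. Each of the
four points carries two eigenframes. *)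

(** * Polynomial functions *)

Section PolynomialFunctions.
Variable C : numClosedFieldType.

(** Polynomial functions on spaces of tuples indexed by arbitrary types; closure
under composition and linear algebra is easier to state for them than for
polynomials. *)
Inductive polyfun (I : Type) : ((I -> C) -> C) -> Prop :=
| polyfun_cst c : polyfun (fun=> c)
| polyfun_var i : polyfun (fun x => x i)
| polyfun_add f g : polyfun f -> polyfun g -> polyfun (fun x => f x + g x)
| polyfun_mul f g : polyfun f -> polyfun g -> polyfun (fun x => f x * g x).

Lemma polyfun_eq I (f g : (I -> C) -> C) : polyfun f -> f =1 g -> polyfun g.
Proof. by move=> pf /funext <-. Qed.

Lemma polyfun_opp I (f : (I -> C) -> C) : polyfun f -> polyfun (fun x => - f x).
Proof.
move=> pf; apply: (@polyfun_eq _ (fun x => -1 * f x)).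
  by apply: polyfun_mul => //; exact: polyfun_cst.
by move=> x; rewrite mulN1r.
Qed.

Lemma polyfun_sub I (f g : (I -> C) -> C) :
  polyfun f -> polyfun g -> polyfun (fun x => f x - g x).
Proof. by move=> pf pg; apply: polyfun_add => //; apply: polyfun_opp. Qed.

Lemma polyfun_exp I (f : (I -> C) -> C) n :
  polyfun f -> polyfun (fun x => f x ^+ n).
Proof.
move=> pf; elim: n => [|n IHn]; first exact: polyfun_cst.
apply: (@polyfun_eq _ (fun x => f x * f x ^+ n)); first exact: polyfun_mul.
by move=> x; rewrite exprS.
Qed.

Lemma polyfun_sum I J (r : seq J) (P : pred J) (F : J -> (I -> C) -> C) :
  (forall j, polyfun (F j)) -> polyfun (fun x => \sum_(j <- r | P j) F j x).
Proof.
move=> pF; elim: r => [|j r IHr].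
  by apply: (polyfun_eq (polyfun_cst _ 0)) => x; rewrite big_nil.
case Pj: (P j).
  by apply: (polyfun_eq (polyfun_add (pF j) IHr)) => x; rewrite big_cons Pj.
by apply: (polyfun_eq IHr) => x; rewrite big_cons Pj.
Qed.

Lemma polyfun_prod I J (r : seq J) (P : pred J) (F : J -> (I -> C) -> C) :
  (forall j, polyfun (F j)) -> polyfun (fun x => \prod_(j <- r | P j) F j x).
Proof.
move=> pF; elim: r => [|j r IHr].
  by apply: (polyfun_eq (polyfun_cst _ 1)) => x; rewrite big_nil.
case Pj: (P j).
  by apply: (polyfun_eq (polyfun_mul (pF j) IHr)) => x; rewrite big_cons Pj.
by apply: (polyfun_eq IHr) => x; rewrite big_cons Pj.
Qed.

Lemma polyfun_comp I J (f : (I -> C) -> C) (h : (J -> C) -> I -> C) :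
  polyfun f -> (forall i, polyfun (h^~ i)) -> polyfun (f \o h).
Proof.
move=> + ph; elim=> [c|i|f1 f2 _ IH1 _ IH2|f1 f2 _ IH1 _ IH2].
- exact: polyfun_cst.
- exact: ph.
- exact: polyfun_add.
- exact: polyfun_mul.
Qed.

Lemma polyfun_det I n (F : (I -> C) -> 'M[C]_n) :
  (forall i j, polyfun (fun x => F x i j)) -> polyfun (fun x => \det (F x)).
Proof.
move=> pF; rewrite /determinant; apply: polyfun_sum => s.
by apply: polyfun_mul; [exact: polyfun_cst | apply: polyfun_prod => i].
Qed.

Lemma polyfun_mulmx I m n p (F : (I -> C) -> 'M[C]_(m, n)) (G : (I -> C) -> 'M[C]_(n, p)) :
  (forall i j, polyfun (fun x => F x i j)) ->
  (forall i j, polyfun (fun x => G x i j)) ->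
  forall i j, polyfun (fun x => (F x *m G x) i j).
Proof.
move=> pF pG i j; apply: (@polyfun_eq _ (fun x => \sum_k F x i k * G x k j)).
  by apply: polyfun_sum => k; apply: polyfun_mul.
by move=> x; rewrite mxE.
Qed.

(** Along a polynomial curve a polynomial function is a univariate
polynomial, which has finitely many zeros. *)
Lemma polyfun_curve I (f : (I -> C) -> C) (q : I -> {poly C}) :
  polyfun f -> exists p : {poly C}, forall t, f (fun i => (q i).[t]) = p.[t].
Proof.
elim=> [c|i|f1 f2 _ [p1 E1] _ [p2 E2]|f1 f2 _ [p1 E1] _ [p2 E2]].
- by exists c%:P => t; rewrite hornerC.
- by exists (q i).
- by exists (p1 + p2) => t; rewrite E1 E2 hornerD.
- by exists (p1 * p2) => t; rewrite E1 E2 hornerM.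
Qed.

Lemma poly_nonroot (p : {poly C}) : p != 0 -> exists t, p.[t] != 0.
Proof.
move=> p0; pose s : seq C := [seq i%:R | i <- iota 0 (size p)].
have us : uniq s.
  by rewrite map_inj_uniq ?iota_uniq // => i j /eqP; rewrite eqr_nat => /eqP.
have [sp|] := boolP (all (root p) s).
  by have := max_poly_roots p0 sp us; rewrite size_map size_iota ltnn.
by case/allPn => t _ tp; exists t.
Qed.

(** The nonvanishing loci of two polynomial functions meet, as one sees on the
line joining a point of one to a point of the other. *)
Lemma polyfun_mul_neq0 I (f g : (I -> C) -> C) x y :
  polyfun f -> polyfun g -> f x != 0 -> g y != 0 ->
  exists z, f z != 0 /\ g z != 0.
Proof.
move=> pf pg fx gy.
(* The line from x to y. *)
pose q i := (x i)%:P + (y i - x i) *: 'X : {poly C}.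
have q0 : (fun i => (q i).[0]) = x.
  by apply/funext => i; rewrite /q hornerD hornerC hornerZ hornerX mulr0 addr0.
have q1 : (fun i => (q i).[1]) = y.
  by apply/funext => i; rewrite /q hornerD hornerC hornerZ hornerX mulr1 addrC subrK.
have [pp pE] := polyfun_curve q pf; have [pp' pE'] := polyfun_curve q pg.
have p0 : pp != 0 by apply: contra_neq fx => p0; rewrite -q0 pE p0 horner0.
have p0' : pp' != 0 by apply: contra_neq gy => p0'; rewrite -q1 pE' p0' horner0.
have [t] := poly_nonroot (mulf_neq0 p0 p0').
rewrite hornerM mulf_eq0 negb_or => /andP[pt pt'].
by exists (fun i => (q i).[t]); rewrite pE pE'.
Qed.

Lemma mpoly_ringind n (P : mpoly n C -> Prop) :
  (forall c, P (mpolyC n c)) -> (forall i, P (mpolyX C (mnm1 i))) ->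
  (forall p q, P p -> P q -> P (p + q)) ->
  (forall p q, P p -> P q -> P (p * q)) -> forall p, P p.
Proof.
move=> PC PX PD PM p; rewrite [p]mpolyE.
have P0 : P 0 by rewrite -(mpolyC0 n C); apply: PC.
apply: (big_ind P P0 PD) => m _; rewrite -mul_mpolyC; apply: (PM) => //.
have P1 : P 1 by rewrite -mpolyC1.
rewrite mpolyXE_id; apply: (big_ind P P1 PM) => i _.
elim: (fun_of_multinom m i) => [|k IHk]; first by rewrite expr0.
by rewrite exprS; apply: PM.
Qed.

Lemma polyfun_meval n (p : mpoly n C) : polyfun (fun x => meval x p).
Proof.
elim/mpoly_ringind: p => [c|i|p q IHp IHq|p q IHp IHq].
- by apply: (polyfun_eq (polyfun_cst _ c)) => x; rewrite mevalC.
- by apply: (polyfun_eq (polyfun_var i)) => x; rewrite mevalXU.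
- by apply: (polyfun_eq (polyfun_add IHp IHq)) => x; rewrite mevalD.
- by apply: (polyfun_eq (polyfun_mul IHp IHq)) => x; rewrite mevalM.
Qed.

Lemma polyfunP n (f : ('I_n -> C) -> C) :
  polyfun f -> exists p : mpoly n C, forall x, f x = meval x p.
Proof.
elim=> [c|i|f1 f2 _ [p1 E1] _ [p2 E2]|f1 f2 _ [p1 E1] _ [p2 E2]].
- by exists (mpolyC n c) => x; rewrite mevalC.
- by exists (mpolyX C (mnm1 i)) => x; rewrite mevalXU.
- by exists (p1 + p2) => x; rewrite mevalD E1 E2.
- by exists (p1 * p2) => x; rewrite mevalM E1 E2.
Qed.

(** If every polynomial vanishing on a set has all its partial derivatives
vanishing on that set, then a nonzero one of least degree would be constant:
in characteristic zero some partial derivative of a nonconstant polynomial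
is nonzero. *)
Lemma derivation_stable_vanish m (I : ('I_m -> C) -> Prop) :
  (exists x, I x) ->
  (forall p, (forall x, I x -> meval x p = 0) ->
     forall i x, I x -> meval x (mderiv i p) = 0) ->
  forall p, (forall x, I x -> meval x p = 0) -> p = 0.
Proof.
move=> [x0 Ix0] stable p; move: {2}(msize p) (leqnn (msize p)) => k.
elim: k p => [|k IHk] p.
  by rewrite leqn0 msize_poly_eq0 => /eqP.
move=> sp vp.
have dp i : mderiv i p = 0.
  apply: IHk; last by move=> x Ix; apply: stable.
  rewrite msizeE; apply/bigmax_leqP_seq => u; rewrite mcoeff_msupp => cu _.
  have cu' : mcoeff (mnm_add u (mnm1 i)) p != 0.
    by apply: contra_neq cu; rewrite mcoeff_mderiv => ->; rewrite mul0rn.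
  rewrite -ltnS; apply: leq_trans sp.
  have := @msize_mdeg_lt _ _ p (mnm_add u (mnm1 i)).
  by rewrite mcoeff_msupp mdegD mdeg1 addn1; apply.
have pc : p = mpolyC m (mcoeff mnm0 p).
  apply/mpolyP => u; rewrite mcoeffC; have [->|u0] := eqVneq mnm0 u.
    by rewrite mulr1.
  rewrite mulr0.
  have [i ui] : exists i, fun_of_multinom u i != 0%N.
    apply/existsP; rewrite -negb_forall; apply: contra_neqN u0 => /forallP u0.
    by apply/mnmP => i; rewrite mnm0E; apply/esym/eqP/u0.
  have /eqP := mcoeff_mderiv i p (mnm_sub u (mnm1 i)).
  rewrite dp mcoeff0 eq_sym mulrn_eq0 /= => /eqP <-; congr mcoeff.
  apply/mnmP => j; rewrite mnmDE mnmBE mnm1E; case: eqVneq => [<-|_].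
    by rewrite subnK // lt0n.
  by rewrite subn0 addn0.
have := vp _ Ix0; rewrite {1}pc mevalC => c0.
by rewrite pc c0 mpolyC0.
Qed.

End PolynomialFunctions.

(** * Algebraic dependence *)

Section Elimination.
Variable C : numClosedFieldType.

Lemma meval_curve n (q : 'I_n -> {poly C}) (p : mpoly n C) :
  exists r : {poly C}, forall t,
    meval (fun i => (q i).[t]) p = r.[t] /\
    r^`().[t] = \sum_i meval (fun i => (q i).[t]) (mderiv i p) * (q i)^`().[t].
Proof.
elim/mpoly_ringind: p => [c|i|p1 p2 [r1 E1] [r2 E2]|p1 p2 [r1 E1] [r2 E2]].
- exists c%:P => t; rewrite mevalC hornerC derivC horner0; split=> //.
  by rewrite big1 // => i _; rewrite mderivC meval0 mul0r.
- exists (q i) => t; rewrite mevalXU; split=> //.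
  rewrite (bigD1 i) //= mderivX mnmE eqxx scale1r.
  rewrite big1 ?addr0; last first.
    move=> j ji; rewrite mderivX mnmE eq_sym (negPf ji) scale0r meval0.
    by rewrite mul0r.
  suff -> : mnm_sub (mnm1 i) (mnm1 i) = mnm0 :> multinom n.
    by rewrite mpolyX0 meval1 mul1r.
  by apply/mnmP => j; rewrite mnmBE subnn mnm0E.
- exists (r1 + r2) => t; have [E1a E1b] := E1 t; have [E2a E2b] := E2 t.
  rewrite mevalD hornerD E1a E2a derivD hornerD E1b E2b; split=> //.
  by rewrite -big_split; apply: eq_bigr => i _; rewrite mderivD mevalD mulrDl.
- exists (r1 * r2) => t; have [E1a E1b] := E1 t; have [E2a E2b] := E2 t.
  rewrite mevalM hornerM E1a E2a derivM hornerD !hornerM E1b E2b; split=> //.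
  rewrite -E1a -E2a mulr_suml mulr_sumr -big_split; apply: eq_bigr => i _ /=.
  by rewrite mderivM mevalD !mevalM mulrDl mulrAC !mulrA.
Qed.

Lemma meval_inj n (p : mpoly n C) : (forall x, meval x p = 0) -> p = 0.
Proof.
move=> p0; apply: (@derivation_stable_vanish _ _ (fun=> True)) => //.
  by exists (fun=> 0).
move=> {p p0} p p0 i x _.
pose q j := (x j)%:P + (j == i)%:R *: 'X : {poly C}.
have [r E] := meval_curve q p.
have r0 : r = 0.
  apply: contraPeq isT => /poly_nonroot[t].
  by have [<- _] := E t; rewrite p0 ?eqxx.
have [_] := E 0; rewrite r0 derivC horner0 (bigD1 i) //= big1 => [|j ji].
  rewrite addr0 => /esym; rewrite /q derivD derivC add0r derivZ derivX eqxx.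
  rewrite scale1r hornerC mulr1 => <-; apply: meval_eq => j.
  by rewrite hornerD hornerC hornerZ hornerX mulr0 addr0.
by rewrite /q derivD derivC add0r derivZ derivX (negPf ji) scale0r horner0 mulr0.
Qed.

Lemma meval_neq0 n (p : mpoly n C) : p != 0 -> exists x, meval x p != 0.
Proof.
move=> p0; apply: contrapT => px; move: p0; apply/negP/negPn/eqP/meval_inj => x.
by apply/eqP; apply: contrapT => /negP ?; apply: px; exists x.
Qed.

(** Polynomials in fewer variables than their number are algebraically
dependent: the products of powers smaller than N of the m polynomials are
N^m in number and have degree O(N), so that for N large they outnumber the
monomials of that degree in d < m variables. *)
Lemma algebraic_dependence d m (f : 'I_m -> mpoly d C) : (d < m)%N ->
  exists2 P : mpoly m C, P != 0 &
    forall x, meval (fun i => meval x (f i)) P = 0.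
Proof.
move=> dm.
pose D := \max_i msize (f i).
pose N := ((m * D).+1 ^ d).+1.
have N0 : (0 < N)%N by [].
pose K := (m * (N * D)).+1.
pose T := {ffun 'I_m -> 'I_N}; pose S := {ffun 'I_d -> 'I_K}.
pose mT (a : T) : multinom m := Multinom [tuple nat_of_ord (a i) | i < m].
pose mS (b : S) : multinom d := Multinom [tuple nat_of_ord (b i) | i < d].
have mTE a i : fun_of_multinom (mT a) i = a i.
  by rewrite /fun_of_multinom tnth_mktuple.
have mSE b i : fun_of_multinom (mS b) i = b i.
  by rewrite /fun_of_multinom tnth_mktuple.
pose g (a : T) : mpoly d C := \prod_i f i ^+ a i.
have sM (h k : mpoly d C) : (msize (h * k) <= (msize h + msize k).-1)%N.
  have [->|h0] := eqVneq h 0; first by rewrite mul0r msize0.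
  have [->|k0] := eqVneq k 0; first by rewrite mulr0 msize0.
  by rewrite msizeM.
have sX (h : mpoly d C) k l : (msize h <= l.+1)%N -> (msize (h ^+ k) <= (k * l).+1)%N.
  move=> hl; elim: k => [|k IHk]; first by rewrite expr0 msize1.
  rewrite exprS; apply: leq_trans (sM _ _) _.
  by move: hl IHk; rewrite mulSn; move: (msize h) (msize (h ^+ k)) => u v; lia.
have sg a : (msize (g a) <= K)%N.
  rewrite /g /K.
  have : forall r : seq 'I_m, (msize (\prod_(i <- r) f i ^+ a i) <= (size r * (N * D)).+1)%N.
    elim=> [|i r IHr]; first by rewrite big_nil msize1.
    rewrite big_cons; apply: leq_trans (sM _ _) _.
    have fD : (msize (f i) <= D.+1)%N by apply: leqW; exact: leq_bigmax.
    move: (sX (f i) (a i) D fD) (leq_mul (ltnW (ltn_ord (a i))) (leqnn D)) (IHr) => /=; move: (msize (f i ^+ a i)) (msize (\prod_(_ <- r) _)) => u v; nia.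
  by move/(_ (index_enum 'I_m)); rewrite -[index_enum _]enumT -cardE card_ord.
pose A : 'M[C]_(#|T|, #|S|) :=
  \matrix_(i, j) mcoeff (mS (enum_val j)) (g (enum_val i)).
have ltST : (#|S| < #|T|)%N.
  rewrite !card_ffun !card_ord.
  apply: (@leq_trans (N ^ d.+1)); last by rewrite leq_pexp2l.
  rewrite expnS; apply: (@leq_ltn_trans ((m * D).+1 ^ d * N ^ d)).
    rewrite -expnMn; have [->|d0] := posnP d; first by rewrite !expn0.
    by rewrite leq_exp2r // /K; nia.
  by rewrite ltn_pmul2r ?expn_gt0 // /N.
have kA : kermx A != 0.
  rewrite kermx_eq0 /row_free; apply: contraL ltST => /eqP <-.
  by rewrite -leqNgt rank_leq_col.
have [i ri] : exists i, row i (kermx A) != 0.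
  apply/existsP; rewrite -negb_forall; apply: contra kA => /forallP r0.
  by apply/eqP/row_matrixP => i; rewrite row0; apply/eqP.
set c := row i (kermx A) in ri.
have cA : c *m A = 0 by rewrite /c -row_mul mulmx_ker row0.
have mT_inj : injective mT.
  by move=> a b ab; apply/ffunP => j; apply/val_inj; rewrite /= -!mTE ab.
pose P : mpoly m C := \sum_(a : T) c 0 (enum_rank a) *: mpolyX C (mT a).
have PE a : mcoeff (mT a) P = c 0 (enum_rank a).
  rewrite /P raddf_sum /= (bigD1 a) //= mcoeffZ mcoeffX eqxx mulr1.
  rewrite big1 ?addr0 // => b ba; rewrite mcoeffZ mcoeffX.
  by rewrite (inj_eq mT_inj) (negPf ba) mulr0.
exists P.
  apply: contra ri => /eqP P0; apply/eqP/rowP => j.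
  by rewrite -[j]enum_valK -PE P0 mcoeff0 mxE.
have sum0 : \sum_(a : T) c 0 (enum_rank a) *: g a = 0.
  apply/mpolyP => u; rewrite mcoeff0 raddf_sum /=.
  have [uK|Ku] := ltnP (mdeg u) K; last first.
    rewrite big1 // => a _; rewrite mcoeffZ [mcoeff _ _](_ : _ = 0) ?mulr0 //.
    by apply/eqP; rewrite mcoeff_eq0; apply: msize_mdeg_ge; apply: leq_trans Ku.
  have uK' j : (fun_of_multinom u j < K)%N.
    by apply: leq_ltn_trans uK; rewrite mdegE (bigD1 j) //= leq_addr.
  pose b : S := [ffun j => Ordinal (uK' j)].
  have ub : mS b = u by apply/mnmP => j; rewrite mSE ffunE.
  have := congr1 (fun M : 'rV_ _ => M 0 (enum_rank b)) cA; rewrite !mxE => cAb.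
  rewrite -[RHS]cAb [RHS](reindex (@enum_rank T)) /=; last first.
    by apply: onW_bij; apply: enum_rank_bij.
  by apply: eq_bigr => a _; rewrite mcoeffZ ![A _ _]mxE !enum_rankK ub.
move=> x; rewrite /P raddf_sum /=.
transitivity (meval x (\sum_(a : T) c 0 (enum_rank a) *: g a)); last first.
  by rewrite sum0 meval0.
rewrite raddf_sum /=; apply: eq_bigr => a _; rewrite !mevalZ mevalX; congr (_ * _).
by rewrite /g rmorph_prod /=; apply: eq_bigr => j _; rewrite rmorphXn /= mTE.
Qed.

End Elimination.

(** * Generic properties *)

Section Generically.
Variable C : numClosedFieldType.

Definition generically n (Q : ('I_n -> C) -> Prop) : Prop :=
  exists P : ('I_n -> C) -> C,
    [/\ polyfun P, exists x, P x != 0 & forall x, P x != 0 -> Q x].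

Lemma generically_true n (Q : ('I_n -> C) -> Prop) :
  (forall x, Q x) -> generically Q.
Proof.
move=> QT; exists (fun=> 1); split=> [| |x _]; last exact: QT.
  exact: polyfun_cst.
by exists (fun=> 0); rewrite oner_eq0.
Qed.

Lemma generically_and n (Q Q' : ('I_n -> C) -> Prop) :
  generically Q -> generically Q' -> generically (fun x => Q x /\ Q' x).
Proof.
move=> [P [pP [x Px] PQ]] [P' [pP' [y Py] PQ']].
exists (fun x => P x * P' x); split; first exact: polyfun_mul.
  have [z [z1 z2]] := polyfun_mul_neq0 pP pP' Px Py.
  by exists z; rewrite mulf_neq0.
by move=> z; rewrite mulf_eq0 negb_or => /andP[/PQ ? /PQ' ?].
Qed.

Lemma generically_imp n (Q Q' : ('I_n -> C) -> Prop) :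
  (forall x, Q x -> Q' x) -> generically Q -> generically Q'.
Proof. by move=> QQ' [P [pP P0 PQ]]; exists P; split=> // x /PQ/QQ'. Qed.

Lemma generically_all n (J : eqType) (r : seq J) (Q : J -> ('I_n -> C) -> Prop) :
  (forall j, generically (Q j)) ->
  generically (fun x => forall j, j \in r -> Q j x).
Proof.
move=> gQ; elim: r => [|j r IHr]; first exact: generically_true.
apply: generically_imp (generically_and (gQ j) IHr) => x [Qj Qx] i.
by rewrite inE => /orP[/eqP ->//|]; exact: Qx.
Qed.

(** The list of values by which the terms of the first order language of fields
are evaluated. *)
Definition env n (x : 'I_n -> C) : seq C := [tuple x i | i < n].

Lemma nth_env n (x : 'I_n -> C) i : (env x)`_i = if insub i is Some j then x j else 0.
Proof.
case: insubP => [j _ <-|]; first by rewrite -tnth_nth tnth_mktuple.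
by rewrite -leqNgt => ni; rewrite nth_default // size_tuple.
Qed.

Lemma size_env n (x : 'I_n -> C) : size (env x) = n.
Proof. by rewrite size_tuple. Qed.

Lemma polyfun_eval n (t : GRing.term C) : GRing.rterm t ->
  polyfun (fun x : 'I_n -> C => GRing.eval (env x) t).
Proof.
elim: t => //=.
- move=> i _; apply: (@polyfun_eq _ _ (fun x => if insub i is Some j then x j else 0)).
    by case: insub => [j|]; [exact: polyfun_var|exact: polyfun_cst].
  by move=> x; rewrite nth_env.
- by move=> c _; exact: polyfun_cst.
- by move=> k _; exact: polyfun_cst.
- by move=> t1 IH1 t2 IH2 /andP[/IH1 ? /IH2 ?]; exact: polyfun_add.
- by move=> t1 IH1 /IH1; exact: polyfun_opp.
- move=> t1 IH1 k /IH1 pt.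
  apply: (polyfun_eq (polyfun_mul (polyfun_cst _ k%:R) pt)) => x.
  by rewrite mulr_natl.
- by move=> t1 IH1 t2 IH2 /andP[/IH1 ? /IH2 ?]; exact: polyfun_mul.
- by move=> t1 IH1 k /IH1; exact: polyfun_exp.
Qed.

(** An equation between polynomials holds identically or fails generically. *)
Lemma qf_eval_generically n (f : GRing.formula C) :
  GRing.qf_form f -> GRing.rformula f ->
  exists b, generically (fun x : 'I_n -> C => GRing.qf_eval (env x) f = b).
Proof.
elim: f => //=.
- by move=> b _ _; exists b; exact: generically_true.
- move=> t1 t2 _ /andP[/(@polyfun_eval n) p1 /(@polyfun_eval n) p2].
  have [[x tx]|te] := pselect (exists x : 'I_n -> C,
      GRing.eval (env x) t1 != GRing.eval (env x) t2).
    exists false, (fun x => GRing.eval (env x) t1 - GRing.eval (env x) t2).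
    split=> [| |y]; first exact: polyfun_sub.
      by exists x; rewrite subr_eq0.
    by rewrite subr_eq0 => /negPf.
  exists true; apply: generically_true => x; apply/negPn/negP => tx.
  by apply: te; exists x.
- move=> f1 IH1 f2 IH2 /andP[q1 q2] /andP[r1 r2].
  have [b1 g1] := IH1 q1 r1; have [b2 g2] := IH2 q2 r2.
  exists (b1 && b2); apply: generically_imp (generically_and g1 g2) => x.
  by case=> -> ->.
- move=> f1 IH1 f2 IH2 /andP[q1 q2] /andP[r1 r2].
  have [b1 g1] := IH1 q1 r1; have [b2 g2] := IH2 q2 r2.
  exists (b1 || b2); apply: generically_imp (generically_and g1 g2) => x.
  by case=> -> ->.
- move=> f1 IH1 f2 IH2 /andP[q1 q2] /andP[r1 r2].
  have [b1 g1] := IH1 q1 r1; have [b2 g2] := IH2 q2 r2.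
  exists (b1 ==> b2); apply: generically_imp (generically_and g1 g2) => x.
  by case=> -> ->.
- move=> f1 IH1 q1 r1; have [b1 g1] := IH1 q1 r1.
  by exists (~~ b1); apply: generically_imp g1 => x ->.
Qed.

Definition join n m (x : 'I_n -> C) (z : 'I_m -> C) (i : 'I_n + 'I_m) : C :=
  match i with inl i => x i | inr j => z j end.

(** The free variables have the indices below n, the quantified ones the indices
from n to n + m - 1. *)
Definition envjoin n m (e : seq C) (i : 'I_n + 'I_m) : C :=
  match i with inl i => e`_i | inr j => e`_(n + j)%N end.

Lemma polyfun_term n m (f : ('I_n + 'I_m -> C) -> C) : polyfun f ->
  exists2 t : GRing.term C, GRing.rterm t &
    forall e, GRing.eval e t = f (envjoin e).
Proof.
elim=> [c|[i|j]|f1 f2 _ [t1 r1 E1] _ [t2 r2 E2]|f1 f2 _ [t1 r1 E1] _ [t2 r2 E2]].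
- by exists (GRing.Const c).
- by exists (GRing.Var C i).
- by exists (GRing.Var C (n + j)).
- by exists (GRing.Add t1 t2) => [|e] /=; rewrite ?r1 // E1 E2.
- by exists (GRing.Mul t1 t2) => [|e] /=; rewrite ?r1 // E1 E2.
Qed.

(** Chevalley's theorem: by quantifier elimination the projection of a
quasi-affine set is defined by polynomial equations and inequations, and away
from the zeros of the nonzero polynomials among them these are all true or
all false. *)
Lemma generically_solvable_or_not n m (E : seq (('I_n + 'I_m -> C) -> C)) h :
  (forall k, (k < size E)%N -> polyfun (nth h E k)) -> polyfun h ->
  let S (x : 'I_n -> C) := exists z : 'I_m -> C,
    (forall k, (k < size E)%N -> nth h E k (join x z) = 0) /\ h (join x z) != 0 in
  generically S \/ generically (fun x => ~ S x).
Proof.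
move=> pE ph S.
have [f rf fE] : exists2 f : GRing.formula C, GRing.rformula f & forall e,
    GRing.holds e f <-> (forall k, (k < size E)%N -> nth h E k (@envjoin n m e) = 0).
  elim: E pE {S} => [|f1 E IHE] pE.
    by exists (GRing.Bool true).
  have [f rf fE] := IHE (fun k kE => pE k.+1 kE).
  have [t rt tE] := polyfun_term (pE 0%N isT).
  exists (GRing.And (GRing.Equal t (GRing.Const 0)) f); first by rewrite /= rt.
  move=> e; rewrite /= tE; split=> [[e0 /fE ef] [|k]//|ef]; first by move=> /ef.
  split; first exact: (ef 0%N isT).
  by apply/fE => k kE; apply: (ef k.+1).
have [t rt tE] := polyfun_term ph.
pose F := foldr (GRing.Exists (R:=C))
  (GRing.And f (GRing.Not (GRing.Equal t (GRing.Const 0)))) (iota n m).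
have rF : GRing.rformula F.
  by rewrite /F; elim: (iota n m) => //=; rewrite rf rt.
have FP x : GRing.holds (env x) F <-> S x.
  rewrite /F -GRing.foldExistsP; split=> [[e xe /= [/fE ef te]]|[z [Ez hz]]].
    have ee : @envjoin n m e = join x (fun j => e`_(n + j)).
      apply/funext => -[i|j] //=; rewrite -xe ?nth_env ?valK //.
      by rewrite !inE mem_iota negb_and -ltnNge ltn_ord.
    exists (fun j => e`_(n + j)); rewrite -ee; split=> //.
    by apply/eqP; rewrite -tE.
  exists (env x ++ env z).
    move=> i; rewrite !inE mem_iota negb_and -ltnNge -leqNgt.
    move=> /orP[ni|ni]; rewrite nth_cat size_env; first by rewrite ni.
    have ni' : (n <= i)%N by apply: leq_trans ni; rewrite leq_addr.
    rewrite ltnNge ni' /= !nth_default ?size_env //.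
    by rewrite -(leq_add2l n) subnKC.
  have ee : @envjoin n m (env x ++ env z) = join x z.
    apply/funext => -[i|j] /=; rewrite nth_cat size_env.
      by rewrite ltn_ord nth_env valK.
    by rewrite ltnNge leq_addr /= addKn nth_env valK.
  split; first by apply/fE => k kE; rewrite ee; exact: Ez.
  by rewrite /= tE ee; apply/eqP.
have cl : GRing.closed_field_axiom C by apply: solve_monicpoly.
pose G := GRing.quantifier_elim (@ClosedFieldQE.ex_elim C) F.
have /andP[qG rG] := GRing.quantifier_elim_wf (@ClosedFieldQE.wf_ex_elim C) rF.
have GP e := GRing.quantifier_elim_rformP (@ClosedFieldQE.wf_ex_elim C)
  (ClosedFieldQE.holds_ex_elim cl) e rF.
have [[] gG] := @qf_eval_generically n G qG rG.
  by left; apply: generically_imp gG => x /GP/FP.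
by right; apply: generically_imp gG => x; rewrite -/G => Gx /FP/GP; rewrite -/G Gx.
Qed.

(** A set contained in finitely many images of affine spaces of dimension less
than n under polynomial maps lies in a hypersurface. The affine spaces are
given by letting the coordinates in s vary and fixing the others. *)
Lemma generically_notin_image n (I : eqType) (s : seq I) (x0 : I -> C)
    (F : 'I_n -> (I -> C) -> C) : (size s < n)%N ->
  (forall k, polyfun (F k)) ->
  generically (fun y => ~ exists2 x, (forall i, i \notin s -> x i = x0 i) &
                              forall k, y k = F k x).
Proof.
move=> sn pF.
pose ext (z : 'I_(size s) -> C) (i : I) : C :=
  if insub (index i s) is Some j then z j else x0 i.
have pext i : polyfun (ext^~ i).
  by rewrite /ext; case: insub => [j|]; [exact: polyfun_var|exact: polyfun_cst].
have /choice[f fE] k : exists f : mpoly (size s) C, forall z, F k (ext z) = meval z f.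
  by apply: (@polyfunP _ _ (F k \o ext)); exact: polyfun_comp.
have [P P0 PE] := algebraic_dependence f sn.
exists (fun y => meval y P); split; first exact: polyfun_meval.
  exact: meval_neq0.
move=> y /eqP Py [x xs yF]; apply: Py.
pose z (j : 'I_(size s)) := x (tnth (in_tuple s) j).
have xE : x = ext z.
  apply/funext => i; rewrite /ext; case: insubP => [j _ ji|].
    rewrite /z (tnth_nth i) ji /= nth_index //.
    by rewrite -index_mem -ji ltn_ord.
  by rewrite index_mem; apply: xs.
by rewrite -(PE z); apply: meval_eq => k; rewrite yF xE fE.
Qed.

End Generically.

(** * Forms with cubic coefficients *)

Notation dX := (@Ordinal 3 0 isT).
Notation dY := (@Ordinal 3 1 isT).
Notation dZ := (@Ordinal 3 2 isT).
Notation XXX := (@Ordinal 10 0 isT).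
Notation XXY := (@Ordinal 10 1 isT).
Notation XXZ := (@Ordinal 10 2 isT).
Notation XYY := (@Ordinal 10 3 isT).
Notation XYZ := (@Ordinal 10 4 isT).
Notation XZZ := (@Ordinal 10 5 isT).
Notation YYY := (@Ordinal 10 6 isT).
Notation YYZ := (@Ordinal 10 7 isT).
Notation YZZ := (@Ordinal 10 8 isT).
Notation ZZZ := (@Ordinal 10 9 isT).

Section CubicForms.
Variable C : numClosedFieldType.

Lemma sum3E (V : nmodType) (F : 'I_3 -> V) : \sum_(i < 3) F i = F dX + F dY + F dZ.
Proof.
by rewrite !big_ord_recr big_ord0 /= add0r; congr (F _ + F _ + F _); apply: val_inj.
Qed.

Lemma prod3E (F : 'I_3 -> C) : \prod_(i < 3) F i = F dX * F dY * F dZ.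
Proof.
by rewrite !big_ord_recr big_ord0 /= mul1r; congr (F _ * F _ * F _); apply: val_inj.
Qed.

Lemma forall3 (P : 'I_3 -> Prop) : P dX -> P dY -> P dZ -> forall i, P i.
Proof.
by move=> P0 P1 P2 [[|[|[|//]]] h]; [move: P0|move: P1|move: P2];
  congr P; apply: val_inj.
Qed.

Lemma forall10 (P : 'I_10 -> Prop) : P XXX -> P XXY -> P XXZ -> P XYY -> P XYZ ->
  P XZZ -> P YYY -> P YYZ -> P YZZ -> P ZZZ -> forall i, P i.
Proof.
move=> P0 P1 P2 P3 P4 P5 P6 P7 P8 P9 [[|[|[|[|[|[|[|[|[|[|//]]]]]]]]]] h];
  [move: P0|move: P1|move: P2|move: P3|move: P4|move: P5|move: P6|move: P7
  |move: P8|move: P9]; congr P; exact: val_inj.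
Qed.

Definition cub (c : 'I_10 -> C) (x y z : C) : C :=
  c XXX * x ^+ 3 + c XXY * (x ^+ 2 * y) + c XXZ * (x ^+ 2 * z) +
  c XYY * (x * y ^+ 2) + c XYZ * (x * y * z) + c XZZ * (x * z ^+ 2) +
  c YYY * y ^+ 3 + c YYZ * (y ^+ 2 * z) + c YZZ * (y * z ^+ 2) + c ZZZ * z ^+ 3.

(** Each coefficient of a ternary cubic is recovered from finitely many values; this
inverts the evaluation map, so that identities between forms reduce to identities
between functions. *)
Definition cubcoef (f : C -> C -> C -> C) (k : 'I_10) : C :=
  let f0 := f 1 0 0 in let f6 := f 0 1 0 in let f9 := f 0 0 1 in
  let f1 := (f 1 1 0 - f 1 (-1) 0) / 2 - f6 in
  let f3 := (f 1 1 0 + f 1 (-1) 0) / 2 - f0 in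
  let f2 := (f 1 0 1 - f 1 0 (-1)) / 2 - f9 in
  let f5 := (f 1 0 1 + f 1 0 (-1)) / 2 - f0 in
  let f7 := (f 0 1 1 - f 0 1 (-1)) / 2 - f9 in
  let f8 := (f 0 1 1 + f 0 1 (-1)) / 2 - f6 in
  let f4 := f 1 1 1 - (f0 + f1 + f2 + f3 + f5 + f6 + f7 + f8 + f9) in
  [:: f0; f1; f2; f3; f4; f5; f6; f7; f8; f9]`_k.

Lemma two_neq0 : 2 != 0 :> C. Proof. by rewrite pnatr_eq0. Qed.

Lemma cub_comp c (g11 g12 g13 g21 g22 g23 g31 g32 g33 : C) x y z :
 let f x y z := cub c (g11 * x + g12 * y + g13 * z) (g21 * x + g22 * y + g23 * z)
    (g31 * x + g32 * y + g33 * z) in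
 cub (cubcoef f) x y z = f x y z.
Proof.
have := two_neq0; rewrite /cub /cubcoef /=.
move: (c XXX) (c XXY) (c XXZ) (c XYY) (c XYZ) (c XZZ) (c YYY) (c YYZ) (c YZZ) (c ZZZ).
by move=> c0 c1 c2 c3 c4 c5 c6 c7 c8 c9 t; field.
Qed.

Lemma cubcoef_cub c : cubcoef (cub c) =1 c.
Proof. by have := two_neq0 => t; apply: forall10; rewrite /cubcoef /cub /=; field. Qed.

Lemma cubcoefD f g k :
  cubcoef (fun x y z => f x y z + g x y z) k = cubcoef f k + cubcoef g k.
Proof.
by have := two_neq0 => t; move: k; apply: forall10; rewrite /cubcoef /=; field.
Qed.

Lemma cubcoefZ s f k : cubcoef (fun x y z => s * f x y z) k = s * cubcoef f k.
Proof.
by have := two_neq0 => t; move: k; apply: forall10; rewrite /cubcoef /=; field.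
Qed.

Definition vec3 (x y z : C) : 'cV[C]_3 := \col_i [:: x; y; z]`_i.

(** The value at a point of the form with coefficients w, as a row vector. *)
Definition ev (w : 'M[C]_(3, 10)) (v : 'cV[C]_3) : 'rV[C]_3 :=
  \row_i cub (w i) (v dX 0) (v dY 0) (v dZ 0).

(** The form that takes given values, provided that some form does. *)
Definition mkform (F : 'cV[C]_3 -> 'rV[C]_3) : 'M[C]_(3, 10) :=
  \matrix_(i, k) cubcoef (fun x y z => F (vec3 x y z) 0 i) k.

(** The maps that are values of a form. *)
Definition cubic (F : 'cV[C]_3 -> 'rV[C]_3) : Prop := ev (mkform F) =1 F.

Lemma mkform_ev w : mkform (ev w) = w.
Proof.
apply/matrixP => i k; rewrite mxE -[RHS](cubcoef_cub (w i)).
congr (cubcoef _ k); apply/funext => x; apply/funext => y; apply/funext => z.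
by rewrite !mxE.
Qed.

Lemma ev_inj w w' : ev w =1 ev w' -> w = w'.
Proof. by move=> /funext e; rewrite -(mkform_ev w) e mkform_ev. Qed.

Lemma mkformD F G : mkform (fun v => F v + G v) = mkform F + mkform G.
Proof.
apply/matrixP => i k; rewrite !mxE -cubcoefD; congr (cubcoef _ k).
by apply/funext => x; apply/funext => y; apply/funext => z; rewrite mxE.
Qed.

Lemma mkformZ s F : mkform (fun v => s *: F v) = s *: mkform F.
Proof.
apply/matrixP => i k; rewrite !mxE -cubcoefZ; congr (cubcoef _ k).
by apply/funext => x; apply/funext => y; apply/funext => z; rewrite mxE.
Qed.

Lemma evD w w' v : ev (w + w') v = ev w v + ev w' v.
Proof. by apply/rowP => i; rewrite !mxE /cub !mxE; ring. Qed.

Lemma evZ s w v : ev (s *: w) v = s *: ev w v.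
Proof. by apply/rowP => i; rewrite !mxE /cub !mxE; ring. Qed.

Lemma cubic_ev w : cubic (ev w).
Proof. by move=> v; rewrite mkform_ev. Qed.

Lemma cubicD F G : cubic F -> cubic G -> cubic (fun v => F v + G v).
Proof. by move=> cF cG v; rewrite mkformD evD cF cG. Qed.

Lemma cubicZ s F : cubic F -> cubic (fun v => s *: F v).
Proof. by move=> cF v; rewrite mkformZ evZ cF. Qed.

Lemma cubic_comp w (g : 'M[C]_3) : cubic (fun v => ev w (g *m v)).
Proof.
move=> v; apply/rowP => i; rewrite mxE.
have -> : mkform (fun v => ev w (g *m v)) i = cubcoef (fun x y z =>
    cub (w i) (g dX dX * x + g dX dY * y + g dX dZ * z)
      (g dY dX * x + g dY dY * y + g dY dZ * z)
      (g dZ dX * x + g dZ dY * y + g dZ dZ * z)).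
  apply/funext => k; rewrite mxE; congr (cubcoef _ k).
  apply/funext => x; apply/funext => y; apply/funext => z.
  by rewrite !mxE !sum3E !mxE.
by rewrite cub_comp !mxE !sum3E.
Qed.

Lemma cubic_mul F (g : 'M[C]_3) : cubic F -> cubic (fun v => F v *m g).
Proof.
move=> cF v; apply/rowP => i; rewrite [RHS]mxE -(cF v).
have gE k : mkform (fun v => F v *m g) i k = \sum_j g j i * mkform F j k.
  rewrite mxE sum3E 3!(mxE _ _ _ k) -!cubcoefZ -!cubcoefD; congr (cubcoef _ k).
  apply/funext => x; apply/funext => y; apply/funext => z.
  by rewrite mxE sum3E !(mulrC (F _ _ _)).
by rewrite !sum3E ![ev _ _ _ _]mxE /cub !gE !sum3E; ring.
Qed.

(** Pullback by the linear map v |-> g v. *)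
Definition act (g : 'M[C]_3) (w : 'M[C]_(3, 10)) : 'M[C]_(3, 10) :=
  mkform (fun v => ev w (g *m v) *m g).

Lemma ev_act g w v : ev (act g w) v = ev w (g *m v) *m g.
Proof. exact: (cubic_mul g (@cubic_comp w g) v). Qed.

Lemma actM g h w : act g (act h w) = act (h *m g) w.
Proof. by apply: ev_inj => v; rewrite !ev_act !mulmxA. Qed.

Lemma act1 w : act 1%:M w = w.
Proof. by apply: ev_inj => v; rewrite ev_act mul1mx mulmx1. Qed.

Lemma actK g : g \in unitmx -> cancel (act g) (act (invmx g)).
Proof. by move=> gu w; rewrite actM mulmxV // act1. Qed.

Lemma actVK g : g \in unitmx -> cancel (act (invmx g)) (act g).
Proof. by move=> gu w; rewrite actM mulVmx // act1. Qed.

Lemma actD g w w' : act g (w + w') = act g w + act g w'.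
Proof. by apply: ev_inj => v; rewrite evD !ev_act evD mulmxDl. Qed.

Lemma actZ g s w : act g (s *: w) = s *: act g w.
Proof. by apply: ev_inj => v; rewrite evZ !ev_act evZ scalemxAl. Qed.

(** Cubic coefficients and the differential contribute degrees 3 and 1. *)
Lemma act_scalar s w : act s%:M w = s ^+ 4 *: w.
Proof.
apply: ev_inj => v; rewrite ev_act evZ mul_scalar_mx mul_mx_scalar.
by apply/rowP => i; rewrite !mxE /cub; ring.
Qed.

(** The entry of the form along monomial k, under a diagonal change of
coordinates, is multiplied by the value of the monomial k times that of the
coordinate whose differential it multiplies. *)
Definition mono (k : 'I_10) (x y z : C) : C :=
  [:: x ^+ 3; x ^+ 2 * y; x ^+ 2 * z; x * y ^+ 2; x * y * z; x * z ^+ 2;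
      y ^+ 3; y ^+ 2 * z; y * z ^+ 2; z ^+ 3]`_k.

Definition diag3 (x y z : C) : 'M[C]_3 := diag_mx (\row_i [:: x; y; z]`_i).

Lemma act_diag x y z w i k :
  act (diag3 x y z) w i k = [:: x; y; z]`_i * mono k x y z * w i k.
Proof.
pose w' : 'M[C]_(3, 10) := \matrix_(i, k) ([:: x; y; z]`_i * mono k x y z * w i k).
rewrite (_ : act _ w = w') ?mxE //.
apply: ev_inj => v; rewrite ev_act; apply/rowP => {}i.
rewrite mxE sum3E !mxE /cub /w' !mxE !sum3E !mxE /mono /=.
by move: i; apply: forall3; rewrite !mulr0n !mulr1n /=; ring.
Qed.

Lemma diag3_unit x y z : x != 0 -> y != 0 -> z != 0 -> diag3 x y z \in unitmx.
Proof.
move=> x0 y0 z0; rewrite unitmxE det_diag unitfE prod3E !mxE /=.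
by rewrite !mulf_neq0.
Qed.

(** Forms of degree two: those that vanish on the radial vector field. *)
Definition radial (w : 'M[C]_(3, 10)) : Prop := forall v, ev w v *m v = 0.

Lemma radial_act g w : radial w -> radial (act g w).
Proof. by move=> rw v; rewrite ev_act -mulmxA rw. Qed.

Lemma radialD w w' : radial w -> radial w' -> radial (w + w').
Proof. by move=> rw rw' v; rewrite evD mulmxDl rw rw' addr0. Qed.

Lemma radialZ s w : radial w -> radial (s *: w).
Proof. by move=> rw v; rewrite evZ -scalemxAl rw scaler0. Qed.

(** Coordinates on the space of radial forms. *)
Definition coord15 (w : 'M[C]_(3, 10)) (l : 'I_15) : C :=
  [:: w dX XXY; w dX XXZ; w dX XYY; w dX XZZ; w dX YYY; w dX ZZZ;
      w dY YYZ; w dY YZZ; w dY ZZZ; w dZ XXY; w dY XXZ; w dX YYZ; w dZ XYY;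
      w dX YZZ; w dY XZZ]`_l.

Definition form15 (x : 'I_15 -> C) : 'M[C]_(3, 10) :=
  let e l := x (inord l) in \matrix_(i, k)
  (nth [::] [::
    [:: 0; e 0%N; e 1%N; e 2%N; - (e 9%N + e 10%N); e 3%N; e 4%N; e 11%N; e 13%N; e 5%N];
    [:: - e 0%N; - e 2%N; e 10%N; - e 4%N; - (e 11%N + e 12%N); e 14%N; 0; e 6%N; e 7%N; e 8%N];
    [:: - e 1%N; e 9%N; - e 3%N; e 12%N; - (e 13%N + e 14%N); - e 5%N; - e 6%N; - e 7%N; - e 8%N; 0]] i)`_k.

Lemma radial_form15 x : radial (form15 x).
Proof.
move=> v; apply/matrixP => i j; rewrite !ord1 mxE sum3E !mxE /cub !mxE /=.
by rewrite /=; ring.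
Qed.

Lemma lincomb (k a b e : C) : k != 0 -> k * (a - b) = e -> e = 0 -> a = b.
Proof.
by move=> k0 <- /eqP; rewrite mulf_eq0 (negPf k0) subr_eq0 => /eqP.
Qed.

Lemma radial_coord w : radial w -> form15 (coord15 w) = w.
Proof.
move=> rw.
have E x y z : cub (w dX) x y z * x + cub (w dY) x y z * y + cub (w dZ) x y z * z = 0.
  by have := rw (vec3 x y z) => /matrixP/(_ 0 0); rewrite mxE sum3E !mxE.
have lin3 (p q r : C) : p + q + r = 0 -> p - q + r = 0 ->
    2 * p + 4 * q + 8 * r = 0 -> [/\ p = 0, q = 0 & r = 0].
  move=> e1 e2 e3; split.
  - apply: (@lincomb 6 _ _ (6 * (p + q + r) + 2 * (p - q + r) - (2 * p + 4 * q + 8 * r))).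
    + by rewrite pnatr_eq0.
    + by ring.
    + by rewrite e1 e2 e3; ring.
  - apply: (@lincomb 2 _ _ (p + q + r - (p - q + r))); first by rewrite two_neq0.
    + by ring.
    + by rewrite e1 e2; ring.
  - apply: (@lincomb 6 _ _ (2 * p + 4 * q + 8 * r - 3 * (p + q + r) + (p - q + r))).
    + by rewrite pnatr_eq0.
    + by ring.
    + by rewrite e1 e2 e3; ring.
rewrite /cub in E.
have ax : w dX XXX = 0 by rewrite -(E 1 0 0); ring.
have by' : w dY YYY = 0 by rewrite -(E 0 1 0); ring.
have cz : w dZ ZZZ = 0 by rewrite -(E 0 0 1); ring.
have [p1 q1 r1] : [/\ w dX XXY + w dY XXX = 0, w dX XYY + w dY XXY = 0 &
                      w dX YYY + w dY XYY = 0].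
  apply: lin3.
  - by rewrite -(E 1 1 0) ax by'; ring.
  - by rewrite -[RHS]oppr0 -(E 1 (-1) 0) ax by'; ring.
  - by rewrite -(E 1 2 0) ax by'; ring.
have [p2 q2 r2] : [/\ w dX XXZ + w dZ XXX = 0, w dX XZZ + w dZ XXZ = 0 &
                      w dX ZZZ + w dZ XZZ = 0].
  apply: lin3.
  - by rewrite -(E 1 0 1) ax cz; ring.
  - by rewrite -[RHS]oppr0 -(E 1 0 (-1)) ax cz; ring.
  - by rewrite -(E 1 0 2) ax cz; ring.
have [p3 q3 r3] : [/\ w dY YYZ + w dZ YYY = 0, w dY YZZ + w dZ YYZ = 0 &
                      w dY ZZZ + w dZ YZZ = 0].
  apply: lin3.
  - by rewrite -(E 0 1 1) by' cz; ring.
  - by rewrite -[RHS]oppr0 -(E 0 1 (-1)) by' cz; ring.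
  - by rewrite -(E 0 1 2) by' cz; ring.
move/eqP: p1; rewrite addrC addr_eq0 => /eqP p1.
move/eqP: q1; rewrite addrC addr_eq0 => /eqP q1.
move/eqP: r1; rewrite addrC addr_eq0 => /eqP r1.
move/eqP: p2; rewrite addrC addr_eq0 => /eqP p2.
move/eqP: q2; rewrite addrC addr_eq0 => /eqP q2.
move/eqP: r2; rewrite addrC addr_eq0 => /eqP r2.
move/eqP: p3; rewrite addrC addr_eq0 => /eqP p3.
move/eqP: q3; rewrite addrC addr_eq0 => /eqP q3.
move/eqP: r3; rewrite addrC addr_eq0 => /eqP r3.
pose p := w dX XYZ + w dY XXZ + w dZ XXY.
pose q := w dX YYZ + w dY XYZ + w dZ XYY.
pose r := w dX YZZ + w dY XZZ + w dZ XYZ.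
have e1 : p + q + r = 0.
  by rewrite -(E 1 1 1) ax by' cz p1 q1 r1 p2 q2 r2 p3 q3 r3 /p /q /r; ring.
have e2 : p - q - r = 0.
  by rewrite -(E (-1) 1 1) ax by' cz p1 q1 r1 p2 q2 r2 p3 q3 r3 /p /q /r; ring.
have e3 : - p + q - r = 0.
  by rewrite -(E 1 (-1) 1) ax by' cz p1 q1 r1 p2 q2 r2 p3 q3 r3 /p /q /r; ring.
have p0 : p = 0.
  by apply: (@lincomb 2 _ _ (p + q + r + (p - q - r)) two_neq0);
    [ring | rewrite e1 e2; ring].
have q0 : q = 0.
  by apply: (@lincomb 2 _ _ (p + q + r + (- p + q - r)) two_neq0);
    [ring | rewrite e1 e3; ring].
have r0 : r = 0 by move: e1; rewrite p0 q0 !add0r.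
have xyz1 : w dX XYZ = - (w dZ XXY + w dY XXZ).
  by rewrite -[RHS]addr0 -p0 /p; ring.
have xyz2 : w dY XYZ = - (w dX YYZ + w dZ XYY).
  by rewrite -[RHS]addr0 -q0 /q; ring.
have xyz3 : w dZ XYZ = - (w dX YZZ + w dY XZZ).
  by rewrite -[RHS]addr0 -r0 /r; ring.
apply/matrixP => i k; rewrite mxE /coord15.
by move: i k; apply: forall3; apply: forall10; rewrite /= ?inordK.
Qed.

End CubicForms.

(** * First order variation of a form *)

Section FirstOrder.
Variable C : numClosedFieldType.
Lemma coord15_form15 (x : 'I_15 -> C) : coord15 (form15 x) = x.
Proof.
apply/funext => -[l hl]; rewrite /coord15 /=.
have E k (hk : (k < 15)%N) : x (inord k) = x (Ordinal hk).
  by congr x; apply: val_inj; rewrite /= inordK.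
do 15?[case: l hl => [|l] hl; first by rewrite /= mxE /= E].
by [].
Qed.

Implicit Types w : 'M[C]_(3, 10).

Lemma coord15D w w' l : coord15 (w + w') l = coord15 w l + coord15 w' l.
Proof. by case: l => l hl; rewrite /coord15 /=; do 15?[case: l hl => [|l] hl; first by rewrite /= mxE]. Qed.

Lemma coord15Z s w l : coord15 (s *: w) l = s * coord15 w l.
Proof. by case: l => l hl; rewrite /coord15 /=; do 15?[case: l hl => [|l] hl; first by rewrite /= mxE]. Qed.

Definition dcub (c : 'I_10 -> C) (x y z u v t : C) : C :=
  (3 * c XXX * x ^+ 2 + 2 * c XXY * (x * y) + 2 * c XXZ * (x * z) +
   c XYY * y ^+ 2 + c XYZ * (y * z) + c XZZ * z ^+ 2) * u +
  (c XXY * x ^+ 2 + 2 * c XYY * (x * y) + c XYZ * (x * z) +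
   3 * c YYY * y ^+ 2 + 2 * c YYZ * (y * z) + c YZZ * z ^+ 2) * v +
  (c XXZ * x ^+ 2 + c XYZ * (x * y) + 2 * c XZZ * (x * z) +
   c YYZ * y ^+ 2 + 2 * c YZZ * (y * z) + 3 * c ZZZ * z ^+ 2) * t.

(** The derivative of the form at the point v in the direction u. *)
Definition dev w (v u : 'cV[C]_3) : 'rV[C]_3 :=
  \row_i dcub (w i) (v dX 0) (v dY 0) (v dZ 0) (u dX 0) (u dY 0) (u dZ 0).

Lemma ev_taylor w (v u : 'cV[C]_3) s :
  ev w (v + s *: u) = ev w v + s *: dev w v u + s ^+ 2 *: dev w u v + s ^+ 3 *: ev w u.
Proof. by apply/rowP => i; rewrite !mxE /cub /dcub; ring. Qed.

(** The derivative at s = 0 of the pullback of w by 1 + s N. *)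
Definition act1_deriv (N : 'M[C]_3) w : 'M[C]_(3, 10) :=
  mkform (fun v => dev w v (N *m v) + ev w v *m N).

Lemma act_taylor N w : exists E2 E3 E4 : 'M[C]_(3, 10), forall s,
  act (1%:M + s *: N) w =
  w + s *: act1_deriv N w + s ^+ 2 *: E2 + s ^+ 3 *: E3 + s ^+ 4 *: E4.
Proof.
pose F2 v := dev w (N *m v) v + dev w v (N *m v) *m N.
pose F3 v := ev w (N *m v) + dev w (N *m v) v *m N.
pose F4 v := ev w (N *m v) *m N.
exists (mkform F2), (mkform F3), (mkform F4) => s.
rewrite -{2}[w]mkform_ev -!mkformZ -!mkformD; congr mkform; apply/funext => v.
rewrite mulmxDl mul1mx -scalemxAl ev_taylor mulmxDr mulmx1 -scalemxAr.
by apply/rowP => i; rewrite /F2 /F3 /F4 !mxE !sum3E !mxE; ring.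
Qed.

Lemma ev_act1_deriv N w v :
  ev (act1_deriv N w) v = dev w v (N *m v) + ev w v *m N.
Proof.
apply: (@cubicD _ (fun v => dev w v (N *m v)) (fun v => ev w v *m N)); last first.
  exact: (cubic_mul N (@cubic_ev _ w)).
have -> : (fun v => dev w v (N *m v)) = (fun v =>
    (2^-1 *: ev w ((1%:M + N) *m v) + (- 2^-1) *: ev w ((1%:M - N) *m v)) +
    (-1) *: ev w (N *m v)).
  apply/funext => {}v; have t2 := two_neq0 C.
  have -> : (1%:M + N) *m v = v + 1 *: (N *m v) by rewrite mulmxDl mul1mx scale1r.
  have -> : (1%:M - N) *m v = v + (-1) *: (N *m v).
    by rewrite mulmxBl mul1mx scaleN1r.
  rewrite !ev_taylor.
  by apply/rowP => i; rewrite !mxE; field.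
apply: cubicD; last by apply: cubicZ; apply: cubic_comp.
by apply: cubicD; apply: cubicZ; apply: cubic_comp.
Qed.

(** Differentiating the identity W(v) v = 0. *)
Lemma dev_radial w v u : radial w -> dev w v u *m v + ev w v *m u = 0.
Proof.
move=> /radial_coord <-; apply/matrixP => i j.
rewrite !ord1 !mxE !sum3E !mxE /cub /dcub !mxE /=; ring.
Qed.

End FirstOrder.

(** * Singular points and invariant lines *)

Section JetsAndFlags.
Variable C : numClosedFieldType.
Implicit Types (w : 'M[C]_(3, 10)) (g : 'M[C]_3).

Lemma polyfun_cub I (W : (I -> C) -> 'I_10 -> C) (f1 f2 f3 : (I -> C) -> C) :
  (forall k, polyfun (fun x => W x k)) -> polyfun f1 -> polyfun f2 -> polyfun f3 ->
  polyfun (fun x => cub (W x) (f1 x) (f2 x) (f3 x)).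
Proof.
by move=> pW p1 p2 p3; do !apply: polyfun_add; apply: polyfun_mul => //;
  do ?apply: polyfun_mul => //; apply: polyfun_exp.
Qed.

Lemma polyfun_cubcoef I (f : (I -> C) -> C -> C -> C -> C) k :
  (forall a b c, polyfun (fun x => f x a b c)) -> polyfun (fun x => cubcoef (f x) k).
Proof.
move=> pf; move: k; apply: forall10; rewrite /cubcoef /=;
  repeat first [ apply: pf | apply: polyfun_cst | apply: polyfun_sub
               | apply: polyfun_add | apply: polyfun_mul ].
Qed.

Lemma polyfun_act I (G : (I -> C) -> 'M[C]_3) (W : (I -> C) -> 'M[C]_(3, 10)) :
  (forall i j, polyfun (fun x => G x i j)) ->
  (forall i k, polyfun (fun x => W x i k)) ->
  forall i k, polyfun (fun x => act (G x) (W x) i k).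
Proof.
move=> pG pW i k.
apply: (@polyfun_eq _ _ (fun x => cubcoef (fun a b c =>
    (ev (W x) (G x *m vec3 a b c) *m G x) 0 i) k)); last by move=> x; rewrite mxE.
apply: polyfun_cubcoef => a b c.
apply: (polyfun_mulmx (F := fun x => ev (W x) (G x *m vec3 a b c))) => // j l.
apply: (@polyfun_eq _ _ (fun x => cub (W x l) ((G x *m vec3 a b c) dX 0)
   ((G x *m vec3 a b c) dY 0) ((G x *m vec3 a b c) dZ 0))); last first.
  by move=> x; rewrite [RHS]mxE.
by apply: polyfun_cub => //; apply: (polyfun_mulmx (F := G)) => // j' l';
  exact: polyfun_cst.
Qed.

Lemma polyfun_form15 I (f : (I -> C) -> 'I_15 -> C) :
  (forall l, polyfun (f^~ l)) ->
  forall i k, polyfun (fun x => form15 (f x) i k).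
Proof.
move=> pf i k.
suff p15 : polyfun (fun x : 'I_15 -> C => form15 x i k).
  exact: (polyfun_comp p15 pf).
move: i k; apply: forall3; apply: forall10;
  (eapply polyfun_eq; [ | intro x; rewrite mxE /=; reflexivity ]);
  repeat first [ apply: polyfun_var | apply: polyfun_cst | apply: polyfun_opp | apply: polyfun_add ].
Qed.

Lemma polyfun_coord15 I (W : (I -> C) -> 'M[C]_(3, 10)) :
  (forall i k, polyfun (fun x => W x i k)) ->
  forall l, polyfun (fun x => coord15 (W x) l).
Proof.
move=> pW [l hl]; rewrite /coord15 /=.
by do 15?[case: l hl => [|l] hl; first by exact: pW].
Qed.

(** The entries at the monomials divisible by x^2 make up the first jet of the form
at (1, 0, 0). *)
Lemma XXX_ev w i : w i XXX = ev w (vec3 1 0 0) 0 i.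
Proof. by rewrite !mxE /cub ?mxE /=; ring. Qed.

Lemma XXY_dev w i : w i XXY = dev w (vec3 1 0 0) (vec3 0 1 0) 0 i.
Proof. by rewrite !mxE /dcub ?mxE /=; ring. Qed.

Lemma XXZ_dev w i : w i XXZ = dev w (vec3 1 0 0) (vec3 0 0 1) 0 i.
Proof. by rewrite !mxE /dcub ?mxE /=; ring. Qed.

Lemma dev_act g w v u : dev (act g w) v u = dev w (g *m v) (g *m u) *m g.
Proof.
have E w' v' u' : dev w' v' u' =
    2^-1 *: (ev w' (v' + 1 *: u') + (-1) *: ev w' (v' + (-1) *: u')) - ev w' u'.
  have t2 := two_neq0 C; rewrite !ev_taylor.
  by apply/rowP => i; rewrite !mxE; field.
rewrite !E !ev_act !(mulmxDr, mulmxN, =^~ scalemxAr).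
by rewrite mulmxBl -scalemxAl mulmxDl -scalemxAl.
Qed.

(** The point (1, 0, 0) is singular and the direction of z = 0 is an
eigendirection of the linear part at that point. *)
Definition flag_singular w : Prop := [/\ w dY XXX = 0, w dZ XXX = 0 & w dY XXY = 0].

Lemma flag_jet w : radial w -> flag_singular w ->
  [/\ w dX XXX = 0, w dX XXY = 0 & w dX XXZ = 0].
Proof.
move=> rw [b0 c0 _].
have E := radial_coord rw.
have e1 : w dX XXX = 0 by rewrite -E mxE.
have e2 : w dY XXX = - w dX XXY by rewrite -{1}E mxE /= /coord15 /= inordK.
have e3 : w dZ XXX = - w dX XXZ by rewrite -{1}E mxE /= /coord15 /= inordK.
by split=> //; apply/eqP; rewrite -oppr_eq0 -?e2 -?e3 ?b0 ?c0.
Qed.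

(** An upper triangular change of coordinates preserves the flag formed by the point
(1, 0, 0) and the line z = 0, and multiplies both eigenvalues at the point by the
same factor. *)
Lemma act_upper_jet g w : radial w -> flag_singular w ->
  g dY dX = 0 -> g dZ dX = 0 -> g dZ dY = 0 ->
  [/\ flag_singular (act g w),
      act g w dZ XXY = g dX dX ^+ 2 * g dY dY * g dZ dZ * w dZ XXY &
      act g w dY XXZ = g dX dX ^+ 2 * g dY dY * g dZ dZ * w dY XXZ].
Proof.
move=> rw fw g10 g20 g21; have [a0 a1 a2] := flag_jet rw fw.
have [b0 c0 b1] := fw.
split; first split.
- by rewrite XXX_ev ev_act !(mxE, sum3E) /cub ?(mxE, sum3E) /= g10 g20 a0 b0 c0; ring.
- by rewrite XXX_ev ev_act !(mxE, sum3E) /cub ?(mxE, sum3E) /= g10 g20 a0 b0 c0; ring.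
- rewrite XXY_dev dev_act !(mxE, sum3E) /dcub ?(mxE, sum3E) /= g10 g20 g21 a0 a1 b0 c0 b1.
  by ring.
- rewrite XXY_dev dev_act !(mxE, sum3E) /dcub ?(mxE, sum3E) /= g10 g20 g21 a0 a1 b0 c0 b1.
  by ring.
- rewrite XXZ_dev dev_act !(mxE, sum3E) /dcub ?(mxE, sum3E) /= g10 g20 g21 a0 a1 a2 b0 c0 b1.
  by ring.
Qed.

(** The restriction of a radial form to the line z = 0 is determined by these
coefficients. *)
Definition line_invariant w : Prop := [/\ w dX XXY = 0, w dX XYY = 0 & w dX YYY = 0].

End JetsAndFlags.

Section InvariantLines.
Variable C : numClosedFieldType.
Implicit Types (w : 'M[C]_(3, 10)) (g : 'M[C]_3).

Lemma line_invariantP w : radial w -> line_invariant w <->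
  forall x y, (ev w (vec3 x y 0) 0 dX = 0) /\ (ev w (vec3 x y 0) 0 dY = 0).
Proof.
move=> rw; split; last first.
  move=> E; have {}E x y : cub (w dX) x y 0 = 0.
    by have [+ _] := E x y; rewrite !mxE.
  have t2 := two_neq0 C.
  by split; rewrite -(cubcoef_cub (w dX)) /cubcoef /= !E; field.
move: rw => /radial_coord <-; move: (coord15 w) => {w} c.
move=> [e1 e2 e3] x y.
move: e1 e2 e3; rewrite !(mxE, sum3E) /cub ?mxE /= => -> -> ->.
by split; ring.
Qed.

Lemma line_invariant_act g w : radial w -> line_invariant w ->
  g dZ dX = 0 -> g dZ dY = 0 -> line_invariant (act g w).
Proof.
move=> rw lw g20 g21; apply/line_invariantP; first exact: radial_act.
move=> x y; rewrite ev_act; have /(line_invariantP rw) L := lw.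
have -> : g *m vec3 x y 0 = vec3 (g dX dX * x + g dX dY * y) (g dY dX * x + g dY dY * y) 0.
  apply/matrixP => i j; rewrite ord1 !mxE sum3E !mxE /=.
  by move: i; apply: forall3; rewrite /= ?g20 ?g21; ring.
move: (g dX dX * x + _) (g dY dX * x + _) => x' y'; have [e1 e2] := L x' y'.
by rewrite !(mxE _ _ _ dX) !(mxE _ _ _ dY) !sum3E e1 e2 g20 g21; split; ring.
Qed.

Definition lower3 (a b c : C) : 'M[C]_3 :=
  \matrix_(i, j) (nth [::] [:: [:: 1; 0; 0]; [:: a; 1; 0]; [:: b; c; 1]] i)`_j.

Lemma lup_exists n (A : 'M[C]_n.+1) : exists (s : 'S_n.+1) (L U : 'M[C]_n.+1),
  [/\ forall i j : 'I_n.+1, (i <= j)%N -> L i j = (i == j)%:R,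
      forall i j : 'I_n.+1, (j < i)%N -> U i j = 0 &
      perm_mx s *m A = L *m U].
Proof.
move: (cormen_lup_correct A) (cormen_lup_perm A).
move: (@cormen_lup_lower _ _ A) (@cormen_lup_upper _ _ A).
by case: (cormen_lup A) => [[P L] U] /= loL upU PA /is_perm_mxP[s Ps];
  exists s, L, U; rewrite -Ps.
Qed.

(** Every complete flag is opposite to one of the coordinate flags: up to a
permutation of the coordinates, a change of coordinates is the product of one that
preserves the standard flag and of one depending on three parameters. *)
Lemma ul_decomposition g : exists (s : 'S_3) (p : 'M[C]_3) (a b c : C),
  [/\ p dY dX = 0, p dZ dX = 0, p dZ dY = 0 & g = p *m lower3 a b c *m perm_mx s].
Proof.
pose R (M : 'M[C]_3) : 'M[C]_3 := \matrix_(i, j) M (rev_ord i) (rev_ord j).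
have RK M : R (R M) = M by apply/matrixP => i j; rewrite !mxE !rev_ordK.
have RM M N : R (M *m N) = R M *m R N.
  apply/matrixP => i j; rewrite !mxE (reindex_inj rev_ord_inj) /=.
  by apply: eq_bigr => k _; rewrite !mxE.
pose A : 'M[C]_3 := (R g)^T.
have [s [L [U [loL upU PA]]]] := lup_exists A.
have gE : R g = U^T *m L^T *m perm_mx s.
  rewrite -(trmxK (R g)) -/A -trmx_mul -[L *m U]PA trmx_mul tr_perm_mx.
  by rewrite -mulmxA -perm_mxM mulVg perm_mx1 mulmx1.
pose rv := perm (@rev_ord_inj 3).
exists (rv * s * rv)%g, (R U^T), (R L^T dY dX), (R L^T dZ dX), (R L^T dZ dY); split.
- by rewrite !mxE upU.
- by rewrite !mxE upU.
- by rewrite !mxE upU.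
rewrite -[LHS]RK gE !RM; congr (_ *m _ *m _).
  apply/matrixP => i j; move: i j.
  by apply: forall3; apply: forall3; rewrite !mxE //= loL.
apply/matrixP => i j; rewrite !mxE !permM !permE.
by rewrite (inv_eq rev_ordK).
Qed.

(** Every line becomes z = 0 in suitable coordinates. *)
Definition no_invariant_line w : Prop :=
  forall g, g \in unitmx -> ~ line_invariant (act g w).

(** The eigenvalues at (1, 0, 0) are the entry dZ XXY and the opposite of the entry
dY XXZ; they are nonzero and distinct. *)
Definition nonresonant w : Prop := w dZ XXY != 0 /\ w dY XXZ != 0 /\
  w dZ XXY + w dY XXZ != 0.

(** Every flag formed by a singular point and an eigendirection becomes the standard
one in suitable coordinates. *)
Definition simple_singularities w : Prop := forall g, g \in unitmx ->
  flag_singular (act g w) -> nonresonant (act g w).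

Definition no_singularity_on_Z0 w : Prop :=
  forall x y, ev w (vec3 x y 0) = 0 -> x = 0 /\ y = 0.

(** A form with an invariant line is obtained from one for which z = 0 is invariant,
three linear conditions on fifteen coordinates, by moving this line in a family
with two parameters: fourteen parameters in all. *)
Lemma no_invariant_line_generic :
  generically (fun x : 'I_15 -> C => no_invariant_line (form15 x)).
Proof.
(* The variables 15 and 16 are the parameters of the line. *)
pose F (s : 'S_3) (k : 'I_15) (x : nat -> C) : C :=
  coord15 (act (perm_mx s) (act (lower3 0 (x 15%N) (x 16%N)) (form15 (fun l => x l)))) k.
have pF s k : polyfun (F s k).
  apply: polyfun_coord15; apply: polyfun_act => [i j|]; first exact: polyfun_cst.
  apply: polyfun_act => [i j|].
    apply: (@polyfun_eq _ _ (fun x : nat -> C => (nth [::] [:: [:: 1; 0; 0]; [:: 0; 1; 0];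
      [:: x 15%N; x 16%N; 1]] i)`_j)); last by move=> x; rewrite mxE.
    by move: i j; apply: forall3; apply: forall3; rewrite /=;
      first [exact: polyfun_cst | exact: polyfun_var].
  by apply: polyfun_form15 => l; exact: polyfun_var.
pose free := [:: 1; 3; 5; 6; 7; 8; 9; 10; 11; 12; 13; 14; 15; 16]%N.
have := generically_all (enum {: 'S_3})
  (fun s => @generically_notin_image _ _ _ free (fun=> 0) (F s) isT (pF s)).
apply: generically_imp => x xF g gu lg.
have [s [p [a [b [c [p10 p20 p21 gE]]]]]] := ul_decomposition (invmx g).
have rx := radial_form15 x.
have pu : p \in unitmx.
  by have := gu; rewrite -unitmx_inv gE 2!unitmx_mul => /andP[/andP[]].
pose q := p *m lower3 a 0 0.
have lE : lower3 a b c = lower3 a 0 0 *m lower3 0 b c.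
  by apply/matrixP; apply: forall3; apply: forall3; rewrite [RHS]mxE sum3E !mxE /=; ring.
have q20 : q dZ dX = 0 by rewrite /q mxE sum3E !mxE /= p20 p21; ring.
have q21 : q dZ dY = 0 by rewrite /q mxE sum3E !mxE /= p20 p21; ring.
pose y := act q (act g (form15 x)).
have ry : radial y by do 2!apply: radial_act.
have ly : line_invariant y by apply: line_invariant_act => //; apply: radial_act.
have xE : form15 x = act (perm_mx s) (act (lower3 0 b c) y).
  have e1 : g *m (q *m lower3 0 b c *m perm_mx s) = 1%:M.
    by rewrite /q -(mulmxA p) -lE -gE mulmxV.
  by rewrite /y !actM -[LHS]act1 -e1 !mulmxA.
apply: (xF s); first by rewrite mem_enum.
exists (fun n => if n == 15%N then b else if n == 16%N then c else
    if insub n is Some l then coord15 y l else 0).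
  move=> n; case: insubP => [l _ <-|]; last first.
    rewrite -leqNgt; case: eqP => [->//|_]; case: eqP => [->//|//].
  case: ly => l0 l2 l4; case: l => l hl /=; rewrite /coord15 /=.
  by do 15?[case: l hl => [|l] hl //].
move=> k; rewrite -[LHS](congr1 (fun f => f k) (coord15_form15 x)) xE /F /=.
congr (coord15 (act _ (act _ _)) k); rewrite -[LHS]radial_coord //; congr form15.
apply/funext => l; have := ltn_ord l; rewrite !ltn_neqAle => _.
by rewrite !ltn_eqF ?valK // (ltn_trans (ltn_ord l)).
Qed.

End InvariantLines.

Section CountingConditions.
Variable C : numClosedFieldType.
Implicit Types (w : 'M[C]_(3, 10)) (g : 'M[C]_3).

(** A complete flag formed by a singular point and an eigendirection imposes three
conditions, a relation between the eigenvalues a fourth one, and flags depend on three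
parameters: fourteen parameters in all. *)
Lemma simple_singularities_generic :
  generically (fun x : 'I_15 -> C => simple_singularities (form15 x)).
Proof.
pose coord (m n : C) (x : nat -> C) (l : 'I_15) : C :=
  if l == 9%N :> nat then m * x 9%N else if l == 10%N :> nat then n * x 9%N else x l.
(* The variables 15, 16 and 17 are the parameters of the flag. *)
pose F (i : 'S_3 * (C * C)) (k : 'I_15) (x : nat -> C) : C :=
  coord15 (act (perm_mx i.1) (act (lower3 (x 15%N) (x 16%N) (x 17%N))
    (form15 (coord i.2.1 i.2.2 x)))) k.
have pF i k : polyfun (F i k).
  apply: polyfun_coord15; apply: polyfun_act => [i' j|]; first exact: polyfun_cst.
  apply: polyfun_act => [i' j|].
    apply: (@polyfun_eq _ _ (fun x : nat -> C => (nth [::] [:: [:: 1; 0; 0]; [:: x 15%N; 1; 0];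
      [:: x 16%N; x 17%N; 1]] i')`_j)); last by move=> x; rewrite mxE.
    by move: i' j; apply: forall3; apply: forall3; rewrite /=;
      first [exact: polyfun_cst | exact: polyfun_var].
  apply: polyfun_form15 => l; rewrite /coord.
  case: (nat_of_ord l == 9%N); last case: (nat_of_ord l == 10%N).
  - by apply: polyfun_mul; [exact: polyfun_cst | exact: polyfun_var].
  - by apply: polyfun_mul; [exact: polyfun_cst | exact: polyfun_var].
  - exact: polyfun_var.
pose free := [:: 3; 4; 5; 6; 7; 8; 9; 11; 12; 13; 14; 15; 16; 17]%N.
(* The ratios of dZ XXY and dY XXZ for the three ways of being resonant. *)
pose cases : seq (C * C) := [:: (0, 1); (1, 0); (1, -1)].
have := generically_all [seq (s, c) | s <- enum {: 'S_3}, c <- cases]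
  (fun i => @generically_notin_image _ _ _ free (fun=> 0) (F i) isT (pF i)).
apply: generically_imp => x xF g gu fg.
have [s [p [a [b [c [p10 p20 p21 gE]]]]]] := ul_decomposition (invmx g).
have rx := radial_form15 x.
pose y := act p (act g (form15 x)).
have ry : radial y by do 2!apply: radial_act.
have rg : radial (act g (form15 x)) by apply: radial_act.
have [fy y1 y2] := act_upper_jet rg fg p10 p20 p21; rewrite -/y in fy y1 y2.
have [y0a y1a y2a] := flag_jet ry fy; have [y0b y0c y1b] := fy.
have y3a : y dX XYY = 0.
  have -> : y dX XYY = - y dY XXY by rewrite -(radial_coord ry) !mxE /= opprK.
  by rewrite y1b oppr0.
have xE : form15 x = act (perm_mx s) (act (lower3 a b c) y).
  have e1 : g *m (p *m lower3 a b c *m perm_mx s) = 1%:M by rewrite -gE mulmxV.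
  by rewrite /y !actM -[LHS]act1 -e1 !mulmxA.
have bad (m n t : C) : (m, n) \in cases -> y dZ XXY = m * t -> y dY XXZ = n * t -> False.
  move=> mn em en; apply: (xF (s, (m, n))).
    by apply: allpairs_f => //; rewrite mem_enum.
  exists (fun k => if k == 15%N then a else if k == 16%N then b else
    if k == 17%N then c else if k == 9%N then t else if k == 10%N then 0 else
    if insub k is Some l then coord15 y l else 0).
    move=> k; do 4![case: eqP => [->//|_]]; case: eqP => [->//|/eqP].
    case: insubP => [l _ <-|//].
    case: l => l hl /=; rewrite /coord15 /=.
    by do 15?[case: l hl => [|l] hl //]; rewrite ?y1a ?y2a ?y3a.
  move=> k; rewrite -[LHS](congr1 (fun f => f k) (coord15_form15 x)) xE /F /=.
  congr (coord15 (act _ (act _ _)) k); rewrite -[LHS]radial_coord //; congr form15.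
  apply/funext => l; rewrite /coord /=.
  case: eqP => [l9|_]; first by rewrite /coord15 l9.
  case: eqP => [l10|_]; first by rewrite /coord15 l10.
  have ll := ltn_ord l.
  by rewrite !ltn_eqF ?valK // (ltn_trans ll).
split; [|split]; apply/eqP => e.
- by apply: (bad 0 1 (y dY XXZ)); rewrite ?inE ?eqxx // ?y1 ?e; ring.
- by apply: (bad 1 0 (y dZ XXY)); rewrite ?inE ?eqxx ?orbT // ?y2 ?e; ring.
- apply: (bad 1 (-1) (y dZ XXY)); rewrite ?inE ?eqxx ?orbT //; first by ring.
  by rewrite y1 y2 -(addKr (act g (form15 x) dZ XXY) (act g (form15 x) dY XXZ)) e; ring.
Qed.

(** A singular point imposes two conditions and a point of z = 0 depends on one
parameter; the point (0, 1, 0), which is not in the family used, is excluded by the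
nonvanishing of the coefficient of y^3 dx. *)
Lemma no_singularity_on_Z0_generic :
  generically (fun x : 'I_15 -> C => no_singularity_on_Z0 (form15 x)).
Proof.
(* The variable 15 is the parameter of the point. *)
pose F (k : 'I_15) (x : nat -> C) : C :=
  coord15 (act (lower3 (x 15%N) 0 0) (form15 (fun l => x l))) k.
have pF k : polyfun (F k).
  apply: polyfun_coord15; apply: polyfun_act => [i' j|].
    apply: (@polyfun_eq _ _ (fun x : nat -> C => (nth [::] [:: [:: 1; 0; 0]; [:: x 15%N; 1; 0];
      [:: 0; 0; 1]] i')`_j)); last by move=> x; rewrite mxE.
    by move: i' j; apply: forall3; apply: forall3; rewrite /=;
      first [exact: polyfun_cst | exact: polyfun_var].
  by apply: polyfun_form15 => l; exact: polyfun_var.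
pose free := [:: 2; 3; 4; 5; 6; 7; 8; 9; 10; 11; 12; 13; 14; 15]%N.
have g4 : generically (fun x : 'I_15 -> C => x (inord 4) != 0).
  exists (fun x => x (inord 4)); split=> //; first exact: polyfun_var.
  by exists (fun=> 1); rewrite oner_eq0.
have := generically_and g4
  (@generically_notin_image _ _ _ free (fun=> 0) F isT pF).
apply: generically_imp => u [u4 uF] x y e.
have rw := radial_form15 u; set w := form15 u in e rw *.
have e' i : cub (w i) x y 0 = 0.
  by have /rowP/(_ i) := e; rewrite !mxE.
have a6 : w dX YYY = u (inord 4) by rewrite mxE.
have [x0|x0] := eqVneq x 0.
  split=> //; move: (e' dX); rewrite x0 /cub a6.
  have -> : forall c0 c1 c2 c3 c4 c5 c7 c8 c9 : C, c0 * 0 ^+ 3 + c1 * (0 ^+ 2 * y) +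
     c2 * (0 ^+ 2 * 0) + c3 * (0 * y ^+ 2) + c4 * (0 * y * 0) + c5 * (0 * 0 ^+ 2) +
     u (inord 4) * y ^+ 3 + c7 * (y ^+ 2 * 0) + c8 * (y * 0 ^+ 2) + c9 * 0 ^+ 3 =
     u (inord 4) * y ^+ 3 by move=> *; ring.
  by move/eqP; rewrite mulf_eq0 (negPf u4) expf_eq0 /= => /eqP.
exfalso; apply: uF; pose t := y / x.
have et i : cub (w i) 1 t 0 = 0.
  apply: (mulfI (expf_neq0 3 x0)); rewrite mulr0 -[RHS](e' i) /cub /t; field.
  exact: x0.
pose z := act (lower3 t 0 0) w.
have rz : radial z by apply: radial_act.
have zE : z dY XXX = 0 /\ z dZ XXX = 0.
  have vE : lower3 t 0 0 *m vec3 1 0 0 = vec3 1 t 0.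
    apply/matrixP => i j; rewrite ord1 !mxE sum3E !mxE /=.
    by move: i; apply: forall3; rewrite /=; ring.
  rewrite !XXX_ev ev_act vE.
  have -> : ev w (vec3 1 t 0) = 0 by apply/rowP => i; rewrite !mxE et.
  by rewrite mul0mx !mxE.
have wE : w = act (lower3 (- t) 0 0) z.
  rewrite /z actM [_ *m _](_ : _ = 1%:M) ?act1 //.
  apply/matrixP; apply: forall3; apply: forall3; rewrite mxE sum3E !mxE /=; ring.
exists (fun k => if k == 15%N then - t else if insub k is Some l then coord15 z l else 0).
  move=> k; case: eqP => [->//|_]; case: insubP => [l _ <-|//].
  have z1 : z dX XXY = - z dY XXX by rewrite -(radial_coord rz) !mxE /= opprK.
  have z2 : z dX XXZ = - z dZ XXX by rewrite -(radial_coord rz) !mxE /= opprK.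
  case: zE => zb zc; case: l => l hl /=; rewrite /coord15 /=.
  by do 15?[case: l hl => [|l] hl //]; rewrite ?z1 ?z2 ?zb ?zc oppr0.
move=> k; rewrite -[LHS](congr1 (fun f => f k) (coord15_form15 u)) -/w {1}wE /F /=.
congr (coord15 (act _ _) k); rewrite -[LHS]radial_coord //; congr form15.
apply/funext => l /=; have ll := ltn_ord l.
by rewrite !ltn_eqF ?valK.
Qed.

End CountingConditions.

(** * Eigenframes of a singular point *)

Section FourPoints.
Variable C : numClosedFieldType.
Implicit Types (w y : 'M[C]_(3, 10)) (g : 'M[C]_3).

Lemma generically_solvable_or_not_fin n m (J : finType) (E : J -> ('I_n + 'I_m -> C) -> C) h :
  (forall j, polyfun (E j)) -> polyfun h ->
  let S (x : 'I_n -> C) := exists z : 'I_m -> C,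
    (forall j, E j (join x z) = 0) /\ h (join x z) != 0 in
  generically S \/ generically (fun x => ~ S x).
Proof.
move=> pE ph S; pose s := [seq E j | j <- enum J].
have nthE k : (k < size s)%N -> exists j, nth h s k = E j.
  rewrite /s size_map => ks; case es : (enum J) ks => [//|j0 r] ks.
  by exists (nth j0 (j0 :: r) k); rewrite (nth_map j0).
have Enth j : exists2 k, (k < size s)%N & nth h s k = E j.
  exists (index j (enum J)); first by rewrite size_map index_mem mem_enum.
  by rewrite (nth_map j) ?index_mem ?mem_enum // nth_index ?mem_enum.
have ps k : (k < size s)%N -> polyfun (nth h s k) by move=> /nthE[j ->].
have SE (x : 'I_n -> C) : S x <-> exists z : 'I_m -> C,
    (forall k, (k < size s)%N -> nth h s k (join x z) = 0) /\ h (join x z) != 0.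
  split=> -[z [Ez hz]]; exists z; split=> //.
    by move=> k /nthE[j ->].
  by move=> j; have [k ks <-] := Enth j; apply: Ez.
by case: (generically_solvable_or_not ps ph) => G; [left|right];
  apply: generically_imp G => x /SE.
Qed.

Definition jet_trace w := w dZ XXY - w dY XXZ.
Definition jet_det w := w dY XXY * w dZ XXZ - w dZ XXY * w dY XXZ.

Lemma det3E (A : 'M[C]_3) : \det A =
  A dX dX * (A dY dY * A dZ dZ - A dY dZ * A dZ dY) -
  A dX dY * (A dY dX * A dZ dZ - A dY dZ * A dZ dX) +
  A dX dZ * (A dY dX * A dZ dY - A dY dY * A dZ dX).
Proof.
pose F (i j : nat) := A (inord i) (inord j).
have AE i j : A i j = F i j by rewrite /F !inord_val.
rewrite (expand_det_row A dX) sum3E /cofactor !(expand_det_row _ 0).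
rewrite !big_ord_recl !big_ord0 /cofactor !det_mx11 !mxE !AE /= /bump /=.
by rewrite !(addn0, add0n, add1n, addn1); ring.
Qed.

Lemma radial_jet w : radial w -> [/\ w dX XXX = 0, w dX XXY = - w dY XXX,
  w dX XXZ = - w dZ XXX & w dX XYY = - w dY XXY].
Proof. by move=> rw; rewrite -(radial_coord rw) !mxE /= !opprK. Qed.

(** The linear part at (1, 0, 0) is a bilinear form on the tangent plane, and
changes as such. *)
Lemma act_jet g w : radial w -> w dY XXX = 0 -> w dZ XXX = 0 ->
  g dY dX = 0 -> g dZ dX = 0 ->
  let l p q r s := g dX dX ^+ 2 * ((w dY XXY * p + w dY XXZ * r) * q +
                                   (w dZ XXY * p + w dZ XXZ * r) * s) in
  [/\ act g w dY XXX = 0, act g w dZ XXX = 0,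
      act g w dY XXY = l (g dY dY) (g dY dY) (g dZ dY) (g dZ dY) &
      act g w dZ XXZ = l (g dY dZ) (g dY dZ) (g dZ dZ) (g dZ dZ)] /\
  act g w dZ XXY = l (g dY dY) (g dY dZ) (g dZ dY) (g dZ dZ) /\
  act g w dY XXZ = l (g dY dZ) (g dY dY) (g dZ dZ) (g dZ dY).
Proof.
move=> rw b0 c0 g10 g20.
have [z0 z1 z2 _] := radial_jet rw; rewrite b0 oppr0 in z1; rewrite c0 oppr0 in z2.
split; [split|split].
- by rewrite XXX_ev ev_act !(mxE, sum3E) /cub ?(mxE, sum3E) /= g10 g20 z0 b0 c0; ring.
- by rewrite XXX_ev ev_act !(mxE, sum3E) /cub ?(mxE, sum3E) /= g10 g20 z0 b0 c0; ring.
- by rewrite XXY_dev dev_act !(mxE, sum3E) /dcub ?(mxE, sum3E) /= g10 g20 z0 z1 z2 b0 c0; ring.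
- by rewrite XXZ_dev dev_act !(mxE, sum3E) /dcub ?(mxE, sum3E) /= g10 g20 z0 z1 z2 b0 c0; ring.
- by rewrite XXY_dev dev_act !(mxE, sum3E) /dcub ?(mxE, sum3E) /= g10 g20 z0 z1 z2 b0 c0; ring.
- by rewrite XXZ_dev dev_act !(mxE, sum3E) /dcub ?(mxE, sum3E) /= g10 g20 z0 z1 z2 b0 c0; ring.
Qed.

(** The eigenvectors of the linear part at a singular point are the isotropic
vectors of the quadratic form b1 y^2 + (b2 + c1) y z + c2 z^2. *)
Lemma eigenframe w s : radial w -> w dY XXX = 0 -> w dZ XXX = 0 ->
  w dY XXY != 0 -> s != 0 -> s ^+ 2 = jet_trace w ^+ 2 - 4 * jet_det w ->
  exists u k, [/\ u \in unitmx, k != 0, flag_singular (act u w),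
    act u w dZ XXY = k * (jet_trace w - s) &
    act u w dY XXZ = - k * (jet_trace w + s)].
Proof.
move=> rw b0 c0 b1 s0 sE.
pose m := w dY XXZ + w dZ XXY.
have sE' : s ^+ 2 - (m ^+ 2 - 4 * w dY XXY * w dZ XXZ) = 0.
  by rewrite sE /jet_trace /jet_det /m; ring.
pose u : 'M[C]_3 := \matrix_(i, j) (nth [::] [:: [:: 1; 0; 0];
  [:: 0; - m + s; - m - s]; [:: 0; 2 * w dY XXY; 2 * w dY XXY]] i)`_j.
have u10 : u dY dX = 0 by rewrite mxE.
have u20 : u dZ dX = 0 by rewrite mxE.
have [[f1 f2 f3 _] [f4 f5]] := act_jet rw b0 c0 u10 u20.
exists u, (2 * w dY XXY * s); split.
- rewrite unitmxE unitfE det3E !mxE /=.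
  rewrite (_ : _ + _ = 4 * s * w dY XXY); last by ring.
  by rewrite !mulf_neq0 // pnatr_eq0.
- by rewrite !mulf_neq0 ?two_neq0.
- split=> //; rewrite f3 !mxE /=.
  rewrite -[RHS](mulr0 (w dY XXY)) -sE' /m; ring.
- rewrite f4 !mxE /=; apply/eqP; rewrite -subr_eq0; apply/eqP.
  rewrite -[RHS](mulr0 (w dY XXY)) -sE' /m /jet_trace; ring.
- rewrite f5 !mxE /=; apply/eqP; rewrite -subr_eq0; apply/eqP.
  rewrite -[RHS](mulr0 (w dY XXY)) -sE' /m /jet_trace; ring.
Qed.

End FourPoints.

(** * Forms with four given singular points *)

Section Frames.
Variable C : numClosedFieldType.
Implicit Types (w y : 'M[C]_(3, 10)) (g : 'M[C]_3).

(** The four points (1, 0, 0), (1, 1, 0), (1, 0, 1), (1, 1, 1). *)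
Definition pt_y (i : 'I_4) : C := [:: 0; 1; 0; 1]`_i.
Definition pt_z (i : 'I_4) : C := [:: 0; 0; 1; 1]`_i.
Definition pt i := vec3 1 (pt_y i) (pt_z i).

(** The pullback that brings the i-th point to (1, 0, 0). *)
Definition at_pt i w := act (lower3 (pt_y i) (pt_z i) 0) w.

Lemma lower3_unit (a b c : C) : lower3 a b c \in unitmx.
Proof. by rewrite unitmxE unitfE det3E !mxE /= !(mulr1, mul0r, mulr0, subr0, addr0) oner_eq0. Qed.

Lemma lower3_e1 (a b c : C) : lower3 a b c *m vec3 1 0 0 = vec3 1 a b.
Proof.
apply/matrixP => i j; rewrite ord1 !mxE sum3E !mxE /=.
by move: i; apply: forall3; rewrite /=; ring.
Qed.

Definition vanish4 w := radial w /\ forall i, ev w (pt i) = 0.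

(** It is nonzero when at each of the four points the eigenvalues are nonzero and
distinct with a nonzero sum, the direction of z = 0 is not an eigendirection, and the
quotients tr^2 / det at the four points are distinct. *)
Definition discriminant4 w : C :=
  \prod_(i < 4) (jet_det (at_pt i w) * jet_trace (at_pt i w) * at_pt i w dY XXY *
     (jet_trace (at_pt i w) ^+ 2 - 4 * jet_det (at_pt i w))) *
  \prod_(i < 4) \prod_(j < 4 | i != j)
    (jet_trace (at_pt i w) ^+ 2 * jet_det (at_pt j w) -
     jet_trace (at_pt j w) ^+ 2 * jet_det (at_pt i w)).

Lemma polyfun_discriminant4 I (W : (I -> C) -> 'M[C]_(3, 10)) :
  (forall i k, polyfun (fun x => W x i k)) -> polyfun (fun x => discriminant4 (W x)).
Proof.
move=> pW.
have pA i j k : polyfun (fun x => at_pt i (W x) j k).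
  by apply: polyfun_act => // *; exact: polyfun_cst.
have pt i : polyfun (fun x => jet_trace (at_pt i (W x))) by apply: polyfun_sub.
have pd i : polyfun (fun x => jet_det (at_pt i (W x))).
  by apply: polyfun_sub; apply: polyfun_mul.
apply: polyfun_mul.
  apply: polyfun_prod => i; do !apply: polyfun_mul => //.
  apply: polyfun_sub; first exact: polyfun_exp.
  by apply: polyfun_mul => //; exact: polyfun_cst.
do 2!apply: polyfun_prod => ?.
by apply: polyfun_sub; apply: polyfun_mul => //; exact: polyfun_exp.
Qed.

Lemma vanish4_jet w i : vanish4 w ->
  radial (at_pt i w) /\ at_pt i w dY XXX = 0 /\ at_pt i w dZ XXX = 0.
Proof.
move=> [rw w0]; split; first exact: radial_act.
rewrite !XXX_ev /at_pt ev_act lower3_e1 -/(pt i) w0.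
by rewrite mul0mx !mxE.
Qed.

Lemma dev_e1 w (i : 'I_3) (y z : C) :
  dev w (vec3 1 0 0) (vec3 0 y z) 0 i = w i XXY * y + w i XXZ * z.
Proof. by rewrite mxE /dcub !mxE /=; ring. Qed.

(** At a nondegenerate singular point the linear part is onto the values taken
there by radial forms. *)
Lemma dev_surjective w v i : vanish4 w -> jet_det (at_pt i w) != 0 -> radial v ->
  exists u, dev w (pt i) u = ev v (pt i).
Proof.
move=> vw d0 rv; set K := lower3 (pt_y i) (pt_z i) 0.
have [ra [b0 c0]] := vanish4_jet i vw.
have [z0 z1 z2 _] := radial_jet ra; rewrite b0 oppr0 in z1; rewrite c0 oppr0 in z2.
have rv' : radial (at_pt i v) by apply: radial_act.
have [zv _ _ _] := radial_jet rv'.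
move: d0; rewrite /jet_det.
set b1 := at_pt i w dY XXY; set b2 := at_pt i w dY XXZ.
set c1 := at_pt i w dZ XXY; set c2 := at_pt i w dZ XXZ => d0.
set r := at_pt i v dY XXX; set s := at_pt i v dZ XXX.
pose u := vec3 0 ((c2 * r - b2 * s) / (b1 * c2 - c1 * b2))
                 ((b1 * s - c1 * r) / (b1 * c2 - c1 * b2)).
have E : dev (at_pt i w) (vec3 1 0 0) u = ev (at_pt i v) (vec3 1 0 0).
  apply/rowP; apply: forall3; rewrite -XXX_ev dev_e1.
  - by rewrite z1 z2 zv mul0r mul0r addr0.
  - rewrite -/b1 -/b2 -/r; field; exact: d0.
  - rewrite -/c1 -/c2 -/s; field; exact: d0.
exists (K *m u); have Ku : K \in unitmx by apply: lower3_unit.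
apply: (can_inj (mulmxK Ku)); move: E.
by rewrite /at_pt dev_act ev_act lower3_e1.
Qed.

Lemma ev_cubic_homog w s v : ev w (s *: v) = s ^+ 3 *: ev w v.
Proof. by apply/rowP => i; rewrite !mxE /cub; ring. Qed.

Lemma devD w v u u' : dev w v (u + u') = dev w v u + dev w v u'.
Proof. by apply/rowP => i; rewrite !mxE /dcub; ring. Qed.

Lemma dev_self w v s : dev w v (s *: v) = (3 * s) *: ev w v.
Proof. by apply/rowP => i; rewrite !mxE /dcub /cub; ring. Qed.

Lemma radial_act1_deriv N w : radial w -> radial (act1_deriv N w).
Proof.
move=> rw v; rewrite ev_act1_deriv mulmxDl -mulmxA.
exact: dev_radial.
Qed.

(** Moving the form by a linear change of coordinates moves the four points,
which are in general position, in an arbitrary way; so the infinitesimal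
linear changes of coordinates and the forms vanishing at the four points span
the whole space. *)
Lemma four_points_transversal w v : vanish4 w -> discriminant4 w != 0 -> radial v ->
  exists N y, vanish4 y /\ act1_deriv N w + y = v.
Proof.
move=> vw; rewrite mulf_eq0 negb_or => /andP[/prodf_neq0 D _] rv.
have /choice[u uE] i : exists u, dev w (pt i) u = ev v (pt i).
  apply: dev_surjective => //.
  by have := D i isT; rewrite !mulf_eq0 !negb_or => /andP[/andP[/andP[->]]].
pose i0 : 'I_4 := @Ordinal 4 0 isT; pose i1 : 'I_4 := @Ordinal 4 1 isT.
pose i2 : 'I_4 := @Ordinal 4 2 isT; pose i3 : 'I_4 := @Ordinal 4 3 isT.
have forall4 (P : 'I_4 -> Prop) : P i0 -> P i1 -> P i2 -> P i3 -> forall i, P i.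
  move=> P0 P1 P2 P3 [[|[|[|[|//]]]] h];
  [move: P0|move: P1|move: P2|move: P3]; congr P; exact: val_inj.
pose d := u i3 - u i1 - u i2 + u i0.
pose n0 := u i0 + (d dY 0 + d dZ 0 - d dX 0) *: pt i0.
pose n1 := u i1 + d dY 0 *: pt i1 - n0.
pose n2 := u i2 + d dZ 0 *: pt i2 - n0.
pose N : 'M[C]_3 := \matrix_(i, j) [:: n0 i 0; n1 i 0; n2 i 0]`_j.
have NE (x y z : C) : N *m vec3 x y z = x *: n0 + y *: n1 + z *: n2.
  apply/matrixP => i j; rewrite ord1 !mxE sum3E !mxE /=; ring.
have Npt i : exists l, N *m pt i = u i + l *: pt i.
  move: i; apply: forall4; rewrite /pt NE.
  - by exists (d dY 0 + d dZ 0 - d dX 0); rewrite scale1r !scale0r !addr0.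
  - by exists (d dY 0); rewrite !scale1r !scale0r addr0 /n1 addrC subrK.
  - by exists (d dZ 0); rewrite !scale1r !scale0r addr0 /n2 addrC subrK.
  - exists 0; rewrite !scale1r scale0r addr0 /n1 /n2 /n0 /d.
    apply/matrixP => k l; rewrite ord1; move: k.
    by apply: forall3; rewrite /pt /pt_y /pt_z !mxE /=; ring.
exists N, (v - act1_deriv N w); split; last by rewrite addrC subrK.
have [rw w0] := vw.
split; first by rewrite -scaleN1r; apply: radialD => //; apply: radialZ; apply: radial_act1_deriv.
move=> i; have [l E] := Npt i.
rewrite -scaleN1r evD evZ ev_act1_deriv w0 mul0mx addr0 E devD dev_self w0 scaler0.
by rewrite addr0 uE scaleN1r subrr.
Qed.

(** Eight frames formed by a singular point and an eigendirection, with distinct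
quotients of the eigenvalues. *)
Definition framed w : Prop := exists h : 'I_8 -> 'M[C]_3,
  (forall i, h i \in unitmx /\ flag_singular (act (h i) w)) /\
  (forall i j, i != j -> act (h i) w dZ XXY * act (h j) w dY XXZ !=
                        act (h j) w dZ XXY * act (h i) w dY XXZ).

(** At each point the two eigenframes have inverse quotients of eigenvalues, q
and 1 / q, which differ since the trace and the discriminant are nonzero; the quantity
tr^2 / det = q + 1 / q + 2 distinguishes the pairs. *)
Lemma vanish4_framed w : vanish4 w -> discriminant4 w != 0 -> framed w.
Proof.
move=> vw; rewrite mulf_eq0 negb_or => /andP[/prodf_neq0 D /prodf_neq0 D'].
pose t i := jet_trace (at_pt i w); pose dt i := jet_det (at_pt i w).
have D1 i : [/\ dt i != 0, t i != 0, at_pt i w dY XXY != 0 & t i ^+ 2 - 4 * dt i != 0].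
  by have := D i isT; rewrite !mulf_eq0 !negb_or => /andP[/andP[/andP[]]].
have D2 i j : i != j -> t i ^+ 2 * dt j - t j ^+ 2 * dt i != 0.
  by move=> ij; have /prodf_neq0/(_ j ij) := D' i isT.
pose s (e : 'I_4 * bool) : C := (-1) ^+ e.2 * sqrtC (t e.1 ^+ 2 - 4 * dt e.1).
have sE e : s e ^+ 2 = t e.1 ^+ 2 - 4 * dt e.1.
  by rewrite /s exprMn sqrtCK -exprM mulnC exprM sqrrN expr1n expr1n mul1r.
have s0 e : s e != 0.
  by have [_ _ _] := D1 e.1; rewrite -sE expf_eq0.
have /choice[u uP] (e : 'I_4 * bool) : exists u, exists k,
   [/\ u \in unitmx, k != 0, flag_singular (act u w),
    act u w dZ XXY = k * (t e.1 - s e) & act u w dY XXZ = - k * (t e.1 + s e)].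
  have [ra [b0 c0]] := vanish4_jet e.1 vw; have [_ _ b1 _] := D1 e.1.
  have [u [k]] := eigenframe ra b0 c0 b1 (s0 e) (sE e).
  rewrite /at_pt !actM => -[uu k0 fu u1 u2].
  exists (lower3 (pt_y e.1) (pt_z e.1) 0 *m u), k; split=> //.
  by rewrite unitmx_mul lower3_unit.
pose idx (i : 'I_8) : 'I_4 * bool := (inord i./2, odd i).
have idx_inj : injective idx.
  move=> i j [/(congr1 val) /=]; rewrite !inordK ?ltn_half_double // => e1 e2.
  apply: val_inj; rewrite /= -[LHS]odd_double_half -[RHS]odd_double_half.
  by rewrite e1 e2.
exists (fun i => u (idx i)); split.
  by move=> i; have [k []] := uP (idx i).
move=> i j ij.
have [k [_ k0 _ -> ->]] := uP (idx i); have [k' [_ k0' _ -> ->]] := uP (idx j).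
have {ij} : idx i != idx j by rewrite (inj_eq idx_inj).
move: (idx i) (idx j) => e e' ee'; rewrite -subr_eq0.
rewrite (_ : _ - _ = 2 * k * k' * (s e' * t e.1 - s e * t e'.1) * (-1)); last by ring.
rewrite !mulf_neq0 ?two_neq0 ?oppr_eq0 ?oner_eq0 // subr_eq0.
apply/eqP => st.
have [e1|e1] := eqVneq e.1 e'.1.
  have [_ t0 _ _] := D1 e'.1.
  move: st; rewrite e1 => /(mulIf t0); rewrite /s e1.
  have [_ _ _] := D1 e'.1; rewrite -(sqrtC_eq0 (_ - _)) => q0 /(mulIf q0).
  case: e e' ee' e1 {q0 D2 t0} => [a [] [b []]] //=; rewrite ?xpair_eqE ?eqxx ?andbT.
  - by move=> /eqP ab e; case: (ab e).
  - by move=> _ _ /eqP; rewrite expr0 expr1 -subr_eq0 opprK -mulr2n pnatr_eq0.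
  - by move=> _ _ /eqP; rewrite expr0 expr1 eq_sym -subr_eq0 opprK -mulr2n pnatr_eq0.
  - by move=> /eqP ab e; case: (ab e).
have st2 : s e' ^+ 2 * t e.1 ^+ 2 = s e ^+ 2 * t e'.1 ^+ 2.
  by rewrite -[LHS]exprMn st exprMn.
rewrite !sE in st2; have := D2 _ _ e1 => /negP; apply.
apply/eqP; apply: (@lincomb C 4 _ _ ((t e.1 ^+ 2 - 4 * dt e.1) * t e'.1 ^+ 2 -
  (t e'.1 ^+ 2 - 4 * dt e'.1) * t e.1 ^+ 2)); first by rewrite pnatr_eq0.
  by ring.
by rewrite st2 subrr.
Qed.

End Frames.

(** * Density of the forms with four given singular points *)

Section FramedGeneric.
Variable C : numClosedFieldType.
Implicit Types (w y : 'M[C]_(3, 10)) (g : 'M[C]_3).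

(** In the affine chart x = 1 this is the vector field
(y^3 + y^2 - 2 y) d/dy + (y^2 - y + 5 z^2 - 5 z + y^2 z - y z) d/dz. *)
Definition example4 : 'M[C]_(3, 10) := \matrix_(i, k) (nth [::] [::
  [:: 0; 0; 0; -1; -3; 0; 1; -2; 5; 0];
  [:: 0; 1; 5; -1; 1; -5; 0; -1; 0; 0];
  [:: 0; -2; 0; 1; 0; 0; 1; 0; 0; 0]] i)`_k.

Lemma example4_vanish : vanish4 example4.
Proof.
split=> [v|i].
  by apply/matrixP => i j; rewrite !ord1 mxE sum3E !mxE /cub !mxE /=; ring.
apply/rowP => j; rewrite /pt /pt_y /pt_z mxE /cub !mxE.
by move: i => [[|[|[|[|//]]]] hi] /=; move: j; apply: forall3; rewrite /=; ring.
Qed.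

Lemma at_pt_jet w i (j : 'I_3) : j != dX ->
  at_pt i w j XXY = dev w (pt C i) (vec3 0 1 0) 0 j /\
  at_pt i w j XXZ = dev w (pt C i) (vec3 0 0 1) 0 j.
Proof.
move=> j0; rewrite XXY_dev XXZ_dev /at_pt !dev_act lower3_e1 -/(pt C i).
have -> : lower3 (pt_y C i) (pt_z C i) 0 *m vec3 0 1 0 = vec3 0 1 0.
  apply/matrixP => k l; rewrite ord1 !mxE sum3E !mxE /=.
  by move: k; apply: forall3; rewrite /=; ring.
have -> : lower3 (pt_y C i) (pt_z C i) 0 *m vec3 0 0 1 = vec3 0 0 1.
  apply/matrixP => k l; rewrite ord1 !mxE sum3E !mxE /=.
  by move: k; apply: forall3; rewrite /=; ring.
move: (dev w _ (vec3 0 1 0)) (dev w _ (vec3 0 0 1)) => u v.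
move: j j0; apply: forall3 => // _;
  by split; rewrite [LHS]mxE sum3E ![lower3 _ _ _ _ _]mxE /=; ring.
Qed.

Lemma example4_jets i :
  [/\ jet_trace (at_pt i example4) = ([:: -7; -2; 3; 8]`_i)%:~R,
      jet_det (at_pt i example4) = ([:: 10; -15; -10; 15]`_i)%:~R &
      at_pt i example4 dY XXY = ([:: 1; -1; 2; -2]`_i)%:~R].
Proof.
rewrite /jet_trace /jet_det.
have [-> ->] := @at_pt_jet example4 i dY isT.
have [-> ->] := @at_pt_jet example4 i dZ isT.
rewrite /pt /pt_y /pt_z !mxE /dcub !mxE.
by move: i => [[|[|[|[|//]]]] hi] /=; split; ring.
Qed.

Lemma example4_discriminant : discriminant4 example4 != 0.
Proof.
apply: mulf_neq0; first (apply/prodf_neq0 => i _).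
  have [-> -> ->] := example4_jets i.
  rewrite -(rmorphXn (@intmul C 1)) -(rmorph_nat (@intmul C 1) 4) -!rmorphM -rmorphB -rmorphM intr_eq0.
  by move: i => [[|[|[|[|//]]]] hi].
apply/prodf_neq0 => i _; apply/prodf_neq0 => j ij.
have [-> -> _] := example4_jets i; have [-> -> _] := example4_jets j.
rewrite -!(rmorphXn (@intmul C 1)) -!rmorphM -rmorphB intr_eq0.
by move: i j ij => [[|[|[|[|//]]]] hi] [[|[|[|[|//]]]] hj].
Qed.

(** The first order variations of a form with four given singular points and of its
transforms are all radial forms, so that the ideal of polynomials vanishing on these forms
is stable under derivation. *)
Lemma dense_four_points (p : mpoly 15 C) :
  (forall g y, g \in unitmx -> vanish4 y -> discriminant4 y != 0 ->
     meval (coord15 (act g y)) p = 0) -> p = 0.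
Proof.
move=> vp.
pose I (x : 'I_15 -> C) := exists g y, [/\ g \in unitmx, vanish4 y, discriminant4 y != 0 &
  x = coord15 (act g y)].
apply: (@derivation_stable_vanish _ _ I).
- by exists (coord15 (act 1%:M example4)), 1%:M, example4; split=> //;
    [exact: unitmx1 | exact: example4_vanish | exact: example4_discriminant].
- move=> {p vp} p vp i x [g [y [gu vy dy ->]]].
  have [ry y0] := vy.
  pose v := form15 (fun l => (l == i)%:R : C).
  have rv : radial (act (invmx g) v) by apply/radial_act/radial_form15.
  have [N [y' [[ry' y0'] Ny]]] := four_points_transversal vy dy rv.
  have [A2 [A3 [A4 AE]]] := act_taylor N y.
  have [B2 [B3 [B4 BE]]] := act_taylor N y'.
  pose c (t : C) := coord15 (act ((1%:M + t *: N) *m g) (y + t *: y')).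
  (* The coefficients of the powers of t in the curve c. *)
  pose A : seq 'M[C]_(3, 10) := [:: y; act1_deriv N y + y'; A2 + act1_deriv N y';
    A3 + B2; A4 + B3; B4].
  pose q l : {poly C} := \poly_(k < 6) coord15 (act g (nth 0 A k)) l.
  have qE t : (fun l => (q l).[t]) = c t.
    apply/funext => l; rewrite horner_poly !big_ord_recr big_ord0 /=.
    rewrite /c -[act (_ *m g) _]actM [act (1%:M + _) (y + _)]actD actZ AE BE.
    by rewrite !(coord15D, coord15Z, actD, actZ); ring.
  have q'0 l : (q l)^`().[0] = (l == i)%:R.
    rewrite horner_coef0 coef_deriv coef_poly /= mulr1n Ny actVK //.
    by rewrite -[LHS]/((coord15 v) l) coord15_form15.
  have pc : polyfun (fun x : 'I_15 -> C => meval x p) by exact: polyfun_meval.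
  have [r rE] := meval_curve q p.
  pose E (x : unit -> C) := \det ((1%:M + x tt *: N) *m g) * discriminant4 (y + x tt *: y').
  have pE : polyfun E.
    apply: polyfun_mul.
      apply: polyfun_det; apply: polyfun_mulmx => [a b|a b]; last exact: polyfun_cst.
      apply: (@polyfun_eq _ _ (fun x => (1%:M : 'M[C]_3) a b + x tt * N a b)).
        by apply: polyfun_add; [exact: polyfun_cst | apply: polyfun_mul;
          [exact: polyfun_var | exact: polyfun_cst]].
      by move=> x0; rewrite !mxE.
    apply: polyfun_discriminant4 => a b.
    apply: (@polyfun_eq _ _ (fun x => y a b + x tt * y' a b)).
      by apply: polyfun_add; [exact: polyfun_cst | apply: polyfun_mul;
        [exact: polyfun_var | exact: polyfun_cst]].
    by move=> x0; rewrite !mxE.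
  have [e eE] := polyfun_curve (fun=> 'X) pE.
  have e0 : e != 0.
    apply: contraTneq isT => e0; have := eE 0; rewrite e0 horner0 /E hornerX.
    rewrite !scale0r !addr0 mul1mx => /eqP; rewrite mulf_eq0 (negPf dy) orbF.
    by move=> /eqP dg; move: gu; rewrite unitmxE dg unitr0.
  have r0 : r = 0.
    apply: contraTeq isT => r0; have [t] := poly_nonroot (mulf_neq0 r0 e0).
    rewrite hornerM mulf_eq0 negb_or -eE /E hornerX mulf_eq0 negb_or => /and3P[rt dt ht].
    suff : r.[t] = 0 by move/eqP: rt.
    have [<- _] := rE t; rewrite qE; apply: vp.
    exists ((1%:M + t *: N) *m g), (y + t *: y'); split=> //.
    + by rewrite unitmxE unitfE.
    + split; first by apply: radialD => //; apply: radialZ.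
      by move=> k; rewrite evD evZ y0 y0' scaler0 addr0.
  have [_] := rE 0; rewrite r0 derivC horner0 qE (bigD1 i) //= big1 => [|l li].
    rewrite addr0 q'0 eqxx mulr1 /c !scale0r !addr0 mul1mx => /esym.
    by [].
  by rewrite q'0 (negPf li) mulr0.
- by move=> x [g [y [gu vy dy ->]]]; apply: vp.
Qed.

(** Being framed is a condition of solvability of polynomial equations and
inequations, so that it is generically true or generically false; the latter is
excluded by density of the forms with four singular points in general position. *)
Lemma framed_generic : generically (fun x : 'I_15 -> C => framed (form15 x)).
Proof.
(* The unknowns are the entries of eight matrices of order 3. *)
pose T := ('I_15 + 'I_72)%type.
pose H (i : 'I_8) (x : T -> C) : 'M[C]_3 :=
  \matrix_(a, b) x (inr (inord (i * 9 + a * 3 + b))).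
pose W (x : T -> C) := form15 (fun l => x (inl l)).
pose D i x := act (H i x) (W x).
have pD i a b : polyfun (fun x => D i x a b).
  apply: polyfun_act => [a' b'|].
    apply: (@polyfun_eq _ _ (fun x : T -> C => x (inr (inord (i * 9 + a' * 3 + b')))));
      [exact: polyfun_var | by move=> x; rewrite mxE].
  by apply: polyfun_form15 => l; exact: polyfun_var.
have pH i : polyfun (fun x => \det (H i x)).
  apply: polyfun_det => a' b'.
  apply: (@polyfun_eq _ _ (fun x : T -> C => x (inr (inord (i * 9 + a' * 3 + b')))));
      [exact: polyfun_var | by move=> x; rewrite mxE].
pose E (j : 'I_8 * 'I_3) x := [:: D j.1 x dY XXX; D j.1 x dZ XXX; D j.1 x dY XXY]`_j.2.
have pE j : polyfun (E j) by case: j => i; apply: forall3; exact: pD.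
pose h x := \prod_(i < 8) \det (H i x) * \prod_(i < 8) \prod_(j < 8 | i != j)
  (D i x dZ XXY * D j x dY XXZ - D j x dZ XXY * D i x dY XXZ).
have ph : polyfun h.
  apply: polyfun_mul; first by apply: polyfun_prod.
  apply: polyfun_prod => i; apply: polyfun_prod => j.
  by apply: polyfun_sub; apply: polyfun_mul.
have SE x : (exists z, (forall j, E j (join x z) = 0) /\ h (join x z) != 0) <->
    framed (form15 x).
  split=> [[z [Ez]]|[k [ku kd]]].
    rewrite mulf_eq0 negb_or => /andP[/prodf_neq0 dz /prodf_neq0 hz].
    exists (fun i => H i (join x z)); split.
      move=> i; split; first by rewrite unitmxE unitfE dz.
      by split; [exact: (Ez (i, dX)) | exact: (Ez (i, dY)) | exact: (Ez (i, dZ))].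
    by move=> i j ij; have /prodf_neq0/(_ j ij) := hz i isT; rewrite subr_eq0.
  pose z (l : 'I_72) : C := k (inord (l %/ 9)) (inord ((l %% 9) %/ 3)) (inord (l %% 3)).
  have Hz i : H i (join x z) = k i.
    apply/matrixP => a b; rewrite mxE /= /z.
    have ia := ltn_ord i; have ha := ltn_ord a; have hb := ltn_ord b.
    rewrite inordK; last by lia.
    rewrite (_ : (i * 9 + a * 3 + b) %/ 9 = i)%N; last by lia.
    rewrite (_ : ((i * 9 + a * 3 + b) %% 9) %/ 3 = a)%N; last by lia.
    rewrite (_ : (i * 9 + a * 3 + b) %% 3 = b)%N; last by lia.
    by rewrite !inord_val.
  have Dz i : D i (join x z) = act (k i) (form15 x) by rewrite /D Hz.
  exists z; split.
    by case=> i; rewrite /E /= !Dz; have [_ []] := ku i => ? ? ?; apply: forall3.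
  apply: mulf_neq0; apply/prodf_neq0 => i _.
    by rewrite Hz; have [] := ku i; rewrite unitmxE unitfE.
  by apply/prodf_neq0 => j ij; rewrite !Dz subr_eq0 kd.
case: (generically_solvable_or_not_fin pE ph) => G.
  by apply: generically_imp G => x /SE.
exfalso; case: G => P [pP [x Px] PN].
have [p pE'] := polyfunP pP.
suff p0 : p = 0 by move: Px; rewrite pE' p0 meval0 eqxx.
apply: dense_four_points => g y gu vy dy.
have [ry _] := vy.
rewrite -pE'; apply/eqP/negPn/negP => /PN; apply; apply/SE.
rewrite radial_coord; last exact: radial_act.
have [h' [hu hd]] := vanish4_framed vy dy.
exists (fun i => invmx g *m h' i); split.
  move=> i; have [hi fi] := hu i; rewrite unitmx_mul unitmx_inv gu hi; split=> //.
  by rewrite actM mulmxA mulmxV // mul1mx.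
by move=> i j ij; rewrite !actM !mulmxA mulmxV // !mul1mx hd.
Qed.

End FramedGeneric.

(** * Foliations as classes of radial forms *)

Section Translation.
Variable R : realType.
Local Notation C := (Cplx R).
Implicit Types (w : 'M[C]_(3, 10)) (g : 'M[C]_3).

Lemma meval_coef w i (v : 'I_3 -> C) :
  meval v (coef w i) = cub (w i) (v dX) (v dY) (v dZ).
Proof.
rewrite /coef raddf_sum /= !big_ord_recr big_ord0 /= add0r /cub.
do !congr (_ + _).
all: rewrite mevalZ mevalX /cubic_monomial /= prod3E /fun_of_multinom /=.
all: rewrite !(tnth_nth 0%N) /=.
all: by congr (w i _ * _); first [exact: val_inj | ring].
Qed.

Lemma mpoly_ext n (p q : mpoly n C) : (forall x, meval x p = meval x q) -> p = q.
Proof.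
move=> E; apply/eqP; rewrite -subr_eq0; apply/eqP/meval_inj => x.
by rewrite mevalB E subrr.
Qed.

Lemma meval_pullback g (a : 'I_3 -> mpoly 3 C) j (v : 'I_3 -> C) :
  meval v (pullback g a j) =
  \sum_i g i j * meval (fun m => \sum_l g m l * v l) (a i).
Proof.
rewrite /pullback raddf_sum; apply: eq_bigr => i _ /=.
rewrite mevalZ comp_mpoly_meval; congr (_ * _); apply: meval_eq => m.
rewrite tnth_mktuple raddf_sum; apply: eq_bigr => l _ /=.
by rewrite mevalZ /var mevalXU.
Qed.

Lemma meval_pullback_coef g w j (v : 'I_3 -> C) :
  meval v (pullback g (coef w) j) = (ev w (g *m \col_l v l) *m g) 0 j.
Proof.
rewrite meval_pullback mxE; apply: eq_bigr => i _; rewrite mulrC; congr (_ * _).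
rewrite meval_coef !mxE; congr (cub _ _ _ _); apply: eq_bigr => l _;
  by rewrite mxE.
Qed.

Lemma ev_meval w i (v : 'I_3 -> C) : ev w (\col_l v l) 0 i = meval v (coef w i).
Proof. by rewrite meval_coef !mxE. Qed.

(** On coefficient matrices the pullback of forms is the action by substitution. *)
Lemma coef_pullbackP g w w' : coef w' =1 pullback g (coef w) <-> w' = act g w.
Proof.
split=> [E|->].
  apply: ev_inj => v; rewrite ev_act; apply/rowP => i.
  have -> : v = \col_l v l 0 by apply/matrixP => a b; rewrite ord1 mxE.
  by rewrite ev_meval E meval_pullback_coef.
move=> i; apply: mpoly_ext => v.
by rewrite meval_pullback_coef -ev_meval ev_act.
Qed.

Lemma radialP w : \sum_(i < 3) coef w i * var R i = 0 <-> radial w.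
Proof.
have E (v : 'I_3 -> C) : meval v (\sum_(i < 3) coef w i * var R i) =
    (ev w (\col_l v l) *m (\col_l v l)) 0 0.
  rewrite raddf_sum mxE; apply: eq_bigr => i _ /=.
  by rewrite mevalM ev_meval /var mevalXU mxE.
split=> [w0 v|rw].
  apply/matrixP => i j; rewrite !ord1 [RHS]mxE.
  have -> : v = \col_l v l 0 by apply/matrixP => a b; rewrite ord1 mxE.
  by rewrite -E w0 meval0.
by apply: mpoly_ext => v; rewrite E rw mxE meval0.
Qed.

Lemma no_common_factor_act g w : g \in unitmx ->
  no_common_factor (coef w) -> no_common_factor (coef (act g w)).
Proof.
move=> gu ncf p pE.
have /choice[q qE] := pE.
pose h := invmx g.
pose lin (k : 'M[C]_3) := [tuple \sum_(l < 3) k m l *: var R l | m < 3].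
have evl (k : 'M[C]_3) r (v : 'I_3 -> C) : meval v (comp_mpoly (lin k) r) =
    meval (fun m => \sum_l k m l * v l) r.
  rewrite comp_mpoly_meval; apply: meval_eq => m.
  rewrite tnth_mktuple raddf_sum; apply: eq_bigr => l _ /=.
  by rewrite mevalZ /var mevalXU.
have hw : coef w =1 pullback h (coef (act g w)) by apply/coef_pullbackP; rewrite actK.
have [c cE] : exists c, comp_mpoly (lin h) p = mpolyC 3 c.
  apply: ncf => j; exists (\sum_i h i j *: comp_mpoly (lin h) (q i)).
  rewrite hw /pullback mulr_sumr; apply: eq_bigr => i _.
  by rewrite qE -scalerAr -[comp_mpoly _ (p * _)]/(comp_mpoly (lin h) (p * q i)) rmorphM.
exists c; apply: mpoly_ext => v; rewrite mevalC.
transitivity (meval (fun m => \sum_l g m l * v l) (comp_mpoly (lin h) p)).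
  rewrite evl; apply: meval_eq => m.
  have := congr1 (fun M : 'cV[C]_3 => M m 0) (mulKmx gu (\col_l v l)).
  rewrite -/h !mxE => <-; apply: eq_bigr => l _; congr (_ * _).
  by rewrite mxE; apply: eq_bigr => k _; rewrite mxE.
by rewrite cE mevalC.
Qed.

Lemma foliation_formE w :
  foliation_form w <-> radial w /\ no_common_factor (coef w).
Proof. by split=> -[/radialP]. Qed.

Lemma foliation_form_act g w : g \in unitmx ->
  foliation_form w -> foliation_form (act g w).
Proof.
move=> gu /foliation_formE[rw nw]; apply/foliation_formE; split.
  exact: radial_act.
exact: no_common_factor_act.
Qed.

(** A scalar matrix acts by its fourth power. *)
Lemma scale_act (c : C) : c != 0 -> exists2 s, s \in unitmx & forall w, act s w = c *: w.
Proof.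
move=> c0; have [s sE] : exists s : C, s ^+ 4 = c.
  by exists (4.-root c); rewrite rootCK.
exists s%:M; last by move=> w; rewrite act_scalar sE.
rewrite unitmxE unitfE det_scalar expf_neq0 //.
by apply: contra_neq c0 => s0; rewrite -sE s0 expr0n.
Qed.

Lemma foliation_formZ (c : C) w : c != 0 -> foliation_form w -> foliation_form (c *: w).
Proof. by move=> /scale_act[s su <-]; exact: foliation_form_act. Qed.

Lemma foliation_form_set_val (w : @foliation_form R) : foliation_form (set_val w).
Proof. exact: set_valP. Qed.

Lemma foliation_form_ex w : foliation_form w -> exists x : @foliation_form R, set_val x = w.
Proof. by move=> fw; exists (SigSub (mem_set fw)). Qed.

Lemma foliation_of_eq (x y : @foliation_form R) : foliation_of x = foliation_of y <->
  exists2 c : C, c != 0 & set_val y = c *: set_val x.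
Proof.
split=> [/(@eqmodP _ _ x y)/asboolP[c [c0 e]]|[c c0 e]]; first by exists c.
by apply/(@eqmodP _ _ x y)/asboolP; exists c.
Qed.

Lemma foliation_ex (F : foliation R) : exists x : @foliation_form R, foliation_of x = F.
Proof. by exists (generic_quotient.repr F); rewrite /foliation_of reprK. Qed.

Lemma orbitP (x : @foliation_form R) (F : foliation R) : PGL3_orbit (foliation_of x) F <->
  exists2 g, g \in unitmx & exists2 y, foliation_of y = F & set_val y = act g (set_val x).
Proof.
split=> [[g [w [w' [gu /foliation_of_eq[c c0 xE] <- /coef_pullbackP E]]]]|].
  have [s su sE] := scale_act (invr_neq0 c0).
  exists (s *m g); first by rewrite unitmx_mul su.
  by exists w' => //; rewrite E xE actZ -actM sE actZ scalerA mulfV // scale1r.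
move=> [g gu [y yF yE]]; exists g, x, y; split=> //.
by apply/coef_pullbackP.
Qed.

End Translation.

(** * The normal forms *)

Ltac polyfun_tac := repeat first [ apply: polyfun_var | apply: polyfun_cst
  | apply: polyfun_add | apply: polyfun_mul | apply: polyfun_opp ].

Section NormalForms.
Variable C : numClosedFieldType.

(** The form x^2 (z dx - x dz) + y^2 (x dy - y dx), which restricts to omega_1 in the
chart z = 1. *)
Definition F1_form : 'M[C]_(3, 10) := \matrix_(i, k) (nth [::] [::
  [:: 0; 0; 1; 0; 0; 0; -1; 0; 0; 0];
  [:: 0; 0; 0; 1; 0; 0; 0; 0; 0; 0];
  [:: -1; 0; 0; 0; 0; 0; 0; 0; 0; 0]] i)`_k.

(** The singular point (1, 0, 0) has eigenvalues al and be, the line y = 0 is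
invariant and the line z = 0 is not. *)
Definition G_form (al be : C) : 'M[C]_(3, 10) := \matrix_(i, k) (nth [::] [::
  [:: 0; 0; 0; 0; be - al; 0; 1; 0; 0; 0];
  [:: 0; 0; - be; -1; 0; 0; 0; 0; 0; 0];
  [:: 0; al; 0; 0; 0; 0; 0; 0; 0; 0]] i)`_k.

Lemma radial_F1 : radial F1_form.
Proof. by move=> v; apply/matrixP => i j; rewrite !ord1 mxE sum3E !mxE /cub !mxE /=; ring. Qed.

Lemma radial_G al be : radial (G_form al be).
Proof. by move=> v; apply/matrixP => i j; rewrite !ord1 mxE sum3E !mxE /cub !mxE /=; ring. Qed.

Lemma ev_F1 (v : 'cV[C]_3) : ev F1_form v = \row_i
  [:: v dX 0 ^+ 2 * v dZ 0 - v dY 0 ^+ 3; v dX 0 * v dY 0 ^+ 2; - v dX 0 ^+ 3]`_i.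
Proof.
apply/rowP => i; rewrite !mxE /cub !mxE.
by move: i; apply: forall3; rewrite /=; ring.
Qed.

Lemma ev_G al be (v : 'cV[C]_3) : ev (G_form al be) v = \row_i
  [:: (be - al) * (v dX 0 * v dY 0 * v dZ 0) + v dY 0 ^+ 3;
      - be * (v dX 0 ^+ 2 * v dZ 0) - v dX 0 * v dY 0 ^+ 2;
      al * (v dX 0 ^+ 2 * v dY 0)]`_i.
Proof.
apply/rowP => i; rewrite !mxE /cub !mxE.
by move: i; apply: forall3; rewrite /=; ring.
Qed.

End NormalForms.
Arguments F1_form {C}.

Section Factors.
Variable R : realType.
Local Notation C := (Cplx R).
Implicit Types (w : 'M[C]_(3, 10)) (g : 'M[C]_3).

Lemma not_divisible_by_X w : foliation_form w ->
  (forall i, [/\ w i YYY = 0, w i YYZ = 0, w i YZZ = 0 & w i ZZZ = 0]) -> False.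
Proof.
move=> [_ ncf] w0.
have [|c] := ncf (mpolyX C (mnm1 dX)).
  move=> i; have [e6 e7 e8 e9] := w0 i.
  have [q qE] := @polyfunP C 3 (fun v => w i XXX * (v dX * v dX) +
    w i XXY * (v dX * v dY) + w i XXZ * (v dX * v dZ) + w i XYY * (v dY * v dY) +
    w i XYZ * (v dY * v dZ) + w i XZZ * (v dZ * v dZ)) ltac:(polyfun_tac).
  exists q; apply: mpoly_ext => v.
  by rewrite meval_coef mevalM mevalXU -qE /cub e6 e7 e8 e9; ring.
move=> E; have := congr1 (meval (fun=> 0)) E; have := congr1 (meval (fun=> 1)) E.
by rewrite !mevalXU !mevalC => <- /esym/eqP; rewrite oner_eq0.
Qed.

(** Such a form has no dz and involves only x and y, hence is a multiple of
x dy - y dx by a form of degree two. *)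
Lemma not_fibration w : foliation_form w ->
  (forall i k, ~~ ((i == dX) && (k \in [:: XXY; XYY; YYY])) ->
     ~~ ((i == dY) && (k \in [:: XXX; XXY; XYY])) -> w i k = 0) -> False.
Proof.
move=> fw w0; have [[rw ncf] _] := (fw, tt).
have {}rw : radial w by apply/radialP.
have [_ e1 _ e3] := radial_jet rw.
have e6 : w dX YYY = - w dY XYY by rewrite -(radial_coord rw) !mxE /= opprK.
have [Q QE'] := @polyfunP C 3 (fun v => w dX XXY * (v dX * v dX) +
  w dX XYY * (v dX * v dY) + w dX YYY * (v dY * v dY)) ltac:(polyfun_tac).
have QE v : meval v Q = w dX XXY * (v dX * v dX) + w dX XYY * (v dX * v dY) +
  w dX YYY * (v dY * v dY) by rewrite -QE'.
have [|c Qc] := ncf Q.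
  apply: forall3.
  - exists (mpolyX C (mnm1 dY)); apply: mpoly_ext => v.
    rewrite mevalM QE mevalXU meval_coef /cub.
    rewrite (w0 dX XXX isT isT) (w0 dX XXZ isT isT) (w0 dX XYZ isT isT) (w0 dX XZZ isT isT) (w0 dX YYZ isT isT) (w0 dX YZZ isT isT) (w0 dX ZZZ isT isT); ring.
  - exists (- mpolyX C (mnm1 dX)); apply: mpoly_ext => v.
    rewrite mevalM QE mevalN mevalXU meval_coef /cub e1 e3 e6.
    rewrite (w0 dY XXZ isT isT) (w0 dY XYZ isT isT) (w0 dY XZZ isT isT) (w0 dY YYY isT isT) (w0 dY YYZ isT isT) (w0 dY YZZ isT isT) (w0 dY ZZZ isT isT); ring.
  - exists 0; apply: mpoly_ext => v.
    rewrite mulr0 meval0 meval_coef /cub.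
    rewrite (w0 dZ XXX isT isT) (w0 dZ XXY isT isT) (w0 dZ XXZ isT isT) (w0 dZ XYY isT isT) (w0 dZ XYZ isT isT) (w0 dZ XZZ isT isT) (w0 dZ YYY isT isT) (w0 dZ YYZ isT isT) (w0 dZ YZZ isT isT) (w0 dZ ZZZ isT isT); ring.
have c0 : c = 0.
  have := congr1 (meval (fun=> 0)) Qc; rewrite mevalC QE => <-; ring.
have Q0 x y : w dX XXY * (x * x) + w dX XYY * (x * y) + w dX YYY * (y * y) = 0.
  have := congr1 (meval (fun i : 'I_3 => [:: x; y]`_i)) Qc.
  by rewrite mevalC QE c0.
have a6 : w dX YYY = 0 by rewrite -(Q0 0 1); ring.
apply: (not_divisible_by_X fw); apply: forall3; split;
  rewrite ?a6 //; exact: w0.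
Qed.

(** A factor common to the three coefficients, which are homogeneous, is
constant unless it vanishes at the origin; in that case it vanishes along a
cone, which meets every plane outside the origin. *)
Lemma no_common_factor_plane w (P1 P2 : 'cV[C]_3) :
  (forall s t, ev w (s *: P1 + t *: P2) = 0 -> s = 0 /\ t = 0) ->
  no_common_factor (coef w).
Proof.
move=> wP p /choice[q pq].
have rootless (r : {poly C}) : (forall t, r.[t] != 0) -> forall t t', r.[t] = r.[t'].
  move=> r0; have /size_poly1P[c _ ->] : size r == 1%N.
    apply: contraT => /closed_rootP[t]; rewrite rootE.
    by move/negPf: (r0 t) => ->.
  by move=> t t'; rewrite !hornerC.
pose f (v : 'cV[C]_3) := meval (v^~ 0) p.
have pf : polyfun (fun x => meval x p) by exact: polyfun_meval.
have line (u v : 'cV[C]_3) : exists r : {poly C}, forall t, f (u + t *: v) = r.[t].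
  have [r rE] := polyfun_curve (fun i => (u i 0)%:P + v i 0 *: 'X) pf.
  exists r => t; rewrite -rE /f; apply: meval_eq => i.
  by rewrite !mxE hornerD hornerC hornerZ hornerX mulrC.
have fev v i : ev w v 0 i = f v * meval (v^~ 0) (q i).
  rewrite /f -mevalM -pq meval_coef mxE //.
have [f0|f0] := eqVneq (f 0) 0.
  exfalso.
  have fP s t : f (s *: P1 + t *: P2) = 0 -> s = 0 /\ t = 0.
    by move=> fst; apply: wP; apply/rowP => i; rewrite fev fst mul0r mxE.
  have c1 t s s' : t != 0 -> f (s *: P1 + t *: P2) = f (s' *: P1 + t *: P2).
    move=> t0; have [r rE] := line (t *: P2) P1.
    rewrite ![_ + t *: P2]addrC !rE; apply: rootless => a.
    by rewrite -rE addrC; apply: contra_neq t0 => /fP[].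
  have c2 s t t' : s != 0 -> f (s *: P1 + t *: P2) = f (s *: P1 + t' *: P2).
    move=> s0; have [r rE] := line (s *: P1) P2.
    rewrite !rE; apply: rootless => a.
    by rewrite -rE; apply: contra_neq s0 => /fP[].
  have [r rE] := line 0 P2.
  set c := f (1 *: P1 + 0 *: P2).
  have r1 t : t != 0 -> r.[t] = c.
    move=> t0; rewrite -rE -(scale0r P1) (c1 t 0 1 t0).
    by apply: c2; rewrite oner_eq0.
  have rc : r = c%:P.
    have /eqP : (r - c%:P) * 'X = 0.
      apply: contraTeq isT => /poly_nonroot[t].
      rewrite hornerM hornerD hornerN hornerC hornerX mulf_eq0 negb_or subr_eq0.
      by move=> /andP[rt t0]; rewrite r1 ?eqxx in rt.
    by rewrite mulf_eq0 polyX_eq0 orbF subr_eq0 => /eqP.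
  have c0 : c = 0.
    by rewrite -[LHS](hornerC c 0) -rc -rE scale0r addr0.
  by have [/eqP] := fP 1 0 c0; rewrite oner_eq0.
have [i wi] : exists i, ev w P1 0 i != 0.
  apply: contrapT => w1; have [|/eqP] := wP 1 0; last by rewrite oner_eq0.
  rewrite scale1r scale0r addr0; apply/rowP => i; rewrite [RHS]mxE.
  by apply/eqP; apply: contrapT => /negP ?; apply: w1; exists i.
exists (f 0); apply: mpoly_ext => v; rewrite mevalC.
have a0 : coef w i != 0.
  by apply: contra_neq wi => a0; rewrite mxE -(meval_coef w i (P1^~ 0)) a0 meval0.
suff /eqP : (p - mpolyC 3 (f 0)) * coef w i = 0.
  by rewrite mulf_eq0 (negPf a0) orbF subr_eq0 => /eqP ->; rewrite mevalC.
apply: mpoly_ext => x; rewrite meval0 mevalM mevalB mevalC.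
pose u : 'cV[C]_3 := \col_j x j.
have fu : meval x p = f u by apply: meval_eq => j; rewrite mxE.
have au : meval x (coef w i) = ev w u 0 i by rewrite ev_meval.
rewrite fu au; have [->|au0] := eqVneq (ev w u 0 i) 0; first by rewrite mulr0.
have [r rE] := line 0 u.
have f1 : f u = r.[1] by rewrite -rE scale1r add0r.
have f00 : f 0 = r.[0] by rewrite -rE scale0r add0r.
rewrite f1 f00 (rootless r _ 1 0) ?subrr ?mul0r // => t.
rewrite -rE add0r; have [->|t0] := eqVneq t 0; first by rewrite scale0r.
have := ev_cubic_homog w t u => /rowP/(_ i); rewrite fev [RHS]mxE => E.
have : t ^+ 3 * ev w u 0 i != 0 by rewrite mulf_neq0 // expf_neq0.
by rewrite -E mulf_eq0 negb_or => /andP[].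
Qed.

Lemma foliation_form_F1 : @foliation_form R F1_form.
Proof.
apply/foliation_formE; split; first exact: radial_F1.
apply: (@no_common_factor_plane _ (vec3 1 0 0) (vec3 0 1 0)) => s t.
set v := _ + _ => e.
have es : s ^+ 3 = - ev (F1_form : 'M[C]_(3, 10)) v 0 dZ by rewrite ev_F1 !mxE /=; ring.
have et : t ^+ 3 = - ev (F1_form : 'M[C]_(3, 10)) v 0 dX by rewrite ev_F1 !mxE /=; ring.
by split; apply/eqP; move: es et; rewrite e !mxE oppr0 => /eqP + /eqP;
  rewrite !expf_eq0 /= => ? ?.
Qed.

Lemma foliation_form_G al be : al != 0 -> be != 0 -> @foliation_form R (G_form al be).
Proof.
move=> al0 be0; apply/foliation_formE; split; first exact: radial_G.
apply: (@no_common_factor_plane _ (vec3 0 1 0) (vec3 1 0 1)) => s t.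
set v := _ + _ => e.
have ec : al * (t ^+ 2 * s) = ev (G_form al be) v 0 dZ by rewrite ev_G !mxE /=; ring.
have ea : (be - al) * (t ^+ 2 * s) + s ^+ 3 = ev (G_form al be) v 0 dX.
  by rewrite ev_G !mxE /=; ring.
have eb : be * t ^+ 3 + t * s ^+ 2 = - ev (G_form al be) v 0 dY.
  by rewrite ev_G !mxE /=; ring.
rewrite e !mxE oppr0 in ea eb ec.
have ts : t ^+ 2 * s = 0 by move/eqP: ec; rewrite mulf_eq0 (negPf al0) => /eqP.
have s0 : s = 0.
  by move/eqP: ea; rewrite ts mulr0 add0r expf_eq0 => /eqP.
split=> //; move/eqP: eb; rewrite s0 expr0n mulr0 addr0 mulf_eq0 (negPf be0).
by rewrite expf_eq0 => /eqP.
Qed.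

(** A curve of common zeros of the coefficients would meet the line z = 0. *)
Lemma foliation_form_generic w : radial w -> no_singularity_on_Z0 w -> foliation_form w.
Proof.
move=> rw ns; apply/foliation_formE; split=> //.
apply: (@no_common_factor_plane _ (vec3 1 0 0) (vec3 0 1 0)) => s t e.
apply: ns; rewrite -[RHS]e; congr ev.
by apply/matrixP => i j; rewrite ord1 !mxE; move: i; apply: forall3; rewrite /=; ring.
Qed.

End Factors.

(** * Degenerations and closures of orbits *)

Section Limits.
Variable C : numClosedFieldType.
Implicit Types (w : 'M[C]_(3, 10)) (g : 'M[C]_3).

Lemma polyfun_cvg (T I : Type) (F : set_system T) (FF : Filter F)
    (f : (I -> C) -> C) (c : T -> I -> C) (l : I -> C) :
  polyfun f -> (forall i, c^~ i @ F --> l i) -> (fun t => f (c t)) @ F --> f l.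
Proof.
move=> pf cl; elim: pf => [a|i|f1 f2 _ IH1 _ IH2|f1 f2 _ IH1 _ IH2].
- exact: cvg_cst.
- exact: cl.
- exact: (@cvgD C C T F FF _ _ _ _ IH1 IH2).
- exact: (@cvgM C T F FF _ _ _ _ IH1 IH2).
Qed.

Lemma cvg_mxP (T : Type) (F : set_system T) (FF : Filter F) m n
    (M : T -> 'M[C]_(m, n)) (L : 'M[C]_(m, n)) :
  M @ F --> L <-> forall i j, (fun t => M t i j) @ F --> L i j.
Proof.
split=> [ML i j|ML].
  exact: (cvg_comp _ _ ML (@coord_continuous C m n i j L)).
apply/cvg_ballP => e e0.
have : \forall t \near F, forall i, forall j, ball (L i j) e (M t i j).
  apply: filter_forall => i; apply: filter_forall => j.
  by move/cvg_ballP: (ML i j); apply.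
by apply: filterS => t Mt; split.
Qed.

Lemma act_cvg (T : Type) (F : set_system T) (FF : Filter F)
    (G : T -> 'M[C]_3) (W : T -> 'M[C]_(3, 10)) g w :
  G @ F --> g -> W @ F --> w -> (fun t => act (G t) (W t)) @ F --> act g w.
Proof.
move=> /cvg_mxP Gg /cvg_mxP Ww; apply/cvg_mxP => i k.
pose I := ('I_3 * 'I_3 + 'I_3 * 'I_10)%type.
pose mG (x : I -> C) : 'M[C]_3 := \matrix_(a, b) x (inl (a, b)).
pose mW (x : I -> C) : 'M[C]_(3, 10) := \matrix_(a, b) x (inr (a, b)).
pose env (h : 'M[C]_3) (v : 'M[C]_(3, 10)) (i : I) : C :=
  match i with inl p => h p.1 p.2 | inr p => v p.1 p.2 end.
have mGE h v : mG (env h v) = h by apply/matrixP => a b; rewrite mxE.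
have mWE h v : mW (env h v) = v by apply/matrixP => a b; rewrite mxE.
have pf : polyfun (fun x : I -> C => act (mG x) (mW x) i k).
  apply: polyfun_act => a b.
    by apply: (polyfun_eq (polyfun_var C (inl (a, b)))) => x; rewrite mxE.
  by apply: (polyfun_eq (polyfun_var C (inr (a, b)))) => x; rewrite mxE.
have := @polyfun_cvg T I F FF _ (fun t => env (G t) (W t)) (env g w) pf.
rewrite mGE mWE; under eq_fun do rewrite mGE mWE.
by apply => -[[a b]|[a b]] /=.
Qed.

Definition degenerates w w0 : Prop :=
  forall e : C, 0 < e -> exists2 g, g \in unitmx & ball w0 e (act g w).

Lemma degenerates_act w w0 g : g \in unitmx -> degenerates w w0 -> degenerates w (act g w0).
Proof.
move=> gu ww0 e e0.
have : (fun w' => act g w') @ w0 --> act g w0.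
  by apply: (@act_cvg _ (nbhs w0) _ (fun=> g) id); [exact: cvg_cst | exact: cvg_id].
move=> /cvg_ballP/(_ e e0)/nbhs_ballP[d /= d0 dE].
have [h hu hd] := ww0 d d0; exists (h *m g); first by rewrite unitmx_mul hu.
by rewrite -actM; apply: dE.
Qed.

Lemma degenerates_trans w w0 w1 : degenerates w w0 -> degenerates w0 w1 -> degenerates w w1.
Proof.
move=> ww0 w01 e e0; have e2 : 0 < e / 2 by rewrite divr_gt0.
have [g gu ge] := w01 _ e2; have [h hu he] := degenerates_act gu ww0 e2.
exists h => //; rewrite [e]splitr; exact: ball_triangle ge he.
Qed.

Lemma degenerates_refl w : degenerates w w.
Proof. by move=> e e0; exists 1%:M; rewrite ?unitmx1 // act1; exact: ballxx. Qed.

Lemma scale_div (c d : C) w : c != 0 -> (d / c) *: (c *: w) = d *: w.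
Proof. by move=> c0; rewrite scalerA divfK. Qed.

End Limits.

Section Closure.
Variable R : realType.
Local Notation C := (Cplx R).

(** Open sets of foliations are the images of open cones of forms, and scalar
matrices absorb the scalars. *)
Lemma closure_orbitP (x y : @foliation_form R) :
  closure (PGL3_orbit (foliation_of x)) (foliation_of y) <->
  degenerates (set_val x) (set_val y).
Proof.
split=> [cl e e0|deg B].
  pose B := [set w : 'M[C]_(3, 10) | exists2 c : C, c != 0 & ball (set_val y : 'M[C]_(3, 10)) e (c *: w)].
  have oB : open B.
    have -> : B = \bigcup_(c in [set c : C | c != 0])
        ((fun w : 'M[C]_(3, 10) => c *: w) @^-1` ball (set_val y : 'M[C]_(3, 10)) e).
      by apply/seteqP; split=> [w [c c0 wb]|w [c c0 wb]]; exists c.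
    apply: bigcup_open => c c0; apply: open_comp; last exact: ball_open.
    by move=> w _; apply: scaler_continuous.
  pose B' := [set F : foliation R | exists2 z, foliation_of z = F & B (set_val z)].
  have nB : nbhs (foliation_of y) B'.
    apply: open_nbhs_nbhs; split; last first.
      by exists y => //; exists 1; rewrite ?oner_eq0 // scale1r; exact: ballxx.
    rewrite /open /= /quotient_open.
    exists B => //; apply/seteqP; split=> z /=.
      by exists z.
    case=> z' /foliation_of_eq[c c0 zE] [d d0 db].
    exists (d / c); first by rewrite mulf_neq0 ?invr_eq0.
    by rewrite zE scale_div.
  have [F [/orbitP[g gu [z zF zE]]]] := cl _ nB.
  case=> z' z'F [c c0 cb].
  move: zF; rewrite -z'F => /foliation_of_eq[d d0 z'E].
  have [s su sE] := scale_act (mulf_neq0 c0 d0).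
  exists (g *m s); first by rewrite unitmx_mul gu.
  by rewrite -actM sE -zE -scalerA -z'E.
rewrite nbhsE => -[U [oU Uy] UB].
move: oU; rewrite /open /= /quotient_open => -[V oV VE].
have Vy : V (set_val y) by move: Uy; rewrite -[U _]/((\pi_(_)%qT @^-1` U) y) -VE.
have /nbhs_ballP[e /= e0 eV] : nbhs (set_val y : 'M[C]_(3, 10)) V by apply: open_nbhs_nbhs.
have [g gu ge] := deg e e0.
have [z zE] := foliation_form_ex (foliation_form_act gu (foliation_form_set_val x)).
exists (foliation_of z); split.
  by apply/orbitP; exists g => //; exists z.
apply: UB; have : (set_val @^-1` V) z by rewrite /= zE; apply: eV.
by rewrite VE.
Qed.

End Closure.

(** * Elimination with complete pivoting *)

Section Pivoting.
Variable C : numClosedFieldType.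

Lemma mulmx_bound m n p (A : 'M[C]_(m, n)) (B : 'M[C]_(n, p)) a b :
  (forall i j, `|A i j| <= a) -> (forall i j, `|B i j| <= b) ->
  forall i j, `|(A *m B) i j| <= n%:R * (a * b).
Proof.
move=> Aa Bb i j; rewrite mxE; apply: le_trans (ler_norm_sum _ _ _) _.
rewrite -[n in n%:R]card_ord mulr_natl -sumr_const; apply: ler_sum => k _.
by rewrite normrM; apply: ler_pM.
Qed.

Lemma max_norm (I : finType) (i0 : I) (f : I -> C) : exists i, forall j, `|f j| <= `|f i|.
Proof.
have [i iP] : exists i, forall j, j \in enum I -> `|f j| <= `|f i|.
  elim: (enum I) => [|i s [k kP]]; first by exists i0.
  have [ik|/ltW ki] := real_leP (normr_real (f i)) (normr_real (f k)).
    by exists k => j; rewrite inE => /orP[/eqP ->|/kP].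
  by exists i => j; rewrite inE => /orP[/eqP ->|/kP/le_trans ->].
by exists i => j; apply: iP; rewrite mem_enum.
Qed.

(** Gaussian elimination with complete pivoting: the factors m and k are
bounded in terms of n only, as are the quotients of the successive pivots. *)
Lemma complete_pivoting n : exists2 B : C, 1 <= B & forall g : 'M[C]_n,
  exists (m k : 'M[C]_n) (a : 'rV[C]_n),
  [/\ g *m m = k *m diag_mx a,
      forall i j, `|m i j| <= B /\ `|k i j| <= B,
      `|\det m| = 1 /\ `|\det k| = 1,
      forall c, (forall i j, `|g i j| <= c) -> forall i, `|a 0 i| <= 2 ^+ i * c &
      forall i j : 'I_n, (i <= j)%N -> `|a 0 j| <= 2 ^+ (j - i) * `|a 0 i|].
Proof.
elim: n => [|n [B B1 IHn]].
  exists 1 => // g; exists 1%:M, 1%:M, 0; split; [| by case | | by move=> c _ [] | by case].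
  - by apply/matrixP => -[].
  - by rewrite !det1 normr1.
pose B' := n%:R * (1 * B) + B.
have B0 : 0 <= B by apply: le_trans B1.
have BB' : B <= B' by rewrite /B' lerDr mulr_ge0 // mul1r.
have nBB' : n%:R * (1 * B) <= B' by rewrite /B' lerDl.
have B'1 : 1 <= B' by apply: le_trans BB'.
have B'0 : 0 <= B' by apply: le_trans B'1.
exists B' => // g0.
have [[i0 j0] max0] := max_norm (ord0, ord0) (fun p : 'I_n.+1 * 'I_n.+1 => g0 p.1 p.2).
have [p0|p0] := eqVneq (g0 i0 j0) 0.
  have g00 : g0 = 0.
    apply/matrixP => i j; rewrite mxE; apply/eqP; rewrite -normr_le0.
    by have := max0 (i, j); rewrite /= p0 normr0.
  exists 1%:M, 1%:M, 0; split.
  - by rewrite g00 mul0mx mul1mx; apply/matrixP => i j; rewrite !mxE mul0rn.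
  - by move=> i j; rewrite !mxE; case: eqP => _; rewrite ?normr1 ?normr0.
  - by rewrite !det1 normr1.
  - move=> c cP i; rewrite mxE normr0 mulr_ge0 ?exprn_ge0 //.
    by apply: le_trans (cP i i).
  - by move=> i j _; rewrite !mxE normr0 mulr0.
pose g : 'M[C]_(1 + n) := xrow i0 0 (xcol j0 0 g0).
pose p := g 0 0; pose u := ursubmx g; pose l := dlsubmx g; pose D := drsubmx g.
have pE : p = g0 i0 j0 by rewrite /p !mxE !tpermR.
have maxg i j : `|g i j| <= `|p| by rewrite pE !mxE; exact: (max0 (_, _)).
have pn0 : p != 0 by rewrite pE.
have gE : g = block_mx p%:M u l D.
  rewrite -[LHS]submxK; congr block_mx.
  by apply/matrixP => i j; rewrite !ord1 !mxE /= mulr1n /p !mxE; congr (g0 _ _);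
     congr (tperm _ _ _); apply: val_inj.
(* The Schur complement of the pivot p. *)
pose S := D - p^-1 *: (l *m u).
have [m [k [a [E bd [dm dk] ac achain]]]] := IHn S.
have ul i j : `|(p^-1 *: u) i j| <= 1.
  rewrite !mxE normrM normfV mulrC ler_pdivrMr ?normr_gt0 // mul1r.
  by rewrite -[X in `|X|](_ : g (lshift n i) (rshift 1 j) = _) ?maxg // !mxE.
have ll i j : `|(p^-1 *: l) i j| <= 1.
  rewrite !mxE normrM normfV mulrC ler_pdivrMr ?normr_gt0 // mul1r.
  by rewrite -[X in `|X|](_ : g (rshift 1 i) (lshift n j) = _) ?maxg // !mxE.
have Sb i j : `|S i j| <= 2 * `|p|.
  have -> : S i j = D i j - ((p^-1 *: l) *m u) i j 
    by rewrite /S scalemxAl [LHS]mxE; congr (_ + _); rewrite [LHS]mxE.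
  apply: le_trans (ler_normB _ _) _; rewrite mulr_natl mulr2n lerD //.
    by rewrite -[X in `|X|](_ : g (rshift 1 i) (rshift 1 j) = _) ?maxg // !mxE.
  have ub (i' : 'I_1) j' : `|u i' j'| <= `|p|.
    by rewrite -[X in `|X|](_ : g (lshift n i') (rshift 1 j') = _) ?maxg // !mxE.
  by have := mulmx_bound ll ub i j; rewrite !mul1r.
pose m' : 'M[C]_(1 + n) := block_mx 1%:M (- (p^-1 *: u) *m m) 0 m.
pose k' : 'M[C]_(1 + n) := block_mx 1%:M 0 (p^-1 *: l) k.
pose a' : 'rV[C]_(1 + n) := row_mx p%:M a.
have aEl (z : 'I_1) : a' 0 (lshift n z) = p by rewrite /a' row_mxEl ord1 mxE mulr1n.
have aEr i : a' 0 (rshift 1 i) = a 0 i by rewrite /a' row_mxEr.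
have E' : g *m m' = k' *m diag_mx a'.
  rewrite gE /m' /k' /a' diag_mx_row !mulmx_block.
  rewrite !(mulmx1, mul1mx, mulmx0, mul0mx, addr0, add0r).
  congr block_mx.
  - by apply/matrixP => i j; rewrite !ord1 !mxE.
  - by rewrite mul_scalar_mx mulNmx scalerN -scalemxAl scalerA mulfV // scale1r addNr.
  - rewrite -scalemxAl; apply/matrixP => i j.
    by rewrite !ord1 !mxE big_ord1 !mxE eqxx mulr1n mulrC mulfK.
  - rewrite -E /S mulmxBl mulmxA mulmxN mulNmx -scalemxAr addrC.
    by rewrite scalemxAl.
exists (tperm_mx j0 0 *m m'), (tperm_mx i0 0 *m k'), a'; split.
- have gg : tperm_mx i0 0 *m g = g0 *m tperm_mx j0 0.
    by rewrite /g xrowE xcolE [LHS]mulmxA -perm_mxM tperm2 perm_mx1 mul1mx.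
  by rewrite mulmxA -gg -!mulmxA E'.
- have mb i j : `|m' i j| <= B'.
    case: (@split_ordP 1 n i) => i' ->; case: (@split_ordP 1 n j) => j' -> /=.
    + rewrite block_mxEul !ord1 mxE eqxx normr1 //.
    + rewrite block_mxEur mulNmx mxE normrN; apply: le_trans nBB'.
      by apply: mulmx_bound => // a1 b1; have [] := bd a1 b1.
    + by rewrite block_mxEdl mxE normr0.
    + by rewrite block_mxEdr; have [/le_trans ->] := bd i' j'.
  have kb i j : `|k' i j| <= B'.
    case: (@split_ordP 1 n i) => i' ->; case: (@split_ordP 1 n j) => j' -> /=.
    + rewrite block_mxEul !ord1 mxE eqxx normr1 //.
    + by rewrite block_mxEur mxE normr0.
    + by rewrite block_mxEdl (le_trans (ll _ _)).
    + by rewrite block_mxEdr; have [_ /le_trans ->] := bd i' j'.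
  by move=> i j; rewrite -!xrowE [xrow _ _ m' _ _]mxE [xrow _ _ k' _ _]mxE.
- have dm' : \det m' = \det m by rewrite [LHS](@det_ublock _ 1 n) det1 mul1r.
  have dk' : \det k' = \det k by rewrite [LHS](@det_lblock _ 1 n) det1 mul1r.
  rewrite !det_mulmx [\det m']dm' [\det k']dk' !normrM dm dk !mulr1.
  by rewrite !det_perm !normrX normrN1 !expr1n.
- move=> c cP i; case: (@split_ordP 1 n i) => i' -> /=.
    by rewrite aEl ord1 expr0 mul1r pE; exact: cP.
  rewrite aEr add1n exprS -mulrA mulrCA; apply: ac => i1 j1.
  apply: le_trans (Sb i1 j1) _; rewrite ler_pM2l //.
  by rewrite pE; exact: cP.
- move=> i j; case: (@split_ordP 1 n i) => i' ->; case: (@split_ordP 1 n j) => j' -> /= ij.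
  + by rewrite !aEl !ord1 expr0 mul1r.
  + rewrite aEr aEl ord1 subn0 add1n exprS -mulrA mulrCA.
    by apply: ac => i1 j1.
  + by move: ij; rewrite ord1.
  + by rewrite !aEr subnDl; apply: achain.
Qed.

End Pivoting.

(** * Limits along ultrafilters *)

Section UltraLimits.
Variable R : realType.
Local Notation C := (Cplx R).

Lemma ultra_compact_cvg (T : Type) (V : topologicalType) (U : set_system T) (f : T -> V)
  (K : set V) : UltraFilter U -> compact K -> U (f @^-1` K) -> exists l : V, f @ U --> l.
Proof.
move=> UU cK UK.
have [l [_ cl]] := cK (f @ U) _ UK; exists l => B nB.
have [//|UB] := in_ultra_setVsetC (f @^-1` B) UU.
by have [x [/= ? ?]] := cl (~` B) B UB nB.
Qed.

Lemma Re_normc_bound (z : C) : `|complex.Re z| <= complex.Re `|z|.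
Proof.
have := normc_ge_Re (z : R[i]); rewrite lecE => /andP[_ /=].
by [].
Qed.

Lemma Im_normc_bound (z : C) : `|complex.Im z| <= complex.Re `|z|.
Proof.
rewrite [`|z|](normc_def (z : R[i])) /= -sqrtr_sqr ler_wsqrtr //.
by rewrite lerDr sqr_ge0.
Qed.

Lemma normc_bound (z : C) (e : R) : `|complex.Re z| < e / 2 -> `|complex.Im z| < e / 2 ->
  `|z| < e%:C%C.
Proof.
move=> re ie; have e0 : 0 < e by rewrite -(pmulr_lgt0 _ (_ : 0 < 2^-1)) ?invr_gt0 //;
  exact: le_lt_trans re.
rewrite [`|z|](normc_def (z : R[i])) ltcR.
rewrite -[e]gtr0_norm // -sqrtr_sqr ltr_sqrt ?exprn_gt0 //.
have sq (x : R) : `|x| < e / 2 -> x ^+ 2 < e ^+ 2 / 4.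
  move=> xe; rewrite -(ger0_norm (sqr_ge0 x)) normrX.
  have -> : e ^+ 2 / 4 = (e / 2) ^+ 2 by field.
  by rewrite ltr_pXn2r // nnegrE ?divr_ge0 // ltW.
apply: (lt_le_trans (ltrD (sq _ re) (sq _ ie))).
by have := sqr_ge0 e; lra.
Qed.

(** The real and imaginary parts remain in a segment, which is compact. *)
Lemma ultra_bounded_cvg (T : Type) (U : set_system T) (f : T -> C) (B : C) :
  UltraFilter U -> U [set t | `|f t| <= B] -> exists l : C, f @ U --> l.
Proof.
move=> UU UB; pose b : R := complex.Re B.
have bnd (p : C -> R) : (forall z : C, `|p z| <= complex.Re `|z|) ->
    exists l : R, (fun t => p (f t)) @ U --> l.
  move=> pz; apply: (ultra_compact_cvg _ (@segment_compact R (- b) b)).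
  apply: filterS UB => t /= fB; rewrite in_itv /= -ler_norml.
  apply: le_trans (pz _) _; move: fB; rewrite lecE => /andP[_].
  by [].
have [l1 L1] := bnd _ Re_normc_bound; have [l2 L2] := bnd _ Im_normc_bound.
exists (Complex l1 l2); apply/cvg_ballP => e e0.
have eE : e = (complex.Re e)%:C%C.
  by move: e0; rewrite ltcE => /andP[/eqP ie _]; rewrite [LHS](complexE (e : R[i])) ie mulr0 addr0.
have e0' : 0 < complex.Re e / 2.
  by rewrite divr_gt0 //; move: e0; rewrite ltcE => /andP[].
move/cvg_ballP: L1 => /(_ _ e0') L1; move/cvg_ballP: L2 => /(_ _ e0') L2.
apply: filterS2 L1 L2 => t t1 t2; rewrite eE.
by apply: normc_bound; rewrite raddfB.
Qed.

End UltraLimits.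

(** * Comparison of weights *)

Section DegenerationWeights.
Variable C : numClosedFieldType.
Implicit Types (w f v : 'M[C]_(3, 10)) (g : 'M[C]_3).

(** The entry (i, k) is multiplied by s^4 r^p t^q under diag(s, s r, s r t). *)
Definition wt1 (i : 'I_3) (k : 'I_10) : nat :=
  nth 0%N [:: 0; 1; 1]%N i + nth 0%N [:: 0; 1; 1; 2; 2; 2; 3; 3; 3; 3]%N k.
Definition wt2 (i : 'I_3) (k : 'I_10) : nat :=
  nth 0%N [:: 0; 0; 1]%N i + nth 0%N [:: 0; 0; 1; 0; 1; 2; 0; 1; 2; 3]%N k.

Lemma act_diag_wt s r t w i k : act (diag3 s (s * r) (s * r * t)) w i k =
  s ^+ 4 * (r ^+ wt1 i k * t ^+ wt2 i k) * w i k.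
Proof.
rewrite act_diag; congr (_ * _); rewrite /mono /wt1 /wt2.
by move: i k; apply: forall3; apply: forall10; rewrite /=; ring.
Qed.

(** The relations satisfied by the entries of a form f and of the limit v of its
images under diagonal matrices with successive quotients r and t; truncated
subtraction clears the denominators. *)
Definition weight_relations f v (r t : C) : Prop := forall i k i' k',
  v i' k' * f i k * (r ^+ (wt1 i k - wt1 i' k') * t ^+ (wt2 i k - wt2 i' k')) =
  v i k * f i' k' * (r ^+ (wt1 i' k' - wt1 i k) * t ^+ (wt2 i' k' - wt2 i k)).

Lemma weight_relations_diag f s r t :
  weight_relations f (act (diag3 s (s * r) (s * r * t)) f) r t.
Proof.
move=> i k i' k'; rewrite !act_diag_wt.
have E (x : C) a b : x ^+ a * x ^+ (b - a) = x ^+ b * x ^+ (a - b).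
  by rewrite -!exprD -!maxnE maxnC.
transitivity (s ^+ 4 * f i k * f i' k' * (r ^+ wt1 i' k' * r ^+ (wt1 i k - wt1 i' k')) *
   (t ^+ wt2 i' k' * t ^+ (wt2 i k - wt2 i' k'))); first by ring.
by rewrite (E r (wt1 i' k')) (E t (wt2 i' k')); ring.
Qed.

(** For radial forms, only the coordinates of nonpositive weight under
diag(s^-3, s, s^5) remain. *)
Definition principal v : Prop :=
  [/\ v dX XZZ = 0, v dX ZZZ = 0, v dX YYZ = 0, v dZ XYY = 0 & v dX YZZ = 0] /\
  [/\ v dY XZZ = 0, v dY YYZ = 0, v dY YZZ = 0 & v dY ZZZ = 0].

Lemma radial_entries w : radial w ->
  [/\ w dX XXX = 0, w dY YYY = 0 & w dZ ZZZ = 0] /\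
  ([/\ w dY XXX = - w dX XXY, w dZ XXX = - w dX XXZ, w dY XXY = - w dX XYY &
       w dZ XXZ = - w dX XZZ] /\
   [/\ w dY XYY = - w dX YYY, w dZ XZZ = - w dX ZZZ, w dZ YYY = - w dY YYZ &
       w dZ YYZ = - w dY YZZ]) /\
  [/\ w dZ YZZ = - w dY ZZZ, w dX XYZ = - (w dZ XXY + w dY XXZ),
     w dY XYZ = - (w dX YYZ + w dZ XYY) & w dZ XYZ = - (w dX YZZ + w dY XZZ)].
Proof. by move=> rw; rewrite -(radial_coord rw) !mxE /=. Qed.
End DegenerationWeights.

Section DegenerationCases.
Variable R : realType.
Local Notation C := (Cplx R).
Implicit Types (w f v : 'M[C]_(3, 10)) (g : 'M[C]_3).

(** The limits of the images of a form under diagonal matrices. Either the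
quotients of the diagonal entries have nonzero limits, and the limit is
equivalent to the form, or some of the weights prevail over the others. *)
Lemma limit_cases f v r t : radial f -> radial v -> foliation_form v ->
  ~ line_invariant f -> (flag_singular f -> nonresonant f) ->
  weight_relations f v r t ->
  (exists2 c, c != 0 & [/\ r != 0, t != 0 & v = c *: act (diag3 1 r (r * t)) f]) \/
  [/\ principal v, v dX YYY != 0 & (v dZ XXY = 0 /\ v dY XXZ = 0 /\ v dZ XXX != 0) \/ nonresonant v].
Proof.
move=> rf rv fv li fs rel.
have [[_ b6 _] [[[b0E c0E b1E c2E] [b3E c5E c6E c7E]] [c8E a4E b4E c4E]]] := radial_entries rv.
(* Otherwise x would divide the three coefficients of v. *)
have not_X : (forall i k, (2 < wt1 i k)%N -> v i k = 0) -> False.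
  by move=> v0; apply: (not_divisible_by_X fv) => i; split; apply: v0; move: i; apply: forall3.
(* Otherwise v would be a multiple of x dy - y dx. *)
have not_Q : (forall i k, (0 < wt2 i k)%N -> v i k = 0) -> False.
  move=> v0; apply: (not_fibration fv) => i k.
  have [q0|q0 _ _] := posnP (wt2 i k); last exact: v0.
  have [v1 v2 _] := (radial_entries rv).1.
  by move: i k q0; apply: forall3; apply: forall10.
have [r0|r0] := eqVneq r 0; last first.
  have [a [b [fab qab]]] : exists a b, f a b != 0 /\ wt2 a b = 0%N.
    apply: contrapT => no; apply: li.
    by split; apply/eqP/negPn/negP => e; apply: no;
      [exists dX, XXY | exists dX, XYY | exists dX, YYY].
  have [t0|t0] := eqVneq t 0.
    exfalso; apply: not_Q => i k q0.
    move: (rel a b i k); rewrite qab sub0n expr0 mulr1 subn0 t0 [0 ^+ wt2 i k]expr0n.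
    rewrite -[wt2 i k == 0%N]negbK -lt0n q0 /= !mulr0 => /eqP.
    by rewrite !mulf_eq0 (negPf fab) expf_eq0 (negPf r0) andbF !orbF => /eqP.
  left; pose M i k := r ^+ wt1 i k * t ^+ wt2 i k.
  have M0 i k : M i k != 0 by rewrite mulf_neq0 // expf_neq0.
  have relM i k : v i k * (M a b * f a b) = v a b * (M i k * f i k).
    have sp (x : C) p p' : x ^+ p = x ^+ (p - p') * x ^+ minn p p'.
      by rewrite -exprD; congr (_ ^+ _); rewrite minnE; lia.
    have sp' (x : C) p p' : x ^+ p' = x ^+ (p' - p) * x ^+ minn p p'.
      by rewrite minnC; exact: sp.
    rewrite /M (sp r (wt1 a b) (wt1 i k)) (sp t (wt2 a b) (wt2 i k)).
    rewrite (sp' r (wt1 a b) (wt1 i k)) (sp' t (wt2 a b) (wt2 i k)).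
    have := rel a b i k.
    move: (r ^+ (_ - _)) (t ^+ (_ - _)) (r ^+ (_ - _)) (t ^+ (_ - _)) => x1 x2 x3 x4 E.
    move: (r ^+ minn _ _) (t ^+ minn _ _) => m1 m2.
    have := congr1 (fun z => z * (m1 * m2)) E => /= {}E.
    transitivity (v i k * f a b * (x3 * x4) * (m1 * m2)); first by ring.
    by rewrite E; ring.
  have Mf0 : M a b * f a b != 0 by rewrite mulf_neq0.
  exists (v a b / (M a b * f a b)); last first.
    split=> //; apply/matrixP => i k; rewrite mxE.
    have := act_diag_wt 1 r t f i k; rewrite mul1r expr1n mul1r => ->.
    by apply: (mulIf Mf0); rewrite relM /M; field; rewrite fab /=; rewrite !expf_neq0.
  rewrite mulf_neq0 ?invr_eq0 //; apply/eqP => vab; apply: not_X => i k _.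
  by apply: (mulIf Mf0); rewrite relM vab !mul0r.
right.
(* A nonzero entry of f makes the entries of v of greater weight vanish. *)
have kill a b i k : f a b != 0 -> (wt1 a b <= wt1 i k)%N ->
    (wt2 a b <= wt2 i k)%N || (t != 0) -> (wt1 a b < wt1 i k)%N || (wt2 a b < wt2 i k)%N && (t == 0) ->
    v i k = 0.
  move=> fab p12 q12 lt; move: (rel a b i k).
  have -> : (wt1 a b - wt1 i k = 0)%N by apply/eqP; rewrite subn_eq0.
  have -> : r ^+ (wt1 i k - wt1 a b) * t ^+ (wt2 i k - wt2 a b) = 0.
    case/orP: lt => [lt|/andP[lt /eqP ->]].
      by rewrite r0 expr0n subn_eq0 leqNgt lt mul0r.
    by rewrite [0 ^+ (wt2 _ _ - _)]expr0n subn_eq0 leqNgt lt mulr0.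
  have tn0 : t ^+ (wt2 a b - wt2 i k) != 0.
    case/orP: q12 => [q12|t0]; last by rewrite expf_neq0.
    by rewrite (_ : wt2 a b - wt2 i k = 0)%N ?expr0 ?oner_eq0 //; apply/eqP; rewrite subn_eq0.
  rewrite expr0 mul1r mulr0 => /eqP; rewrite !mulf_eq0 (negPf fab) (negPf tn0) !orbF.
  by move/eqP.
have low a b : f a b != 0 -> (wt1 a b <= 2)%N -> wt2 a b = 0%N \/ t != 0 -> False.
  move=> fab p2 q0; apply: not_X => i k p3; apply: (kill a b) => //.
  - exact: ltnW (leq_ltn_trans p2 p3).
  - by case: q0 => [->//|->]; rewrite orbT.
  - by rewrite (leq_ltn_trans p2 p3).
have [t0|t0] := eqVneq t 0; last first.
  exfalso.
  have fb0 : f dY XXX = 0 by apply/eqP/negPn/negP => e; apply: (low dY XXX) => //; right.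
  have fc0 : f dZ XXX = 0 by apply/eqP/negPn/negP => e; apply: (low dZ XXX) => //; right.
  have fb1 : f dY XXY = 0 by apply/eqP/negPn/negP => e; apply: (low dY XXY) => //; right.
  have [c1 _] := fs (And3 fb0 fc0 fb1).
  by apply: (low dZ XXY) => //; right.
have fb0 : f dY XXX = 0 by apply/eqP/negPn/negP => e; apply: (low dY XXX) => //; left.
have fb1 : f dY XXY = 0 by apply/eqP/negPn/negP => e; apply: (low dY XXY) => //; left.
have [_ a1E _ a3E] := radial_jet rf.
have fa6 : f dX YYY != 0.
  by apply/eqP => a6; apply: li; split=> //; rewrite ?a1E ?a3E ?fb0 ?fb1 oppr0.
have k3 i k : (2 < wt1 i k)%N -> (0 < wt2 i k)%N -> v i k = 0.
  by move=> p q; apply: (kill dX YYY); rewrite ?t0 ?eqxx ?orbT // q orbT.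
have va6 : v dX YYY != 0.
  apply/eqP => a6; apply: not_X => i k p.
  have [q0|] := posnP (wt2 i k); last exact: k3.
  by move: i k p q0; apply: forall3; apply: forall10 => //; rewrite b3E a6 oppr0.
have [fc0|fc0] := eqVneq (f dZ XXX) 0; last first.
  have k2 i k : (1 < wt1 i k)%N -> (0 < wt2 i k)%N -> v i k = 0.
    by move=> p q; apply: (kill dZ XXX); rewrite // ?q ?p // ltnW.
  split=> //; first by do 2?split; apply: k2.
  left; split; [exact: k2|split; first exact: k2].
  apply/eqP => c0; apply: not_Q => i k q.
  have [p|p] := ltnP 1 (wt1 i k); first exact: k2.
  move: i k p q; apply: forall3; apply: forall10 => // _ _.
  by rewrite -[LHS]opprK -c0E c0 oppr0.
have nr := fs (And3 fb0 fc0 fb1); have [c1 [b2 s12]] := nr.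
have k2 i k : (1 < wt1 i k)%N -> (1 < wt2 i k)%N -> v i k = 0.
  move=> p q; apply: (kill dZ XXY) => //; rewrite ?t0 ?eqxx ?orbT //.
    by rewrite (ltnW q).
  by rewrite q orbT.
split=> //; first by do 2?split; first [exact: k2 | exact: k3].
have := rel dZ XXY dY XXZ; rewrite /wt1 /wt2 /= subnn !expr0 !mulr1 => e.
have [vc1|vc1] := eqVneq (v dZ XXY) 0.
  have vb2 : v dY XXZ = 0.
    by move/eqP: e; rewrite vc1 mul0r mulf_eq0 (negPf c1) orbF => /eqP.
  left; do 2?split=> //; apply/eqP => c0; apply: not_Q => i k q.
  have [p|p] := ltnP 2 (wt1 i k); first exact: k3.
  have a2 : v dX XXZ = 0 by rewrite -[LHS]opprK -c0E c0 oppr0.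
  have a4 : v dX XYZ = 0 by rewrite a4E vc1 vb2 addr0 oppr0.
  by move: i k p q; apply: forall3; apply: forall10 => // _ _; exact: k2.
right; split=> //; split.
  apply/eqP => vb2; move/eqP: e; rewrite vb2 mul0r eq_sym mulf_eq0.
  by rewrite (negPf vc1) (negPf b2).
apply/eqP => vs; move/eqP: s12; apply; apply: (mulfI vc1).
by rewrite mulr0 mulrDr -e -mulrDl vs mul0r.
Qed.

End DegenerationCases.

(** * Classification of the degenerations *)

Section FilterGeneral.
Variable C : numClosedFieldType.

Lemma cvg_eventually_eq0 (T : Type) (U : set_system T) (f : T -> C) (l : C) :
  ProperFilter U -> f @ U --> l -> U [set t | f t = 0] -> l = 0.
Proof.
move=> PU fl U0; apply/eqP/negPn/negP => l0.
have n0 : 0 < `|l| by rewrite normr_gt0.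
have Ub : U [set t | ball l `|l| (f t)] by move/cvg_ballP: fl; apply.
have [t [/= ft0]] := filter_ex (filterI U0 Ub).
by rewrite ft0 /ball /= subr0 ltxx.
Qed.

Lemma det_cvg (T : Type) (U : set_system T) n (M : T -> 'M[C]_n) (L : 'M[C]_n) :
  Filter U -> M @ U --> L -> (fun t => \det (M t)) @ U --> \det L.
Proof.
move=> FU /(cvg_mxP) ML.
pose E (x : 'I_n * 'I_n -> C) := \det (\matrix_(i, j) x (i, j)).
have pE : polyfun E.
  apply: polyfun_det => i j.
  by apply: (polyfun_eq (polyfun_var C (i, j))) => x; rewrite mxE.
have EM (A : 'M[C]_n) : E (fun p => A p.1 p.2) = \det A.
  by rewrite /E; congr determinant; apply/matrixP => i j; rewrite mxE.
have := @polyfun_cvg C T _ U FU E (fun t p => M t p.1 p.2) (fun p => L p.1 p.2) pE.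
rewrite EM; under eq_fun do rewrite EM.
by apply => -[i j] /=.
Qed.

(** Bounded factors of determinant of modulus one do not degenerate. *)
Lemma det_norm1_cvg (T : Type) (U : set_system T) n (M : T -> 'M[C]_n) (L : 'M[C]_n) :
  ProperFilter U -> (forall t, `|\det (M t)| = 1) -> M @ U --> L -> L \in unitmx.
Proof.
move=> PU M1 ML; rewrite unitmxE unitfE; apply/eqP => L0.
have dM : (fun t => \det (M t)) @ U --> \det L by exact: det_cvg.
have Ub : U [set t | ball (\det L) 1 (\det (M t))] by move/cvg_ballP: dM; apply.
have [t /=] := filter_ex Ub.
by rewrite L0 /ball /= sub0r normrN M1 ltxx.
Qed.

Lemma weight_relations_cvg (T : Type) (U : set_system T) (F V : T -> 'M[C]_(3, 10))
    (r t : T -> C) f v r0 t0 : ProperFilter U ->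
  F @ U --> f -> V @ U --> v -> r @ U --> r0 -> t @ U --> t0 ->
  U [set x | weight_relations (F x) (V x) (r x) (t x)] -> weight_relations f v r0 t0.
Proof.
move=> PU /cvg_mxP Ff /cvg_mxP Vv rr tt UW i k i' k'.
apply/eqP; rewrite -subr_eq0; apply/eqP.
pose E (x : nat -> C) :=
  x 0%N * x 1%N * (x 4%N ^+ (wt1 i k - wt1 i' k') * x 5%N ^+ (wt2 i k - wt2 i' k')) -
  x 2%N * x 3%N * (x 4%N ^+ (wt1 i' k' - wt1 i k) * x 5%N ^+ (wt2 i' k' - wt2 i k)).
have pE : polyfun E.
  by apply: polyfun_sub; apply: polyfun_mul; apply: polyfun_mul;
    try exact: polyfun_var; apply: polyfun_exp; exact: polyfun_var.
pose c (x : T) (n : nat) := [:: V x i' k'; F x i k; V x i k; F x i' k'; r x; t x]`_n.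
pose l (n : nat) := [:: v i' k'; f i k; v i k; f i' k'; r0; t0]`_n.
have cl n : c^~ n @ U --> l n.
  rewrite /c /l; do 6![case: n => [|n] /=; first by auto].
  exact: cvg_cst.
have FU : Filter U by exact: _.
have Ec : (fun x => E (c x)) @ U --> E l by exact: (polyfun_cvg FU pE cl).
apply: (cvg_eventually_eq0 PU Ec).
by apply: filterS UW => x Wx; rewrite /= /E /c /= Wx subrr.
Qed.

Lemma successive_quotients (x y z : C) : x != 0 -> y != 0 ->
  z = x * (y / x) * (z / y).
Proof. by move=> x0 y0; rewrite (mulrC x) divfK // mulrC divfK. Qed.

End FilterGeneral.

Section LimitData.
Variable R : realType.
Local Notation C := (Cplx R).
Implicit Types (w f v : 'M[C]_(3, 10)) (g : 'M[C]_3).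

Lemma ultra_bounded_mx (T : Type) (U : set_system T) n (M : T -> 'M[C]_n) (B : C) :
  UltraFilter U -> (forall t i j, `|M t i j| <= B) -> exists L : 'M[C]_n, M @ U --> L.
Proof.
move=> UU MB.
have /choice[l lP] (p : 'I_n * 'I_n) : exists l : C, (fun t => M t p.1 p.2) @ U --> l.
  by apply: (@ultra_bounded_cvg R T U _ B UU); apply: filterE => t /=; exact: MB.
exists (\matrix_(i, j) l (i, j)); apply/cvg_mxP => i j; rewrite mxE.
exact: (lP (i, j)).
Qed.

(** The Cartan decomposition of the elements g of the linear group by which w
degenerates to w0, with bounded factors instead of unitary ones. *)
Lemma degenerates_weight_relations w w0 : degenerates w w0 ->
  exists k m r t, [/\ k \in unitmx, m \in unitmx &
    weight_relations (act k w) (act m w0) r t].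
Proof.
move=> deg.
pose G (e : C) := [set g : 'M[C]_3 | g \in unitmx /\ ball w0 e (act g w)].
pose F := filter_from [set e : C | 0 < e] G.
have PF : ProperFilter F.
  apply: filter_from_proper; last first.
    by move=> e /= e0; have [g gu ge] := deg e e0; exists g.
  apply: filter_from_filter; first by exists 1; rewrite /= ltr01.
  move=> e1 e2 /= p1 p2.
  have [e12|/ltW e21] := real_leP (gtr0_real p1) (gtr0_real p2).
    by exists e1 => // g [gu ge]; split; split=> //; apply: le_ball ge.
  by exists e2 => // g [gu ge]; split; split=> //; apply: le_ball ge.
have [U [UU FU]] := ultraFilterLemma PF.
have Uu : U [set g | g \in unitmx].
  by apply: FU; exists 1; rewrite /= ?ltr01 // => g [].
have cw : (fun g => act g w) @ U --> w0.
  by apply/cvg_ballP => e e0; apply: FU; exists e => // g [].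
have [B B1 piv] := @complete_pivoting C 3.
have /choice[m /choice[k /choice[a mka]]] := piv.
have [mu Mmu] : exists L : 'M[C]_3, m @ U --> L.
  by apply: (@ultra_bounded_mx _ U 3 m B UU) => g i j; have [_ /(_ i j)[]] := mka g.
have [ka Kka] : exists L : 'M[C]_3, k @ U --> L.
  by apply: (@ultra_bounded_mx _ U 3 k B UU) => g i j; have [_ /(_ i j)[]] := mka g.
pose r g := a g 0 dY / a g 0 dX; pose t g := a g 0 dZ / a g 0 dY.
have quot g (i j : 'I_3) : j = i.+1 :> nat -> `|a g 0 j / a g 0 i| <= 2.
  move=> ji; have [_ _ _ _ /(_ i j)] := mka g; rewrite ji leqnSn subSnn expr1 => /(_ isT).
  have [->|ai0] := eqVneq (a g 0 i) 0; first by rewrite invr0 mulr0 normr0.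
  by move=> ?; rewrite normrM normfV ler_pdivrMr ?normr_gt0.
have [r0 rr0] : exists l : C, r @ U --> l.
  by apply: (@ultra_bounded_cvg R _ U r 2 UU); apply: filterE => g; apply: quot.
have [t0 tt0] : exists l : C, t @ U --> l.
  by apply: (@ultra_bounded_cvg R _ U t 2 UU); apply: filterE => g; apply: quot.
have PU : ProperFilter U by apply: ultra_proper.
exists ka, mu, r0, t0; split.
- by apply: (@det_norm1_cvg _ _ U _ k) => // g; have [_ _ []] := mka g.
- by apply: (@det_norm1_cvg _ _ U _ m) => // g; have [_ _ []] := mka g.
have H1 : (fun g => act (k g) w) @ U --> act ka w.
  exact: (act_cvg _ Kka (cvg_cst w)).
have H2 : (fun g => act (m g) (act g w)) @ U --> act mu w0.
  exact: (act_cvg _ Mmu cw).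
refine (weight_relations_cvg PU H1 H2 rr0 tt0 _).
apply: filterS Uu => g /= gu; have [E _ [dm dk] _ _] := mka g.
have a0 i : a g 0 i != 0.
  have : \det (diag_mx (a g)) != 0.
    apply: contraTneq gu => d0; rewrite unitmxE unitfE negbK.
    have /eqP := congr1 determinant E; rewrite !det_mulmx d0 mulr0 mulf_eq0.
    by case/orP=> // /eqP m0; move: dm; rewrite m0 normr0 => /eqP; rewrite eq_sym oner_eq0.
  by rewrite det_diag => /prodf_neq0; apply.
rewrite actM E -actM.
have -> : diag_mx (a g) = diag3 (a g 0 dX) (a g 0 dX * r g) (a g 0 dX * r g * t g).
  congr diag_mx; apply/rowP => i; rewrite mxE; move: i; apply: forall3 => //=.
    by rewrite /r mulrC divfK.
  exact: successive_quotients.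
exact: weight_relations_diag.
Qed.

Theorem degenerations w w0 : radial w -> radial w0 -> foliation_form w0 ->
  no_invariant_line w -> simple_singularities w -> degenerates w w0 ->
  (exists2 g, g \in unitmx & w0 = act g w) \/
  exists2 g, g \in unitmx & [/\ principal (act g w0), act g w0 dX YYY != 0 &
    (act g w0 dZ XXY = 0 /\ act g w0 dY XXZ = 0 /\ act g w0 dZ XXX != 0) \/
    nonresonant (act g w0)].
Proof.
move=> rw rw0 fw0 nil ss /degenerates_weight_relations[k [m [r [t [ku mu rel]]]]].
have [[c c0 [r0 t0 E]]|] := limit_cases (radial_act k rw) (radial_act m rw0)
  (foliation_form_act mu fw0) (nil k ku) (ss k ku) rel; last first.
  by right; exists m.
left; have [s su sE] := scale_act c0.
pose D : 'M[C]_3 := diag3 1 r (r * t).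
have Du : D \in unitmx by apply: diag3_unit; rewrite ?oner_eq0 ?mulf_neq0.
exists (k *m D *m s *m invmx m); first by rewrite !unitmx_mul unitmx_inv ku Du su mu.
by rewrite -[LHS](actK mu) E -sE -!actM.
Qed.

End LimitData.

(** * Degenerations to the normal forms *)

Section TorusLimits.
Variable C : numClosedFieldType.
Implicit Types (w v : 'M[C]_(3, 10)) (g : 'M[C]_3).

Lemma degenerates_curve w (D : C -> 'M[C]_3) (M : C -> 'M[C]_(3, 10)) :
  (forall s, s != 0 -> D s \in unitmx /\ act (D s) w = M s) ->
  (forall i k, polyfun (fun x : unit -> C => M (x tt) i k)) -> degenerates w (M 0).
Proof.
move=> DM pM e e0.
have /cvg_ballP/(_ e e0)/nbhs_ballP[d /= d0 dM] : M @ (0 : C) --> M 0.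
  have FF : Filter (nbhs (0 : C)) by exact: nbhs_filter.
  apply/(cvg_mxP FF) => i k.
  by apply: (polyfun_cvg FF (c := fun s (_ : unit) => s) (l := fun=> 0) (pM i k)) => _; exact: cvg_id.
have d2 : 0 < d / 2 by rewrite divr_gt0.
have [Du E] := DM (d / 2) (lt0r_neq0 d2).
exists (D (d / 2)) => //; rewrite E; apply: dM.
by rewrite /ball /= sub0r normrN gtr0_norm // gtr_pMr // invf_lt1 // ltr1n.
Qed.

Lemma act_diag_form15 a b c (x : 'I_15 -> C) : act (diag3 a b c) (form15 x) =
  form15 (fun l => [:: a ^+ 3 * b; a ^+ 3 * c; a ^+ 2 * b ^+ 2; a ^+ 2 * c ^+ 2;
    a * b ^+ 3; a * c ^+ 3; b ^+ 3 * c; b ^+ 2 * c ^+ 2; b * c ^+ 3;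
    a ^+ 2 * b * c; a ^+ 2 * b * c; a * b ^+ 2 * c; a * b ^+ 2 * c;
    a * b * c ^+ 2; a * b * c ^+ 2]`_l * x l).
Proof.
apply/matrixP => i k; rewrite act_diag /mono !mxE.
by move: i k; apply: forall3; apply: forall10; rewrite /= ?inordK //=; ring.
Qed.

(** The part of a form carried by the coordinates whose indices are in s. *)
Definition keep (s : seq nat) (x : 'I_15 -> C) (l : 'I_15) : C :=
  if nat_of_ord l \in s then x l else 0.

(** Under diag(s^-3, s, s^5) the kept coordinates have weight 0 and the others,
except those assumed zero, have positive weight. *)
Lemma degenerates_diagonal x : x (inord 0) = 0 -> x (inord 1) = 0 -> x (inord 2) = 0 ->
  degenerates (form15 x) (form15 (keep [:: 4; 9; 10]%N x)).
Proof.
move=> x0 x1 x2.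
pose e : seq nat := [:: 0; 0; 0; 4; 0; 12; 8; 12; 16; 0; 0; 4; 4; 8; 8]%N.
pose kill : seq C := [:: 0; 0; 0; 1; 1; 1; 1; 1; 1; 1; 1; 1; 1; 1; 1].
pose M (s : C) := form15 (fun l => kill`_l * s ^+ (nth 0%N e l) * x l).
have -> : form15 (keep [:: 4; 9; 10]%N x) = M 0.
  congr form15; apply/funext => -[l hl]; rewrite /keep /=.
  by do 15?[case: l hl => [|l] hl; first by rewrite /= ?expr0 ?expr0n /= ?(mul0r, mulr0, mulr1, mul1r)].
apply: (@degenerates_curve _ (fun s => diag3 (s ^- 3) s (s ^+ 5))).
  move=> s s0; split.
    by apply: diag3_unit; rewrite ?invr_eq0 ?expf_neq0.
  rewrite act_diag_form15; congr form15; apply/funext => -[l hl].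
  have E k (hk : (k < 15)%N) : x (inord k) = x (Ordinal hk).
    by congr x; apply: val_inj; rewrite /= inordK.
  rewrite (E 0%N isT) in x0; rewrite (E 1%N isT) in x1; rewrite (E 2%N isT) in x2.
  do 15?[case: l hl => [|l] hl; first by rewrite /= (bool_irrelevance hl isT) ?x0 ?x1 ?x2; field].
  by [].
move=> i k; apply: polyfun_form15 => l; apply: polyfun_mul; last exact: polyfun_cst.
by apply: polyfun_mul; [exact: polyfun_cst | apply: polyfun_exp; exact: polyfun_var].
Qed.

(** Under diag(s^-3, s, s^9) the kept coordinates have weight 0 and the others,
except those assumed zero, have positive weight. *)
Lemma degenerates_inflection x : x (inord 0) = 0 -> x (inord 2) = 0 ->
  degenerates (form15 x) (form15 (keep [:: 1; 4]%N x)).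
Proof.
move=> x0 x2.
pose e : seq nat := [:: 0; 0; 0; 12; 0; 24; 12; 20; 28; 4; 4; 8; 8; 16; 16]%N.
pose kill : seq C := [:: 0; 1; 0; 1; 1; 1; 1; 1; 1; 1; 1; 1; 1; 1; 1].
pose M (s : C) := form15 (fun l => kill`_l * s ^+ (nth 0%N e l) * x l).
have -> : form15 (keep [:: 1; 4]%N x) = M 0.
  congr form15; apply/funext => -[l hl]; rewrite /keep /=.
  by do 15?[case: l hl => [|l] hl; first by rewrite /= ?expr0 ?expr0n /= ?(mul0r, mulr0, mulr1, mul1r)].
apply: (@degenerates_curve _ (fun s => diag3 (s ^- 3) s (s ^+ 9))).
  move=> s s0; split.
    by apply: diag3_unit; rewrite ?invr_eq0 ?expf_neq0.
  rewrite act_diag_form15; congr form15; apply/funext => -[l hl].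
  have E k (hk : (k < 15)%N) : x (inord k) = x (Ordinal hk).
    by congr x; apply: val_inj; rewrite /= inordK.
  rewrite (E 0%N isT) in x0; rewrite (E 2%N isT) in x2.
  do 15?[case: l hl => [|l] hl; first by rewrite /= (bool_irrelevance hl isT) ?x0 ?x2; field].
  by [].
move=> i k; apply: polyfun_form15 => l; apply: polyfun_mul; last exact: polyfun_cst.
by apply: polyfun_mul; [exact: polyfun_cst | apply: polyfun_exp; exact: polyfun_var].
Qed.

Lemma form15_G (a c b : C) x : a != 0 -> x (inord 4) = a -> x (inord 9) = c -> x (inord 10) = b ->
  act (diag3 a^-1 1 1) (form15 (keep [:: 4; 9; 10]%N x)) = G_form (c / a ^+ 2) (- b / a ^+ 2).
Proof.
move=> a0 xa xc xb; apply/matrixP => i k; rewrite act_diag /mono !mxE /keep.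
by move: i k; apply: forall3; apply: forall10; rewrite /= ?inordK //= ?xa ?xc ?xb; field.
Qed.

Lemma form15_F1 (a c : C) x : a != 0 -> c != 0 -> x (inord 4) = a -> x (inord 1) = c ->
  act (diag3 (- a^-1) 1 (- a ^+ 3 / c)) (form15 (keep [:: 1; 4]%N x)) = F1_form.
Proof.
move=> a0 c0 xa xc; apply/matrixP => i k; rewrite act_diag /mono !mxE /keep.
by move: i k; apply: forall3; apply: forall10; rewrite /= ?inordK //= ?xa ?xc; field;
  rewrite ?a0 ?c0.
Qed.

Definition principal_form (a1 a2 a3 a6 c1 b2 : C) : 'M[C]_(3, 10) :=
  form15 (fun l => [:: a1; a2; a3; 0; a6; 0; 0; 0; 0; c1; b2; 0; 0; 0; 0]`_l).

Lemma ev_principal_form a1 a2 a3 a6 c1 b2 (v : 'cV[C]_3) :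
  ev (principal_form a1 a2 a3 a6 c1 b2) v = \row_i
  [:: a1 * (v dX 0 ^+ 2 * v dY 0) + a2 * (v dX 0 ^+ 2 * v dZ 0) + a3 * (v dX 0 * v dY 0 ^+ 2)
        + a6 * v dY 0 ^+ 3 - (c1 + b2) * (v dX 0 * v dY 0 * v dZ 0);
      - a1 * v dX 0 ^+ 3 - a3 * (v dX 0 ^+ 2 * v dY 0) - a6 * (v dX 0 * v dY 0 ^+ 2)
        + b2 * (v dX 0 ^+ 2 * v dZ 0);
      - a2 * v dX 0 ^+ 3 + c1 * (v dX 0 ^+ 2 * v dY 0)]`_i.
Proof.
apply/rowP => i; rewrite !mxE /cub !mxE.
by move: i; apply: forall3; rewrite /= ?inordK //=; ring.
Qed.

(** The unipotent transformations x, y + p x, z + q x + k y preserve this shape. *)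
Lemma act_lower3_principal a1 a2 a3 a6 c1 b2 p q k :
  act (lower3 p q k) (principal_form a1 a2 a3 a6 c1 b2) =
  principal_form (a1 + a3 * p + a6 * p ^+ 2 - b2 * q + k * (a2 - c1 * p)) (a2 - c1 * p)
    (a3 + 2 * a6 * p - (b2 + c1) * k) a6 c1 b2.
Proof.
apply: ev_inj => v; rewrite ev_act !ev_principal_form; apply/rowP => i; rewrite mxE sum3E !mxE !sum3E !mxE.
by move: i; apply: forall3; rewrite /=; ring.
Qed.

Lemma principal_formE v : radial v -> principal v ->
  v = principal_form (v dX XXY) (v dX XXZ) (v dX XYY) (v dX YYY) (v dZ XXY) (v dY XXZ).
Proof.
move=> rv [[z1 z2 z3 z4 z5] [z6 z7 z8 z9]]; rewrite -[LHS](radial_coord rv); congr form15.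
apply/funext => -[l hl]; rewrite /coord15.
by do 15?[case: l hl => [|l] hl; first by rewrite /= ?(z1, z2, z3, z4, z5, z6, z7, z8, z9)].
Qed.

Lemma principal_form_keep4 a1 a6 c1 b2 : a1 = 0 ->
  exists2 x : 'I_15 -> C, principal_form a1 0 0 a6 c1 b2 = form15 (keep [:: 4; 9; 10]%N x) &
  [/\ x (inord 4) = a6, x (inord 9) = c1 & x (inord 10) = b2].
Proof.
move=> ->; exists (fun l => [:: 0; 0; 0; 0; a6; 0; 0; 0; 0; c1; b2; 0; 0; 0; 0]`_l); last by rewrite !inordK.
congr form15; apply/funext => -[l hl]; rewrite /keep /=.
by do 15?[case: l hl => [|l] hl; first by []].
Qed.

Lemma principal_form_keep2 a2 a6 : 
  exists2 x : 'I_15 -> C, principal_form 0 a2 0 a6 0 0 = form15 (keep [:: 1; 4]%N x) &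
  x (inord 4) = a6 /\ x (inord 1) = a2.
Proof.
exists (fun l => [:: 0; a2; 0; 0; a6; 0; 0; 0; 0; 0; 0; 0; 0; 0; 0]`_l); last by rewrite !inordK.
congr form15; apply/funext => -[l hl]; rewrite /keep /=.
by do 15?[case: l hl => [|l] hl; first by []].
Qed.

(** Completing the cube removes the coefficient a3, adding a multiple of y to z
removes a1, and a diagonal matrix normalises the two remaining coefficients. *)
Lemma principal_F1 v : radial v -> principal v -> v dX YYY != 0 ->
  v dZ XXY = 0 -> v dY XXZ = 0 -> v dZ XXX != 0 ->
  exists2 g, g \in unitmx & act g v = F1_form.
Proof.
move=> rv pv a6 c1 b2 c0; have [_ [[[_ E _ _] _] _]] := radial_entries rv.
rewrite E oppr_eq0 in c0; rewrite (principal_formE rv pv) c1 b2.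
move: (v dX XXY) (v dX XXZ) (v dX XYY) (v dX YYY) a6 c0 => x1 x2 x3 x6 a6 c0.
set p := - x3 / (2 * x6).
have [x xE [x4 x1E]] := principal_form_keep2 x2 x6.
exists (lower3 p 0 (- (x1 + x3 * p + x6 * p ^+ 2) / x2) *m diag3 (- x6^-1) 1 (- x6 ^+ 3 / x2)).
  rewrite unitmx_mul lower3_unit; apply: diag3_unit; rewrite ?oner_eq0 //.
    by rewrite oppr_eq0 invr_eq0.
  by rewrite mulf_neq0 ?invr_eq0 // oppr_eq0 expf_neq0.
have E1 : act (lower3 p 0 (- (x1 + x3 * p + x6 * p ^+ 2) / x2)) (principal_form x1 x2 x3 x6 0 0) =
    principal_form 0 x2 0 x6 0 0.
  rewrite act_lower3_principal; congr (principal_form _ _ _ _ _ _).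
  - by field.
  - by rewrite mul0r subr0.
  - by rewrite addr0 mul0r subr0 /p; field; rewrite a6.
by rewrite -actM E1 xE; exact: form15_F1.
Qed.

Lemma keep_G w (x : 'I_15 -> C) : x (inord 4) != 0 -> nonresonant (form15 (keep [:: 4; 9; 10]%N x)) ->
  w = form15 (keep [:: 4; 9; 10]%N x) ->
  exists2 g, g \in unitmx & exists al, exists2 be,
    [/\ al != 0, be != 0 & al != be] & act g w = G_form al be /\
    al * w dY XXZ = - be * w dZ XXY.
Proof.
move=> x4 [n1 [n2 n3]] ->.
have E : [/\ form15 (keep [:: 4; 9; 10]%N x) dZ XXY = x (inord 9) &
              form15 (keep [:: 4; 9; 10]%N x) dY XXZ = x (inord 10)].
  by rewrite !mxE /= /keep !inordK.
case: E n1 n2 n3 => -> -> n1 n2 n3.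
exists (diag3 (x (inord 4))^-1 1 1).
  by apply: diag3_unit; rewrite ?oner_eq0 ?invr_eq0.
exists (x (inord 9) / x (inord 4) ^+ 2), (- x (inord 10) / x (inord 4) ^+ 2); last first.
  by split; [exact: form15_G | field].
split; rewrite ?mulf_neq0 ?oppr_eq0 ?invr_eq0 ?expf_neq0 //.
rewrite (inj_eq (mulIf _)) ?invr_eq0 ?expf_neq0 //.
by rewrite -subr_eq0 opprK.
Qed.

(** Since the eigenvalues are nonzero and distinct, a unipotent transformation
removes a2, then a3, then a1. *)
Lemma principal_G v : radial v -> principal v -> v dX YYY != 0 -> nonresonant v ->
  exists2 g, g \in unitmx & exists al, exists2 be,
    [/\ al != 0, be != 0 & al != be] & act g v = G_form al be.
Proof.
move=> rv pv a6 [n1 [n2 n3]].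
move: (principal_formE rv pv); move: (v dX XXY) (v dX XXZ) (v dX XYY) (v dX YYY) (v dZ XXY) (v dY XXZ) a6 n1 n2 n3.
move=> x1 x2 x3 x6 c b a6 n1 n2 n3 vE.
set p := x2 / c; set k := (x3 + 2 * x6 * p) / (b + c); set q := (x1 + x3 * p + x6 * p ^+ 2) / b.
have cb : b + c != 0 by rewrite addrC.
have [x xE [y4 y9 y10]] := @principal_form_keep4 0 x6 c b erefl.
have xE' : act (lower3 p q k) v = form15 (keep [:: 4; 9; 10]%N x).
  rewrite vE act_lower3_principal -xE; congr (principal_form _ _ _ _ _ _); rewrite /q /k /p; field;
  by rewrite ?n1 ?n2 ?cb.
have nr : nonresonant (form15 (keep [:: 4; 9; 10]%N x)).
  by rewrite /nonresonant !mxE /= /keep !inordK //= y9 y10.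
have [g gu [al [be ab [E _]]]] : _ := keep_G (w := act (lower3 p q k) v) (eq_ind_r (fun t => t != 0) a6 y4) nr xE'.
exists (lower3 p q k *m g); first by rewrite unitmx_mul lower3_unit.
by exists al, be => //; rewrite -actM.
Qed.

(** A one-parameter group contracts the frame; the limit keeps the two eigenvalues
and the coefficient of y^3 dx, which is nonzero when z = 0 is not invariant. *)
Lemma degenerates_G w : radial w -> flag_singular w -> nonresonant w -> w dX YYY != 0 ->
  exists al, exists2 be, [/\ al != 0, be != 0 & al != be] &
    degenerates w (G_form al be) /\ al * w dY XXZ = - be * w dZ XXY.
Proof.
move=> rw [b0 [c0 b1]] nr a6; have [_ [[[E1 E2 E3 _] _] _]] := radial_entries rw.
have x0 : coord15 w (inord 0) = 0 by rewrite /coord15 inordK //= -[LHS]opprK -E1 b0 oppr0.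
have x1 : coord15 w (inord 1) = 0 by rewrite /coord15 inordK //= -[LHS]opprK -E2 c0 oppr0.
have x2 : coord15 w (inord 2) = 0 by rewrite /coord15 inordK //= -[LHS]opprK -E3 b1 oppr0.
have := degenerates_diagonal x0 x1 x2; rewrite (radial_coord rw) => deg.
have y4 : coord15 w (inord 4) != 0 by rewrite /coord15 inordK.
have EE : [/\ form15 (keep [:: 4; 9; 10]%N (coord15 w)) dZ XXY = w dZ XXY &
              form15 (keep [:: 4; 9; 10]%N (coord15 w)) dY XXZ = w dY XXZ].
  by rewrite !mxE /= /keep /coord15 !inordK.
case: EE => EE1 EE2.
have nr' : nonresonant (form15 (keep [:: 4; 9; 10]%N (coord15 w))) by rewrite /nonresonant EE1 EE2.
have [g gu [al [be ab [E E']]]] := keep_G y4 nr' erefl.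
exists al, be => //; split; first by rewrite -E; exact: degenerates_act.
by rewrite -EE1 -EE2.
Qed.

(** In the coordinates adapted to the nonsingular point (1, 1, q), at which the line
tangent to the foliation has an inflectional contact, a one-parameter group contracts
the form to its part kept in F1. *)
Lemma degenerates_G_F1 al be : al != 0 -> be != 0 -> al != be ->
  @degenerates C (G_form al be) F1_form.
Proof.
move=> al0 be0; rewrite -subr_eq0 => ab.
set k := 2 / (al - be); set q := (k * al - 1) / be.
have GE : G_form al be = principal_form 0 0 0 1 al (- be).
  apply: ev_inj => v; rewrite ev_G ev_principal_form; apply/rowP => i; rewrite !mxE.
  by move: i; apply: forall3; rewrite /=; ring.
have aE : act (lower3 1 q k) (G_form al be) = principal_form 0 (- al) 0 1 al (- be).
  rewrite GE act_lower3_principal /q /k; congr (principal_form _ _ _ _ _ _); field; by rewrite ?be0 ?ab.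
set x : 'I_15 -> C := fun l => [:: 0; - al; 0; 0; 1; 0; 0; 0; 0; al; - be; 0; 0; 0; 0]`_l.
have x0 : x (inord 0) = 0 by rewrite /x inordK.
have x2 : x (inord 2) = 0 by rewrite /x inordK.
have d1 : degenerates (act (lower3 1 q k) (G_form al be)) (form15 (keep [:: 1; 4]%N x)).
  by rewrite aE; exact: degenerates_inflection.
have x4 : x (inord 4) = 1 by rewrite /x inordK.
have x1 : x (inord 1) = - al by rewrite /x inordK.
have al0' : - al != 0 by rewrite oppr_eq0.
have o0 : (1 : C) != 0 by exact: oner_neq0.
rewrite -(form15_F1 o0 al0' x4 x1).
apply: degenerates_act.
  by apply: diag3_unit; rewrite ?invr1 ?expr1n ?oppr_eq0 ?oner_eq0 // mulf_neq0 ?oppr_eq0 ?oner_eq0 ?invr_eq0.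
apply: degenerates_trans d1; apply: degenerates_act; first exact: lower3_unit.
exact: degenerates_refl.
Qed.

End TorusLimits.

(** * Derivatives of polynomial maps *)

Section Derivatives.
Variable C : numClosedFieldType.

(** The chain rule for a polynomial in functions of a vector variable. *)
Lemma is_derive_meval (V : normedModType C) n (p : mpoly n C) (x v : V)
    (f : 'I_n -> V -> C) (df : 'I_n -> C) :
  (forall i, is_derive x v (f i) (df i)) ->
  is_derive x v (fun y => meval (fun i => f i y) p)
    (\sum_(i < n) meval (fun i => f i x) (mderiv i p) * df i).
Proof.
move=> dF; elim/mpoly_ringind: p => [c|j|p q IHp IHq|p q IHp IHq].
- rewrite (_ : (fun _ => _) = cst c); last by apply/funext => y; rewrite mevalC.
  rewrite big1 => [|i _]; last by rewrite mderivC meval0 mul0r.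
  exact: is_derive_cst.
- rewrite (_ : (fun _ => _) = f j); last by apply/funext => y; rewrite mevalXU.
  have mdE i : mderiv i (mpolyX C (mnm1 j)) = mpolyC n (i == j)%:R.
    rewrite mderivX mnm1E eq_sym -mul_mpolyC; case: eqP => [->|_]; last by rewrite mpolyC0 mul0r.
    rewrite (_ : mnm_sub (mnm1 j) (mnm1 j) = mnm0) ?mpolyX0 ?mulr1 //.
    by apply/mnmP => k; rewrite mnmBE mnm0E subnn.
  rewrite (bigD1 j) //= mdE eqxx mevalC mul1r big1 ?addr0 // => i /negPf ij.
  by rewrite mdE ij mevalC mul0r.
- rewrite (_ : (fun _ => _) = (fun y => meval (f^~ y) p) + (fun y => meval (f^~ y) q)); last first.
    by apply/funext => y; rewrite mevalD.
  apply: is_derive_eq (is_deriveD IHp IHq) _.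
  by rewrite -big_split /=; apply: eq_bigr => i _; rewrite mderivD mevalD mulrDl.
rewrite (_ : (fun _ => _) = (fun y => meval (f^~ y) p) * (fun y => meval (f^~ y) q)); last first.
  by apply/funext => y; rewrite mevalM.
apply: is_derive_eq (is_deriveM IHp IHq) _.
rewrite /GRing.scale /= !mulr_sumr -big_split /=; apply: eq_bigr => i _.
rewrite mderivM mevalD !mevalM; ring.
Qed.

Lemma differentiable_meval (V : normedModType C) n (p : mpoly n C) (x : V) (f : 'I_n -> V -> C) :
  (forall i, differentiable (f i) x) ->
  differentiable (fun y => meval (fun i => f i y) p) x.
Proof.
move=> dF; elim/mpoly_ringind: p => [c|j|p q IHp IHq|p q IHp IHq].
- rewrite (_ : (fun _ => _) = cst c); last by apply/funext => y; rewrite mevalC.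
  exact: differentiable_cst.
- by rewrite (_ : (fun _ => _) = f j); last by apply/funext => y; rewrite mevalXU.
- rewrite (_ : (fun _ => _) = (fun y => meval (f^~ y) p) + (fun y => meval (f^~ y) q)); last first.
    by apply/funext => y; rewrite mevalD.
  exact: differentiableD.
rewrite (_ : (fun _ => _) = (fun y => meval (f^~ y) p) * (fun y => meval (f^~ y) q)); last first.
  by apply/funext => y; rewrite mevalM.
exact: differentiableM.
Qed.

Lemma is_derive_coord m n (x v : 'M[C]_(m, n)) i j :
  is_derive x v (fun y : 'M[C]_(m, n) => y i j) (v i j).
Proof.
have d := @differentiable_coord C m n x i j.
apply: DeriveDef; first exact: diff_derivable.
rewrite /derive; apply: cvg_lim => //.
apply: (@cvg_trans _ ((fun=> v i j) @ (0 : C)^')); last exact: cvg_cst.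
apply: near_eq_cvg; near=> h; rewrite /= !mxE addrK.
rewrite [RHS]mulrA mulVf ?mul1r //; near: h; exact: nbhs_dnbhs_neq.
Unshelve. all: by end_near.
Qed.

Lemma differentiable_mx (V : normedModType C) m n (f : V -> 'M[C]_(m, n)) (x : V) :
  (forall i j, differentiable (fun y => f y i j) x) -> differentiable f x.
Proof.
move=> df.
rewrite (_ : f = \sum_(i < m) \sum_(j < n) (fun y => f y i j *: delta_mx i j)).
  apply: differentiable_sum => i; apply: differentiable_sum => j.
  exact: differentiableZl.
apply/funext => y; rewrite [LHS]matrix_sum_delta fct_sumE; apply: eq_bigr => i _.
by rewrite fct_sumE.
Qed.

Lemma diff_entry (V : normedModType C) m n (f : V -> 'M[C]_(m, n)) (x v : V) i j :
  differentiable f x -> is_derive x v (fun y => f y i j) (('d f x : V -> _) v i j).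
Proof.
move=> df; have dv : derivable f x v by exact: diff_derivable.
rewrite -deriveE //.
have FF : Filter (0 : C)^' by exact: dnbhs_filter.
have /(cvg_mxP FF)/(_ i j) E : (fun h : C => h^-1 *: ((f \o shift x) (h *: v) - f x)) @ (0 : C)^' --> 'D_v f x.
  exact: dv.
have E' : (fun h : C => h^-1 *: (((fun y => f y i j) \o shift x) (h *: v) - f x i j)) @ (0 : C)^' --> ('D_v f x) i j.
  by apply: cvg_trans E; apply: near_eq_cvg; near=> h; rewrite /= !mxE.
by apply: DeriveDef; [apply: cvgP E' | apply: cvg_lim].
Unshelve. all: by end_near.
Qed.

(** The rows are the partial derivatives of the entries of a polynomial family of
forms, and the form itself; the family is immersed in the projective space where they
are independent. *)
Definition jac d (P : 'I_3 -> 'I_10 -> mpoly d C) (u : 'I_d -> C) : 'M[C]_(d + 1, 3 * 10) :=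
  col_mx (\matrix_(j, k) mxvec (\matrix_(a, b) meval u (mderiv j (P a b))) 0 k)
         (mxvec (\matrix_(a, b) meval u (P a b))).

Lemma minor_kernel m n (A : 'M[C]_(m, n)) (f : 'I_m -> 'I_n) (x : 'rV[C]_m) :
  \det (colsub f A) != 0 -> x *m A = 0 -> x = 0.
Proof.
move=> dA xA; have u : colsub f A \in unitmx by rewrite unitmxE unitfE.
rewrite -[x](mulmxK u) (_ : x *m colsub f A = 0) ?mul0mx //.
apply/rowP => j; have /rowP/(_ (f j)) := xA; rewrite !mxE => {2}<-.
by apply: eq_bigr => i _; rewrite !mxE.
Qed.

(** Independent rows have an invertible square submatrix. *)
Lemma minor_exists m n (A : 'M[C]_(m, n)) :
  (forall x : 'rV[C]_m, x *m A = 0 -> x = 0) -> exists f : 'I_m -> 'I_n, \det (colsub f A) != 0.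
Proof.
move=> kA; have fA : row_full A^T.
  rewrite -[row_full _]/(\rank A^T == m) mxrank_tr; apply/inj_row_free => v; exact: kA.
exists (fullrankfun fA); rewrite -det_tr -unitfE -unitmxE -row_full_unit.
suff -> : (colsub (fullrankfun fA) A)^T = rowsub (fullrankfun fA) A^T by exact: fullrowsub_full.
by apply/matrixP => i j; rewrite !mxE.
Qed.

Lemma jac_kernel d (P : 'I_3 -> 'I_10 -> mpoly d C) u (v : 'rV[C]_d) (t : C) :
  row_mx v (- t%:M) *m jac P u = 0 <->
  forall a b, \sum_i v 0 i * meval u (mderiv i (P a b)) = t * meval u (P a b).
Proof.
rewrite mul_row_col mulNmx mul_scalar_mx; split=> [/eqP|E].
  rewrite subr_eq0 => /eqP E a b.
  have /rowP/(_ (mxvec_index a b)) := E; rewrite !mxE mxvecE mxE => <-.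
  by apply: eq_bigr => i _; rewrite !mxE mxvecE mxE.
apply/eqP; rewrite subr_eq0; apply/eqP/rowP => k; case/mxvec_indexP: k => a b.
rewrite !mxE mxvecE mxE -E; apply: eq_bigr => i _; by rewrite !mxE mxvecE mxE.
Qed.

Lemma mx_diff_meval d (P : 'I_3 -> 'I_10 -> mpoly d C) (u v : 'rV[C]_d) :
  let phi (u : 'rV[C]_d) := \matrix_(a, b) meval (u 0) (P a b) in
  differentiable phi u /\ forall a b, ('d phi u : 'rV[C]_d -> _) v a b = \sum_i v 0 i * meval (u 0) (mderiv i (P a b)).
Proof.
move=> phi.
have E a b : (fun y => phi y a b) = fun y : 'rV[C]_d => meval (fun i => y 0 i) (P a b).
  by apply/funext => y; rewrite mxE.
have df : differentiable phi u.
  apply: differentiable_mx => a b; rewrite E.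
  by apply: differentiable_meval => i; exact: differentiable_coord.
split=> // a b.
have D1 := diff_entry v a b df; rewrite E in D1.
have D2 := is_derive_meval (P a b) (fun i => is_derive_coord u v 0 i).
have [_ <-] := D1; have [_ ->] := D2.
by apply: eq_bigr => i _; rewrite mulrC.
Qed.

End Derivatives.

(** * Manifolds contained in an orbit *)

Section OrbitManifolds.
Variable C : numClosedFieldType.
Implicit Types (w : 'M[C]_(3, 10)) (g N : 'M[C]_3).

Lemma act1_derivP a N N' w :
  act1_deriv (a *: N + N') w = a *: act1_deriv N w + act1_deriv N' w.
Proof.
apply: ev_inj => v; rewrite evD evZ !ev_act1_deriv.
have devZ u : dev w v (a *: u) = a *: dev w v u.
  by apply/rowP => i; rewrite !mxE /dcub; ring.
by rewrite mulmxDl -scalemxAl devD devZ mulmxDr -scalemxAr scalerDr addrACA.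
Qed.

Lemma act1_deriv_sum d (v : 'rV[C]_d) (N : 'I_d -> 'M[C]_3) w :
  act1_deriv (\sum_j v 0 j *: N j) w = \sum_j v 0 j *: act1_deriv (N j) w.
Proof.
have D0 : act1_deriv 0 w = 0.
  have := act1_derivP 1 0 0 w; rewrite !scale1r addr0 => /eqP.
  by rewrite -subr_eq0 opprD addrA subrr sub0r oppr_eq0 => /eqP.
elim/big_rec2: _ => [|j A B _ <-]; first exact: D0.
by rewrite act1_derivP.
Qed.

Lemma polyfun_act1_deriv I N (W : (I -> C) -> 'M[C]_(3, 10)) :
  (forall i k, polyfun (fun x => W x i k)) ->
  forall i k, polyfun (fun x => act1_deriv N (W x) i k).
Proof.
move=> pW i k; apply: (polyfun_eq (f := fun x => cubcoef (fun a b c => (dev (W x) (vec3 a b c) (N *m vec3 a b c)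
    + ev (W x) (vec3 a b c) *m N) 0 i) k)); last by move=> x; rewrite mxE.
apply: polyfun_cubcoef => a b c.
apply: (polyfun_eq (f := fun x => dev (W x) (vec3 a b c) (N *m vec3 a b c) 0 i + (ev (W x) (vec3 a b c) *m N) 0 i)); last by move=> x; rewrite [RHS]mxE.
apply: polyfun_add.
  move: (N *m _) => u; apply: (polyfun_eq (f := fun x => dcub (W x i) (vec3 a b c dX 0) (vec3 a b c dY 0) (vec3 a b c dZ 0) (u dX 0) (u dY 0) (u dZ 0))); last by move=> x; rewrite [RHS]mxE.
  by rewrite /dcub; repeat first [apply: pW | apply: polyfun_cst | apply: polyfun_add | apply: polyfun_mul | apply: polyfun_exp].
apply: polyfun_mulmx => a' b'; last exact: polyfun_cst.
apply: (polyfun_eq (f := fun x => cub (W x b') (vec3 a b c dX 0) (vec3 a b c dY 0) (vec3 a b c dZ 0))); last by move=> x; rewrite [RHS]mxE.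
by apply: polyfun_cub => *; try exact: polyfun_cst; apply: pW.
Qed.

Lemma polyfun_cvg_entries (m n : nat) (f : 'M[C]_(m, n) -> C) (x : 'M[C]_(m, n)) :
  polyfun (fun e : 'I_m * 'I_n -> C => f (\matrix_(i, j) e (i, j))) -> f @ x --> f x.
Proof.
move=> pf; have FF : Filter (nbhs x) by exact: nbhs_filter.
have := polyfun_cvg FF (c := fun y p => y p.1 p.2) (l := fun p => x p.1 p.2) pf
  (fun p => @coord_continuous C m n p.1 p.2 x).
have mK (y : 'M[C]_(m, n)) : \matrix_(i, j) y (i, j).1 (i, j).2 = y by apply/matrixP => i j; rewrite mxE.
by rewrite mK; under eq_fun do rewrite mK.
Qed.

Lemma poly_first_order (r : {poly C}) (c0 c1 c2 c3 c4 : C) :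
  (forall t, r.[t] = c0 + t * c1 + t ^+ 2 * c2 + t ^+ 3 * c3 + t ^+ 4 * c4) -> r^`().[0] = c1.
Proof.
move=> E; have -> : r = c0%:P + 'X * c1%:P + 'X ^+ 2 * c2%:P + 'X ^+ 3 * c3%:P + 'X ^+ 4 * c4%:P.
  apply/eqP; rewrite -subr_eq0; apply/negPn/negP => /poly_nonroot[t].
  by rewrite hornerD hornerN E !hornerE subrr eqxx.
by rewrite !poly.derivE !hornerE /= !expr0n /= !(mul0r, mulr0, addr0, mul1r, add0r).
Qed.

(** The map u |-> (1 + sum u_j N_j) . w' is an immersion modulo scalars at u = 0
for w' = w0, hence also for w' in the orbit of w close to w0. *)
Lemma orbit_immersion d (N : 'I_d -> 'M[C]_3) w w0 : w0 != 0 ->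
  (forall (v : 'rV[C]_d) (t : C), act1_deriv (\sum_j v 0 j *: N j) w0 = t *: w0 -> v = 0) ->
  degenerates w w0 ->
  exists (U : set 'rV[C]_d) (phi : 'rV[C]_d -> 'M[C]_(3, 10)),
    [/\ open U, U !=set0 & forall u, U u ->
      [/\ exists2 g, g \in unitmx & phi u = act g w, differentiable phi u &
          forall (v : 'rV[C]_d) (t : C), 'd phi u v = t *: phi u -> v = 0]].
Proof.
move=> w00 inj deg.
pose A w' : 'M[C]_(d + 1, 3 * 10) :=
  col_mx (\matrix_(j, k) mxvec (act1_deriv (N j) w') 0 k) (mxvec w').
have kA (x : 'rV[C]_(d + 1)) : x *m A w0 = 0 -> x = 0.
  rewrite -(@hsubmxK _ 1 d 1 x); set v := lsubmx x; set y := rsubmx x.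
  rewrite (mx11_scalar y).
  rewrite mul_row_col mul_scalar_mx => E.
  have EE : \sum_j v 0 j *: act1_deriv (N j) w0 + y 0 0 *: w0 = 0.
    apply: (can_inj mxvecK); rewrite linear0 -E linearD linearZ linear_sum /=; congr (_ + _).
    rewrite mulmx_sum_row; apply: eq_bigr => j _; rewrite linearZ /=; congr (_ *: _).
    by apply/rowP => k; rewrite !mxE.
  have v0 : v = 0.
    apply: (inj _ (- y 0 0)); rewrite act1_deriv_sum scaleNr; apply/eqP.
    by rewrite -addr_eq0 EE.
  move: EE; rewrite v0 big1 ?add0r => [/eqP|j _]; last by rewrite mxE scale0r.
  rewrite scaler_eq0 (negPf w00) orbF => /eqP ->.
  by rewrite -scalemx1 scale0r row_mx0.
have [f fA] := minor_exists kA.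
have pA : polyfun (fun e : 'I_3 * 'I_10 -> C => \det (colsub f (A (\matrix_(i, j) e (i, j))))).
  apply: polyfun_det => a b.
  have pe i k : polyfun (fun e : 'I_3 * 'I_10 -> C => (\matrix_(i, j) e (i, j)) i k).
    by apply: (polyfun_eq (polyfun_var C (i, k))) => e; rewrite mxE.
  have [i [k fb]] : exists i k, f b = mxvec_index i k by case/mxvec_indexP: (f b) => i k; exists i, k.
  case: (splitP a) => [j|j] ea.
    have -> : a = lshift 1 j by apply: val_inj.
    apply: (polyfun_eq (polyfun_act1_deriv (N j) pe i k)) => e.
    by rewrite [RHS]mxE [RHS]col_mxEu [RHS]mxE fb mxvecE.
  have -> : a = rshift d j by apply: val_inj.
  apply: (polyfun_eq (pe i k)) => e.
  by rewrite [RHS]mxE [RHS]col_mxEd ord1 fb mxvecE.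
have cA := polyfun_cvg_entries (f := fun w' => \det (colsub f (A w'))) (x := w0) pA.
have : nbhs w0 [set w' | \det (colsub f (A w')) != 0] by exact: (cvgr_neq0 _ cA fA).
move=> /nbhs_ballP[e /= e0 eA].
have [g gu ge] := deg e e0; have {ge}fA' := eA _ ge; move: fA'; set w' := act g w => fA'.
pose M (u : 'I_d -> C) := 1%:M + \sum_j u j *: N j.
have pM i j : polyfun (fun u => M u i j).
  apply: (polyfun_eq (f := fun u => 1%:M i j + \sum_l u l * N l i j)).
    apply: polyfun_add; first exact: polyfun_cst.
    by apply: polyfun_sum => l; apply: polyfun_mul; [exact: polyfun_var | exact: polyfun_cst].
  by move=> u; rewrite [RHS]mxE summxE; congr (_ + _); apply: eq_bigr => l _; rewrite mxE.
have : forall p : 'I_3 * 'I_10, exists q : mpoly d C, forall u, act (M u) w' p.1 p.2 = meval u q.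
  move=> [i k]; apply: polyfunP; apply: polyfun_act => [|a b]; first exact: pM.
  exact: polyfun_cst.
move=> /choice[P' P'E]; pose P i k := P' (i, k).
have PE u i k : act (M u) w' i k = meval u (P i k) by have := P'E (i, k) u.
(* The Jacobian matrix of the family at u = 0. *)
have J0 : jac P (fun=> 0) = A w'.
  congr col_mx; last first.
    congr mxvec; apply/matrixP => i k; rewrite mxE -PE /M big1 ?addr0 ?act1 // => j _.
    by rewrite scale0r.
  apply/matrixP => j k; rewrite !mxE; congr (mxvec _ 0 k).
  apply/matrixP => i l; rewrite mxE.
  have [r rE] := meval_curve (fun i => (i == j)%:R *: 'X : {poly C}) (P i l).
  have [E2 [E3 [E4 E]]] := act_taylor (N j) w'.
  have <- : r^`().[0] = act1_deriv (N j) w' i l.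
    apply: (@poly_first_order _ (w' i l) _ (E2 i l) (E3 i l) (E4 i l)) => t.
    have [<- _] := rE t; rewrite -PE.
    rewrite (_ : M _ = 1%:M + t *: N j); first by rewrite E !mxE.
    congr (_ + _); rewrite (bigD1 j) //= eqxx scale1r hornerX big1 ?addr0 // => i' /negPf ij.
    by rewrite ij scale0r horner0 scale0r.
  have [_ ->] := rE 0; rewrite (bigD1 j) //= big1 ?addr0 => [|i' /negPf ij]; last first.
    by rewrite ij scale0r deriv0 horner0 mulr0.
  rewrite eqxx scale1r derivX hornerE mulr1; congr meval; apply/funext => i'.
  by rewrite hornerZ hornerX mulr0.
pose m (u : 'rV[C]_d) := \det (colsub f (jac P (u 0))) * \det (M (u 0)).
have pm : polyfun (fun e : 'I_1 * 'I_d -> C => m (\matrix_(i, j) e (i, j))).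
  have pev (q : mpoly d C) : polyfun (fun e : 'I_1 * 'I_d -> C => meval ((\matrix_(i, j) e (i, j) : 'rV[C]_d) 0) q).
    apply: (polyfun_comp (polyfun_meval q)) => i.
    by apply: (polyfun_eq (polyfun_var C (0, i))) => e'; rewrite mxE.
  apply: polyfun_mul; apply: polyfun_det => a b; last first.
    apply: (polyfun_comp (pM a b)) => i.
    by apply: (polyfun_eq (polyfun_var C (0, i))) => e'; rewrite mxE.
  have [i [k fb]] : exists i k, f b = mxvec_index i k by case/mxvec_indexP: (f b) => i k; exists i, k.
  case: (splitP a) => [j|j] ea.
    have -> : a = lshift 1 j by apply: val_inj.
    apply: (polyfun_eq (pev (mderiv j (P i k)))) => e'.
    by rewrite [RHS]mxE [RHS]col_mxEu [RHS]mxE fb mxvecE [RHS]mxE.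
  have -> : a = rshift d j by apply: val_inj.
  apply: (polyfun_eq (pev (P i k))) => e'.
  by rewrite [RHS]mxE [RHS]col_mxEd ord1 fb mxvecE [RHS]mxE.
pose phi (u : 'rV[C]_d) : 'M[C]_(3, 10) := \matrix_(a, b) meval (u 0) (P a b).
exists [set u | m u != 0], phi; split.
- rewrite openE => u mu; exact: (cvgr_neq0 _ (polyfun_cvg_entries (f := m) (x := u) pm) mu).
- exists 0; rewrite /= /m (_ : (0 : 'rV[C]_d) 0 = fun=> 0); last by apply/funext => j; rewrite mxE.
  rewrite J0 /M big1 ?addr0 ?det1 ?mulr1 // => j _; by rewrite scale0r.
move=> u /=; rewrite /m mulf_eq0 negb_or => /andP[mu Mu].
have [du dE] := mx_diff_meval P u (0 : 'rV[C]_d); split=> //.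
  exists (g *m M (u 0)); first by rewrite unitmx_mul gu unitmxE unitfE.
  by rewrite -actM; apply/matrixP => i k; rewrite mxE PE.
move=> v t E; have [_ {}dE] := mx_diff_meval P u v.
have /(minor_kernel mu)/eqP : row_mx v (- t%:M) *m jac P (u 0) = 0.
  by apply/jac_kernel => a b; rewrite -dE E mxE; congr (_ * _); rewrite mxE.
by rewrite row_mx_eq0 => /andP[/eqP].
Qed.

End OrbitManifolds.

(** * Dimension of images of polynomial maps *)

Section SomewhereDense.
Variables (T : topologicalType) (K : eqType) (A : K -> set T).

(** A nonempty open set covered by finitely many sets contains an open set in which one
of them is dense. *)
Lemma somewhere_dense (s : seq K) (U : set T) : open U -> U !=set0 ->
  (forall u, U u -> exists2 k, k \in s & A k u) ->
  exists2 k, k \in s & exists V, [/\ open V, V !=set0, V `<=` U &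
    forall W, open W -> W `<=` V -> W !=set0 -> exists2 u, W u & A k u].
Proof.
elim: s U => [|k s IHs] U oU U0 UA; first by case: U0 => u /UA[].
have [[W [oW WU W0 WA]]|dense] := pselect (exists W, [/\ open W, W `<=` U, W !=set0 & forall u, W u -> ~ A k u]).
  have [|k' k's [V [oV V0 VW VA]]] := IHs W oW W0.
    move=> u Wu; have [k' + Ak'] := UA u (WU u Wu); rewrite inE => /orP[/eqP kk'|k's].
      by case: (WA u Wu); rewrite -kk'.
    by exists k'.
  exists k'; first by rewrite inE k's orbT.
  by exists V; split=> //; exact: subset_trans WU.
exists k; first by rewrite inE eqxx.
exists U; split=> // W oW WU W0; apply: contrapT => nW; apply: dense.
by exists W; split=> // u Wu Aku; apply: nW; exists u.
Qed.

Lemma dense_zero (C : numClosedFieldType) k (V : set T) (g : T -> C) : open V ->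
  (forall W, open W -> W `<=` V -> W !=set0 -> exists2 u, W u & A k u) ->
  (forall u, V u -> {for u, continuous g}) -> (forall u, V u -> A k u -> g u = 0) ->
  forall u, V u -> g u = 0.
Proof.
move=> oV VA cg g0 u Vu; apply/eqP/negPn/negP => gu.
have nW : nbhs u (V `&` [set t | g t != 0]).
  by apply: filterI; [exact: open_nbhs_nbhs | exact: (cvgr_neq0 _ (cg u Vu) gu)].
have [|||t /interior_subset[Vt gt] At] := VA (V `&` [set t | g t != 0])°.
- exact: open_interior.
- by move=> t /interior_subset[].
- by exists u.
by move: gt; rewrite /= (g0 t Vt At) eqxx.
Qed.

End SomewhereDense.

Section UpperBound.
Variable C : numClosedFieldType.
Implicit Types (w : 'M[C]_(3, 10)) (g N : 'M[C]_3).

(** On some open set one choice of e + 1 independent entries and one polynomial map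
account for a dense set of points. If d were at most e, these entries would satisfy an
algebraic relation there, hence everywhere on the open set by continuity. The ideal of
relations that hold on the cone is stable under derivation, because the derivatives of
a relation along the manifold and along the cone vanish and the Jacobian matrix is
invertible; so it is zero. *)
Lemma immersed_dim_lt d e (K : finType) (S : K -> set 'M[C]_(3, 10))
    (F : K -> 'I_3 -> 'I_10 -> mpoly d C) (U : set 'rV[C]_e) (phi : 'rV[C]_e -> 'M[C]_(3, 10)) :
  (forall k w c, c != 0 -> S k w -> S k (c *: w)) ->
  (forall k w, S k w -> exists x, forall i j, w i j = meval x (F k i j)) ->
  open U -> U !=set0 ->
  (forall u, U u -> [/\ exists k, S k (phi u), phi u != 0, differentiable phi u &
     forall (v : 'rV[C]_e) (t : C), 'd phi u v = t *: phi u -> v = 0]) ->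
  (e < d)%N.
Proof.
move=> coneS SF oU U0 UE; rewrite ltnNge; apply/negP => de.
pose J (u : 'rV[C]_e) : 'M[C]_(e + 1, 3 * 10) :=
  col_mx (\matrix_(j, k) mxvec ('d phi u (delta_mx 0 j)) 0 k) (mxvec (phi u)).
have kJ u : U u -> exists f : {ffun 'I_(e + 1) -> 'I_(3 * 10)}, \det (colsub f (J u)) != 0.
  move=> /UE[_ phi0 dphi imm].
  suff /minor_exists[f fJ] : forall x : 'rV[C]_(e + 1), x *m J u = 0 -> x = 0.
    exists [ffun i => f i]; rewrite (_ : colsub _ _ = colsub f (J u)) //.
    by apply/matrixP => i j; rewrite !mxE ffunE.
  move=> x; rewrite -(@hsubmxK _ 1 e 1 x); set v := lsubmx x; set y := rsubmx x.
  rewrite (mx11_scalar y) mul_row_col mul_scalar_mx => E.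
  have EE : 'd phi u v + y 0 0 *: phi u = 0.
    apply: (can_inj mxvecK); rewrite linear0 -E linearD linearZ /=; congr (_ + _).
    rewrite {1}[v]row_sum_delta linear_sum [LHS]linear_sum mulmx_sum_row; apply: eq_bigr => j _.
    rewrite !linearZ /=; congr (_ *: _); by apply/rowP => k; rewrite !mxE.
  have v0 : v = 0.
    by apply: (imm _ (- y 0 0)); rewrite scaleNr; apply/eqP; rewrite -addr_eq0 EE.
  move: EE; rewrite v0 linear0 add0r => /eqP.
  rewrite scaler_eq0 (negPf phi0) orbF => /eqP ->.
  by rewrite -scalemx1 scale0r row_mx0.
pose A (kf : K * {ffun 'I_(e + 1) -> 'I_(3 * 10)}) : set 'rV[C]_e :=
  [set u | [/\ U u, S kf.1 (phi u) & \det (colsub kf.2 (J u)) != 0]].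
have [|[k f] _ [V [oV V0 VU VA]]] := somewhere_dense (A := A) (s := enum predT) oU U0.
  move=> u Uu; have [[k Sk] _ _ _] := UE u Uu; have [f fJ] := kJ u Uu.
  by exists (k, f) => //; rewrite mem_enum.
have : forall i, exists p : 'I_3 * 'I_10, f i = mxvec_index p.1 p.2.
  by move=> i; case/mxvec_indexP: (f i) => a b; exists (a, b).
move=> /choice[h hE]; pose psi i u := phi u (h i).1 (h i).2.
have [P P0 PE] := @algebraic_dependence C d (e + 1) (fun i => F k (h i).1 (h i).2) ltac:(by rewrite addn1 ltnS).
pose I y := exists2 u, V u & exists2 c : C, c != 0 & y = fun i => c * psi i u.
have dpsi u i : V u -> differentiable (psi i) u.
  move=> /VU/UE[_ _ du _].
  exact: (differentiable_comp du (differentiable_coord _ _ _)).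
have cont c p u : V u -> {for u, continuous (fun t => meval (fun i => c * psi i t) p)}.
  move=> Vu; apply: differentiable_continuous; apply: differentiable_meval => i.
  by apply: differentiableZ; exact: dpsi.
move/eqP: P0; apply.
apply: (@derivation_stable_vanish C _ I).
- by case: V0 => u Vu; exists (fun i => 1 * psi i u), u => //; exists 1; rewrite ?oner_eq0.
- move=> p pI i _ [u Vu [c c0 ->]]; move: u Vu.
  apply: (dense_zero (A := A) (k := (k, f)) oV VA) => [u Vu|u Vu [Uu Sk fJ]].
    exact: cont.
  pose x := \row_j meval (fun i => c * psi i u) (mderiv j p).
  suff x0 : x = 0 by have /rowP/(_ i) := x0; rewrite !mxE.
  have [_ phi0 dphi _] := UE u Uu.
  suff E : x *m (colsub f (J u))^T = 0.
    have uT : (colsub f (J u))^T \in unitmx by rewrite unitmx_tr unitmxE unitfE.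
    by rewrite -[x](mulmxK uT) E mul0mx.
  apply/rowP => a; rewrite !mxE.
  case: (splitP a) => [j|j] ea.
    have -> : a = lshift 1 j by apply: val_inj.
    have D := is_derive_meval p (fun i => is_deriveZ c (diff_entry (delta_mx 0 j) (h i).1 (h i).2 dphi)).
    have D0 : is_derive u (delta_mx 0 j : 'rV[C]_e) (fun t => meval (fun i => (c \*: psi i) t) p) 0.
      apply: near_eq_is_derive (is_derive_cst (0 : C) u (delta_mx 0 j)).
      near=> t; rewrite (pI (fun i => (c \*: psi i) t)) //; exists t; last by exists c.
      by near: t; exact: open_nbhs_nbhs.
    have [_ E1] := D; have [_ E2] := D0; move: E1; rewrite E2 => /esym/eqP E.
    apply/eqP; rewrite -(mulrI_eq0 _ (mulfI c0)) mulr_sumr; move: E; congr (_ == _); apply: eq_bigr => l _.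
    rewrite [X in _ = c * (X * _)]mxE; do 2!rewrite [X in _ = c * (_ * X)]mxE.
    rewrite [X in _ = c * (_ * X)]col_mxEu [X in _ = c * (_ * X)]mxE hE mxvecE.
    by rewrite /GRing.scale /= mulrCA.
  have -> : a = rshift e j by apply: val_inj.
  have [r rE] := meval_curve (fun i => psi i u *: 'X : {poly C}) p.
  have q0 t : (fun i => (psi i u *: 'X : {poly C}).[t]) = fun i => t * psi i u.
    by apply/funext => l; rewrite hornerZ hornerX mulrC.
  have r0 : r = 0.
    apply/eqP/negPn/negP => r0.
    have /poly_nonroot[t] : 'X * r != 0 by rewrite mulf_neq0 // polyX_eq0.
    rewrite hornerM hornerX mulf_eq0 negb_or => /andP[t0]; have [<- _] := rE t.
    by rewrite q0 pI ?eqxx //; exists u => //; exists t.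
  have [_] := rE c; rewrite r0 deriv0 horner0 q0 => /esym E; rewrite -[RHS]E.
  apply: eq_bigr => l _; rewrite [X in X * _ = _]mxE; congr (_ * _).
  by rewrite [LHS]mxE [LHS]mxE [LHS]col_mxEd ord1 hE mxvecE derivZ derivX hornerZ hornerE mulr1.
move=> _ [u Vu [c c0 ->]]; move: u Vu.
apply: (dense_zero (A := A) (k := (k, f)) oV VA) => [u Vu|u Vu [Uu Sk fJ]]; first exact: cont.
have [x xE] := SF k _ (coneS k _ c c0 Sk).
rewrite -[RHS](PE x); congr meval; apply/funext => i.
by rewrite -xE mxE.
Unshelve. all: by end_near.
Qed.

End UpperBound.

(** * Parametrization of the orbits of the normal forms *)

Section OrbitPieces.
Variable C : numClosedFieldType.
Implicit Types (w : 'M[C]_(3, 10)) (g N : 'M[C]_3).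

(** The entries of g in D are the variables, the others are given by M0. *)
Lemma orbit_param d (D : {set 'I_3 * 'I_3}) (M0 : 'M[C]_3) w0 : (#|D| <= d)%N ->
  exists F : 'I_3 -> 'I_10 -> mpoly d C, forall g,
    (forall a b, (a, b) \notin D -> g a b = M0 a b) ->
    exists x, forall i k, act g w0 i k = meval x (F i k).
Proof.
move=> cD.
pose v (x : 'I_d -> C) (a b : 'I_3) :=
  if insub (index (a, b) (enum D)) is Some i then x i else 0.
pose G (x : 'I_d -> C) : 'M[C]_3 := \matrix_(a, b) if (a, b) \in D then v x a b else M0 a b.
have pG a b : polyfun (fun x => G x a b).
  apply: (polyfun_eq (f := fun x => if (a, b) \in D then v x a b else M0 a b)); last by move=> x; rewrite mxE.
  case: ((a, b) \in D); last exact: polyfun_cst.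
  by rewrite /v; case: (insub _ : option 'I_d) => [i|]; [exact: polyfun_var | exact: polyfun_cst].
have : forall p : 'I_3 * 'I_10, exists q : mpoly d C, forall x, act (G x) w0 p.1 p.2 = meval x q.
  move=> [i k]; apply: polyfunP; apply: polyfun_act => [|a b]; first exact: pG.
  exact: polyfun_cst.
move=> /choice[F FE]; exists (fun i k => F (i, k)) => g gD.
exists (fun i => let p := nth (dX, dX) (enum D) i in g p.1 p.2).
move=> i k; rewrite -(FE (i, k)) /=; congr (act _ w0 i k); apply/matrixP => a b; rewrite mxE.
case: ifP => [abD|/negbT]; last exact: gD.
rewrite /v; case: insubP => [l _ ->|]; first by rewrite nth_index ?mem_enum.
by rewrite (leq_trans _ cD) // cardE index_mem mem_enum.
Qed.

Lemma act_cone c g w : c != 0 -> exists2 s, s != 0 & c *: act g w = act (s *: g) w.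
Proof.
move=> c0; pose s := 4.-root c; have s4 : s ^+ 4 = c by rewrite rootCK.
exists s; first by apply: contra_neq c0 => s0; rewrite -s4 s0 expr0n.
by rewrite -s4 -act_scalar actM mul_mx_scalar.
Qed.

Lemma unit_row g i : g \in unitmx -> exists j, g i j != 0.
Proof.
move=> gu; apply: contrapT => n; have g0 : row i g = 0.
  apply/rowP => j; rewrite !mxE; apply/eqP/negPn/negP => gj; apply: n; by exists j.
have /rowP/(_ i) : row i (1%:M : 'M[C]_3) = 0 by rewrite -(mulmxV gu) row_mul g0 mul0mx.
by rewrite !mxE eqxx => /eqP; rewrite oner_eq0.
Qed.

Lemma diag3_mul (a b c : C) g i j : (diag3 a b c *m g) i j = [:: a; b; c]`_i * g i j.
Proof.
rewrite /diag3 mxE sum3E !mxE.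
by move: i; apply: forall3; rewrite /= ?(mulr1n, mulr0n) ?(mul0r, addr0, add0r).
Qed.

(** The piece of the orbit on which the entry of g to be normalised is nonzero. *)
Definition G_piece (al be : C) (j : 'I_3) : set 'M[C]_(3, 10) :=
  [set w | exists2 g, g \in unitmx & w = act g (G_form al be) /\ g dY j != 0].

Lemma G_stab (al be t : C) : t != 0 -> act (diag3 (t ^- 3) t (t ^+ 5)) (G_form al be) = G_form al be.
Proof.
move=> t0; apply/matrixP => i k; rewrite act_diag /mono !mxE.
by move: i k; apply: forall3; apply: forall10; rewrite /=; field.
Qed.

Lemma F1_stab (t : C) : t != 0 -> act (diag3 (t ^- 3) t (t ^+ 9)) F1_form = F1_form :> 'M[C]_(3, 10).
Proof.
move=> t0; apply/matrixP => i k; rewrite act_diag /mono !mxE.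
by move: i k; apply: forall3; apply: forall10; rewrite /=; field.
Qed.

Lemma F1_stab_lower (s : C) : act (lower3 0 s 0) F1_form = F1_form :> 'M[C]_(3, 10).
Proof.
apply: ev_inj => v; rewrite ev_act !ev_F1; apply/rowP => i; rewrite mxE sum3E !mxE !sum3E !mxE.
by move: i; apply: forall3; rewrite /=; ring.
Qed.

Lemma G_piece_cone al be j w c : c != 0 -> G_piece al be j w -> G_piece al be j (c *: w).
Proof.
move=> c0 [g gu [-> gj]]; have [s s0 ->] := act_cone g (G_form al be) c0.
exists (s *: g); first by rewrite unitmxZ ?unitfE.
by rewrite mxE mulf_neq0.
Qed.

(** The stabiliser contains a torus of dimension one, which normalises a nonzero
entry of g to 1. *)
Lemma G_piece_param al be : exists F : 'I_3 -> 'I_3 -> 'I_10 -> mpoly 8 C, forall j w,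
  G_piece al be j w -> exists x, forall i k, w i k = meval x (F j i k).
Proof.
have : forall j : 'I_3, exists F : 'I_3 -> 'I_10 -> mpoly 8 C, forall w,
    G_piece al be j w -> exists x, forall i k, w i k = meval x (F i k).
  move=> j; pose D := ~: [set (dY, j)].
  have cD : (#|D| <= 8)%N.
    by have := cardsC [set (dY, j)]; rewrite cards1 card_prod !card_ord -/D; lia.
  have [F FE] := orbit_param (const_mx 1) (G_form al be) cD.
  exists F => w [g gu [-> gj]].
  pose t := (g dY j)^-1; have t0 : t != 0 by rewrite invr_eq0.
  have <- : act (diag3 (t ^- 3) t (t ^+ 5) *m g) (G_form al be) = act g (G_form al be).
    by rewrite -actM G_stab.
  apply: FE => a b; rewrite finset.in_setC finset.in_set1 negbK => /eqP[-> ->].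
  by rewrite diag3_mul mxE mulVf.
by move=> /choice[F FE]; exists F.
Qed.

Definition F1_piece (jj : 'I_3 * 'I_3) : set 'M[C]_(3, 10) :=
  [set w | exists2 g, g \in unitmx & [/\ w = act g F1_form, g dX jj.1 != 0 & g dY jj.2 != 0]].

Lemma F1_piece_cone jj w c : c != 0 -> F1_piece jj w -> F1_piece jj (c *: w).
Proof.
move=> c0 [g gu [-> g1 g2]]; have [s s0 ->] := act_cone g F1_form c0.
exists (s *: g); first by rewrite unitmxZ ?unitfE.
by rewrite ![(s *: g) _ _]mxE !mulf_neq0.
Qed.

(** Besides a torus, the stabiliser contains the transformations z + s x, which
annihilate one more entry of g. *)
Lemma F1_piece_param : exists F : 'I_3 * 'I_3 -> 'I_3 -> 'I_10 -> mpoly 7 C, forall jj w,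
  F1_piece jj w -> exists x, forall i k, w i k = meval x (F jj i k).
Proof.
have : forall jj : 'I_3 * 'I_3, exists F : 'I_3 -> 'I_10 -> mpoly 7 C, forall w,
    F1_piece jj w -> exists x, forall i k, w i k = meval x (F i k).
  move=> [j j']; pose D := ~: [set (dZ, j); (dY, j')].
  have cD : (#|D| <= 7)%N.
    have := cardsC [set (dZ, j); (dY, j')]; rewrite cards2 card_prod !card_ord -/D.
    by rewrite xpair_eqE /=; lia.
  have [F FE] := orbit_param (\matrix_(a, b) (a == dY)%:R) F1_form cD.
  exists F => w [g gu [-> /= g1 g2]].
  pose t := (g dY j')^-1; have t0 : t != 0 by rewrite invr_eq0.
  pose s := - g dZ j / g dX j.
  have <- : act (diag3 (t ^- 3) t (t ^+ 9) *m (lower3 0 s 0 *m g)) F1_form = act g F1_form.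
    by rewrite -actM F1_stab // -actM F1_stab_lower.
  apply: FE => a b; rewrite finset.in_setC finset.in_set2 negbK => /orP[] /eqP[-> ->];
    rewrite diag3_mul mxE sum3E !mxE /=.
    by rewrite /s; field.
  by rewrite mul0r mul1r mul0r add0r addr0 mulVf.
by move=> /choice[F FE]; exists F.
Qed.

End OrbitPieces.

(** * Infinitesimal transformations and equivalence of the normal forms *)

Section NormalFormOrbits.
Variable C : numClosedFieldType.
Implicit Types (w : 'M[C]_(3, 10)) (g N : 'M[C]_3).

(** These matrices span a complement of the infinitesimal stabiliser of the class of
G(al, be); without the last one, which generates the transformations z + s x, they span
a complement of that of F1. *)
Definition direction (j : nat) : 'M[C]_3 :=
  nth 0 [:: delta_mx dX dY; delta_mx dX dZ; delta_mx dY dX; delta_mx dY dY; delta_mx dY dZ;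
            delta_mx dZ dY; delta_mx dZ dX] j.

Definition gl_sum (v : nat -> C) : 'M[C]_3 := \matrix_(i, j) (nth [::] [::
  [:: 0; v 0%N; v 1%N]; [:: v 2%N; v 3%N; v 4%N]; [:: v 6%N; v 5%N; 0]] i)`_j.

Lemma sum_direction7 (v : 'rV[C]_7) :
  \sum_(j < 7) v 0 j *: direction j = gl_sum (fun k => v 0 (inord k)).
Proof.
have E k (hk : (k < 7)%N) : v 0 (inord k) = v 0 (Ordinal hk).
  by congr (v 0 _); apply: val_inj; rewrite /= inordK.
apply/matrixP => a b; rewrite summxE !big_ord_recl big_ord0 /= !mxE !E.
by move: a b; apply: forall3; apply: forall3; rewrite /= ?(mulr1n, mulr0n) ?(mulr1, mulr0, addr0, add0r); first [by [] | by congr (v 0 _); apply: val_inj].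
Qed.

Lemma sum_direction6 (v : 'rV[C]_6) :
  \sum_(j < 6) v 0 j *: direction j = gl_sum (fun k => if (k < 6)%N then v 0 (inord k) else 0).
Proof.
have E k (hk : (k < 6)%N) : v 0 (inord k) = v 0 (Ordinal hk).
  by congr (v 0 _); apply: val_inj; rewrite /= inordK.
apply/matrixP => a b; rewrite summxE !big_ord_recl big_ord0 /= !mxE /= !E.
by move: a b; apply: forall3; apply: forall3; rewrite /= ?(mulr1n, mulr0n) ?(mulr1, mulr0, addr0, add0r); first [by [] | by congr (v 0 _); apply: val_inj].
Qed.

Lemma act1_deriv_G al be v : act1_deriv (gl_sum v) (G_form al be) = \matrix_(i, k) (nth [::] [::
  [:: 0; be * v 6%N; - al * v 2%N; 2 * v 2%N - (al - be) * v 5%N; (be - al) * v 3%N;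
      (be - al) * v 4%N; 3 * v 3%N; (be - al) * v 0%N + 3 * v 4%N; (be - al) * v 1%N; 0];
  [:: - be * v 6%N; (al - be) * v 5%N - 2 * v 2%N; - be * v 3%N; - (3 * v 3%N);
      - (al + be) * v 0%N - 2 * v 4%N; - (2 * be * v 1%N); 0; - v 1%N; 0; 0];
  [:: al * v 2%N; al * v 3%N; (al - be) * v 4%N; 2 * al * v 0%N - v 4%N; (al + be) * v 1%N; 0;
      v 1%N; 0; 0; 0]] i)`_k.
Proof.
apply: ev_inj => u; rewrite ev_act1_deriv ev_G; apply/rowP => i.
rewrite [LHS]mxE [X in X + _]mxE [X in _ + X]mxE sum3E [RHS]mxE /dcub /cub !mxE !sum3E !mxE.
by move: i; apply: forall3; rewrite /=; ring.
Qed.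

Lemma act1_deriv_F1 v : v 6%N = 0 -> act1_deriv (gl_sum v) F1_form = \matrix_(i, k) (nth [::] [::
  [:: 0; v 5%N; 0; - (2 * v 2%N); 2 * v 0%N; 2 * v 1%N; - (3 * v 3%N); - (3 * v 4%N); 0; 0];
  [:: - v 5%N; 2 * v 2%N; v 0%N; 3 * v 3%N; 2 * v 4%N; 0; 0; v 1%N; 0; 0];
  [:: 0; - (3 * v 0%N); - (2 * v 1%N); v 4%N; 0; 0; - v 1%N; 0; 0; 0]] i)`_k.
Proof.
move=> v6; apply: ev_inj => u; rewrite ev_act1_deriv ev_F1; apply/rowP => i.
rewrite [LHS]mxE [X in X + _]mxE [X in _ + X]mxE sum3E [RHS]mxE /dcub /cub !mxE !sum3E !mxE /= v6.
by move: i; apply: forall3; rewrite /=; ring.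
Qed.

Lemma G_directions al be (v : 'rV[C]_7) t : al != 0 -> be != 0 -> al != be ->
  act1_deriv (\sum_(j < 7) v 0 j *: direction j) (G_form al be) = t *: G_form al be -> v = 0.
Proof.
move=> al0 be0 ab; have ba : be - al != 0 by rewrite subr_eq0 eq_sym.
rewrite sum_direction7; set u := fun k : nat => _; rewrite act1_deriv_G => /matrixP E.
have three : (3 : C) != 0 by rewrite pnatr_eq0.
have E1 := E dX YYY; have E2 := E dZ XXY; have E3 := E dX XZZ; have E4 := E dX YYZ.
have E5 := E dX YZZ; have E6 := E dX XXZ; have E7 := E dX XXY; have E8 := E dX XYY.
move: E1 E2 E3 E4 E5 E6 E7 E8; rewrite !mxE /= ?mulr0 mulr1 [t * al]mulrC.
move=> E1 /(mulfI al0) E2 /eqP E3 E4 /eqP E5 /eqP E6 /eqP E7 E8.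
have u3 : u 3%N = 0.
  apply/eqP; have : 2 * u 3%N = 0 by rewrite -[RHS](subrr t) -{1}E1 -E2; ring.
  by move/eqP; rewrite mulf_eq0 pnatr_eq0.
have u4 : u 4%N = 0 by move: E3; rewrite mulf_eq0 (negPf ba) => /eqP.
have u1 : u 1%N = 0 by move: E5; rewrite mulf_eq0 (negPf ba) => /eqP.
have u2 : u 2%N = 0 by move: E6; rewrite mulf_eq0 oppr_eq0 (negPf al0) => /eqP.
have u6 : u 6%N = 0 by move: E7; rewrite mulf_eq0 (negPf be0) => /eqP.
have u0 : u 0%N = 0.
  by move: E4 => /eqP; rewrite u4 mulr0 addr0 mulf_eq0 (negPf ba) => /eqP.
have u5 : u 5%N = 0.
  move: E8 => /eqP; rewrite u2 mulr0 sub0r oppr_eq0 mulf_eq0 subr_eq0 (negPf ab).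
  by move/eqP.
apply/rowP => -[l hl]; rewrite [RHS]mxE; have -> : Ordinal hl = inord l by apply: val_inj; rewrite /= inordK.
rewrite -[LHS]/(u l); clear E; by do 7?[case: l hl => [|l] hl; first by []].
Qed.

Lemma F1_directions (v : 'rV[C]_6) t :
  act1_deriv (\sum_(j < 6) v 0 j *: direction j) F1_form = t *: F1_form -> v = 0.
Proof.
rewrite sum_direction6; set u := fun k : nat => _; rewrite act1_deriv_F1 // => /matrixP E.
have three : (3 : C) != 0 by rewrite pnatr_eq0.
have E0 := E dX XXZ; have E1 := E dX YYY; have E2 := E dX XXY; have E3 := E dX XYY; have E4 := E dX XYZ.
have E5 := E dX XZZ; have E6 := E dX YYZ.
move: E0 E1 E2 E3 E4 E5 E6; rewrite !mxE /= ?mulr0 mulr1 => <-; rewrite mul0r.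
move=> /eqP E1 E2 /eqP E3 /eqP E4 /eqP E5 /eqP E6.
have u3 : u 3%N = 0 by move: E1; rewrite oppr_eq0 mulf_eq0 (negPf three) => /eqP.
have u4 : u 4%N = 0 by move: E6; rewrite oppr_eq0 mulf_eq0 (negPf three) => /eqP.
have u2 : u 2%N = 0 by move: E3; rewrite oppr_eq0 mulf_eq0 pnatr_eq0 => /eqP.
have u0 : u 0%N = 0 by move: E4; rewrite mulf_eq0 pnatr_eq0 => /eqP.
have u1 : u 1%N = 0 by move: E5; rewrite mulf_eq0 pnatr_eq0 => /eqP.
apply/rowP => -[l hl]; rewrite [RHS]mxE; have -> : Ordinal hl = inord l by apply: val_inj; rewrite /= inordK.
have -> : v 0 (inord l) = u l by rewrite /u hl.
clear E; by do 6?[case: l hl => [|l] hl; first by []].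
Qed.

Lemma dev_G al be (v u : 'cV[C]_3) : dev (G_form al be) v u = \row_i
  [:: (be - al) * (u dX 0 * v dY 0 * v dZ 0 + v dX 0 * u dY 0 * v dZ 0 + v dX 0 * v dY 0 * u dZ 0)
        + 3 * (v dY 0 ^+ 2 * u dY 0);
      - be * (2 * (v dX 0 * u dX 0 * v dZ 0) + v dX 0 ^+ 2 * u dZ 0)
        - (u dX 0 * v dY 0 ^+ 2 + 2 * (v dX 0 * v dY 0 * u dY 0));
      al * (2 * (v dX 0 * u dX 0 * v dY 0) + v dX 0 ^+ 2 * u dY 0)]`_i.
Proof.
apply/rowP => i; rewrite !mxE /dcub !mxE.
by move: i; apply: forall3; rewrite /=; ring.
Qed.

(** The singular points of G are (1, 0, 0), where the quotient of the eigenvalues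
is be / al, and (0, 0, 1), where the linear part vanishes. *)
Lemma G_conjugate g al be al' be' : al != 0 -> be != 0 -> al != be -> al' != 0 ->
  g \in unitmx -> act g (G_form al be) = G_form al' be' -> al * be' = al' * be.
Proof.
move=> al0 be0 ab al'0 gu E.
have singular (v : 'cV[C]_3) : ev (G_form al be) (g *m v) *m g = 0 ->
    ev (G_form al be) (g *m v) = 0.
  by move=> e; rewrite -[LHS](mulmxK gu) e mul0mx.
have sing1 : ev (G_form al be) (g *m vec3 1 0 0) = 0.
  apply: singular; rewrite -ev_act E ev_G; apply/rowP => i; rewrite !mxE /=.
  by move: i; apply: forall3; rewrite /=; ring.
have sing3 : ev (G_form al be) (g *m vec3 0 0 1) = 0.
  apply: singular; rewrite -ev_act E ev_G; apply/rowP => i; rewrite !mxE /=.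
  by move: i; apply: forall3; rewrite /=; ring.
have g1 a : (g *m vec3 1 0 0) a 0 = g a dX by rewrite mxE sum3E !mxE /= !(mulr1, mulr0, addr0).
have g3 a : (g *m vec3 0 0 1) a 0 = g a dZ by rewrite mxE sum3E !mxE /= !(mulr1, mulr0, add0r).
have g2 a : (g *m vec3 0 1 0) a 0 = g a dY by rewrite mxE sum3E !mxE /= !(mulr1, mulr0, add0r, addr0).
move: sing1 sing3; rewrite !ev_G => /rowP sing1 /rowP sing3.
have := sing1 dX; have := sing1 dY; have := sing1 dZ; have := sing3 dX; have := sing3 dZ.
clear sing1 sing3; rewrite ![(\row_i _) _ _]mxE ![(0 : 'rV_3) _ _]mxE /= !g1 !g3 => s3Z s3X s1Z s1Y s1X.
have jetY i : G_form al' be' i XXY = (dev (G_form al be) (g *m vec3 1 0 0) (g *m vec3 0 1 0) *m g) 0 i.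
  by rewrite -dev_act -XXY_dev E.
have jetZ i : G_form al' be' i XXZ = (dev (G_form al be) (g *m vec3 1 0 0) (g *m vec3 0 0 1) *m g) 0 i.
  by rewrite -dev_act -XXZ_dev E.
have alE := jetY dZ; have b1E := jetY dY; have beE := jetZ dY; have c2E := jetZ dZ.
move: alE b1E beE c2E; clear jetY jetZ E singular; rewrite !dev_G ![(_ *m g) 0 _]mxE !sum3E ![(\row_i _) _ _]mxE /=.
rewrite ![G_form al' be' _ _]mxE /= !g1 !g2 !g3; clear g1 g2 g3 gu.
move: (g dX dX) (g dX dY) (g dX dZ) (g dY dX) (g dY dY) (g dY dZ) (g dZ dX) (g dZ dY) (g dZ dZ) s3Z s3X s1Z s1Y s1X.
move=> g00 g01 g02 g10 g11 g12 g20 g21 g22 s3Z s3X s1Z s1Y s1X alE b1E beE c2E.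
(* Otherwise (1, 0, 0) would be sent to (0, 0, 1), where the linear part is zero. *)
have g00' : g00 != 0.
  apply: contra_neq al'0 => g00E; rewrite alE; move: s1X; rewrite g00E !(mul0r, mulr0, add0r) => /eqP.
  by rewrite expf_eq0 /= => /eqP ->; ring.
have g10E : g10 = 0.
  by move/eqP: s1Z; rewrite !mulf_eq0 (negPf al0) (negPf g00') => /eqP.
have g20E : g20 = 0.
  move/eqP: s1Y; rewrite g10E expr0n !mulr0 subr0 mulNr oppr_eq0.
  by rewrite !mulf_eq0 (negPf be0) (negPf g00') => /eqP.
move: alE b1E beE c2E; rewrite g10E g20E => alE b1E beE c2E.
have k0 : (al - be) * g00 ^+ 2 != 0 by rewrite mulf_neq0 ?expf_neq0 ?subr_eq0.
have /eqP : (al - be) * g00 ^+ 2 * (g11 * g21) = 0 by rewrite b1E; ring.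
rewrite mulf_eq0 (negPf k0) => /eqP yz.
have /eqP : (al - be) * g00 ^+ 2 * (g12 * g22) = 0 by rewrite c2E; ring.
rewrite mulf_eq0 (negPf k0) => /eqP zy.
have alE' : al' = g00 ^+ 2 * (al * g11 * g22 - be * (g21 * g12)) by rewrite alE; ring.
have beE' : be' = g00 ^+ 2 * (be * g11 * g22 - al * (g21 * g12)).
  by apply: oppr_inj; rewrite beE; ring.
(* The eigendirections are preserved or exchanged; an exchange would send (0, 0, 1) to a
   point which is not singular. *)
suff t0 : g21 * g12 = 0 by rewrite alE' beE' t0; ring.
apply/eqP; have [//|t0] := eqVneq (g21 * g12) 0.
move: t0; rewrite mulf_eq0 negb_or => /andP[g21' g12'].
have g02E : g02 = 0.
  by move/eqP: s3Z; rewrite !mulf_eq0 (negPf al0) (negPf g12') orbF orbb => /eqP.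
by move/eqP: s3X; rewrite g02E !(mul0r, mulr0, add0r) expf_eq0 (negPf g12').
Qed.

End NormalFormOrbits.

(** * Orbits in the closure of a generic orbit *)

Section GenericForms.
Variable C : numClosedFieldType.
Implicit Types (w : 'M[C]_(3, 10)) (g N : 'M[C]_3).

Lemma framed_degenerates w : radial w -> no_invariant_line w -> simple_singularities w ->
  framed w -> exists al be : 'I_8 -> C,
    (forall i, [/\ al i != 0, be i != 0, al i != be i & degenerates w (G_form (al i) (be i))]) /\
    (forall i j, i != j -> al i * be j != al j * be i).
Proof.
move=> rw li sing [h [hu hd]].
have deg i : exists p : C * C, [/\ p.1 != 0, p.2 != 0, p.1 != p.2,
    degenerates w (G_form p.1 p.2) &
    p.1 * act (h i) w dY XXZ = - p.2 * act (h i) w dZ XXY].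
  have [hiu fi] := hu i; have rh := radial_act (h i) rw.
  have a6 : act (h i) w dX YYY != 0.
    apply/eqP => a6; apply: (li _ hiu); have [b0 _ b1] := fi.
    have [_ [[[E1 _ E3 _] _] _]] := radial_entries rh.
    split=> //; first by rewrite -[LHS]opprK -E1 b0 oppr0.
    by rewrite -[LHS]opprK -E3 b1 oppr0.
  have [al [be [al0 be0 ab] [deg E]]] := degenerates_G rh fi (sing _ hiu fi) a6.
  exists (al, be); split=> //; apply: degenerates_trans deg.
  by apply: degenerates_act => //; exact: degenerates_refl.
have [p pE] := choice deg.
exists (fun i => (p i).1), (fun i => (p i).2); split=> [i|i j ij].
  by have [] := pE i.
have [ai0 bi0 _ _ Ei] := pE i; have [aj0 bj0 _ _ Ej] := pE j.
apply: contra_neq (hd i j ij) => E.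
apply: (mulfI (mulf_neq0 aj0 bi0)).
have -> : (p j).1 * (p i).2 * (act (h i) w dZ XXY * act (h j) w dY XXZ) =
  - (- (p i).2 * act (h i) w dZ XXY) * ((p j).1 * act (h j) w dY XXZ) by ring.
rewrite -{1}E -Ei Ej; ring.
Qed.

(** The homogeneous components of a polynomial are the coefficients of its restriction to
a line through the origin. *)
Lemma homogeneous_components n (p : mpoly n C) (v : 'I_n -> C) t :
  meval (fun i => t * v i) p =
  (\poly_(d < mmeasure mdeg p) meval v (pihomog mdeg d p)).[t].
Proof.
rewrite {1}(pihomog_partitionE (mf := mdeg) (leqnn (mmeasure mdeg p))).
rewrite horner_poly raddf_sum; apply: eq_bigr => d _.
have hom : pihomog mdeg d p \is ishomog1 d mdeg by exact: pihomogP.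
rewrite /= !mevalE mulr_suml; apply: eq_big_seq => m ms.
have <- : mdeg m = d by move/dhomogP: hom => ->.
rewrite -mulrA; congr (_ * _); rewrite mdegE expr_sum -big_split /=.
by apply: eq_bigr => i _; rewrite exprMn mulrC.
Qed.

Lemma cub_F1 (x y z : C) : (cub (F1_form 0) x y z = x ^+ 2 * z - y ^+ 3) *
  (cub (F1_form 1) x y z = x * y ^+ 2).
Proof. by split; rewrite /cub !mxE /=; ring. Qed.

End GenericForms.

Section Orbits.
Variable R : realType.
Local Notation C := (Cplx R).
Implicit Types x y : @foliation_form R.

Lemma form_neq0 x : set_val x != 0 :> 'M[C]_(3, 10).
Proof.
apply/eqP => x0; apply: (not_divisible_by_X (foliation_form_set_val x)) => i.
by rewrite x0 !mxE.
Qed.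

Lemma orbit_eqP x y : PGL3_orbit (foliation_of x) = PGL3_orbit (foliation_of y) <->
  exists2 g, g \in unitmx & set_val y = act g (set_val x).
Proof.
split=> [E|[g gu yE]].
  have : PGL3_orbit (foliation_of x) (foliation_of y).
    rewrite E; apply/orbitP; exists 1%:M; rewrite ?unitmx1 //.
    by exists y; rewrite ?act1.
  move=> /orbitP[g gu [z /foliation_of_eq[c c0 zy] zE]].
  have [s su sE] := scale_act c0.
  exists (g *m s); first by rewrite unitmx_mul gu.
  by rewrite -actM sE -zE zy.
apply/seteqP; split=> F /orbitP[h hu [z zF zE]]; apply/orbitP.
  exists (invmx g *m h); first by rewrite unitmx_mul unitmx_inv gu.
  exists z; first exact: zF.
  by rewrite yE -actM (actK gu).
exists (g *m h); first by rewrite unitmx_mul gu.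
exists z; first exact: zF.
by rewrite zE yE actM.
Qed.

Lemma orbit_closureP x y :
  PGL3_orbit (foliation_of y) `<=` closure (PGL3_orbit (foliation_of x)) <->
  degenerates (set_val x) (set_val y).
Proof.
split=> [sub|deg F /orbitP[g gu [z <- zE]]].
  apply/closure_orbitP; apply: sub; apply/orbitP; exists 1%:M; rewrite ?unitmx1 //.
  by exists y; rewrite ?act1.
by apply/closure_orbitP; rewrite zE; exact: degenerates_act.
Qed.

Lemma contains_manifold_orbit x w0 d (N : 'I_d -> 'M[C]_3) : w0 != 0 ->
  (forall (v : 'rV[C]_d) (t : C), act1_deriv (\sum_j v 0 j *: N j) w0 = t *: w0 -> v = 0) ->
  degenerates (set_val x) w0 -> contains_manifold (PGL3_orbit (foliation_of x)) d.
Proof.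
move=> w00 inj deg; have [U [phi [oU U0 UE]]] := orbit_immersion w00 inj deg.
exists U, phi; split=> // u Uu; have [[g gu pE] du imm] := UE u Uu; split=> //.
have [z zE] := foliation_form_ex (foliation_form_act gu (foliation_form_set_val x)).
exists z; split; first by rewrite zE pE.
by apply/orbitP; exists g => //; exists z.
Qed.

Lemma F1_neq0 : F1_form != 0 :> 'M[C]_(3, 10).
Proof. by apply/eqP => /matrixP/(_ dY XYY)/eqP; rewrite !mxE /= oner_eq0. Qed.

Lemma G_neq0 al be : G_form al be != 0 :> 'M[C]_(3, 10).
Proof. by apply/eqP => /matrixP/(_ dX YYY)/eqP; rewrite !mxE /= oner_eq0. Qed.

Lemma contains_manifold_G x al be : al != 0 -> be != 0 -> al != be ->
  degenerates (set_val x) (G_form al be) ->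
  contains_manifold (PGL3_orbit (foliation_of x)) 7.
Proof.
move=> al0 be0 ab; apply: contains_manifold_orbit; first exact: G_neq0.
by move=> v t; exact: G_directions.
Qed.

Lemma contains_manifold_F1 x : degenerates (set_val x) F1_form ->
  contains_manifold (PGL3_orbit (foliation_of x)) 6.
Proof.
apply: contains_manifold_orbit; first exact: F1_neq0.
by move=> v t; exact: F1_directions.
Qed.

Lemma manifold_dim_lt x d e (K : finType) (S : K -> set 'M[C]_(3, 10))
    (F : K -> 'I_3 -> 'I_10 -> mpoly d C) :
  (forall k w c, c != 0 -> S k w -> S k (c *: w)) ->
  (forall k w, S k w -> exists v, forall i j, w i j = meval v (F k i j)) ->
  (forall g, g \in unitmx -> exists k, S k (act g (set_val x))) ->
  contains_manifold (PGL3_orbit (foliation_of x)) e -> (e < d)%N.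
Proof.
move=> coneS SF cov [U [phi [oU U0 UE]]].
apply: (immersed_dim_lt (phi := phi) coneS SF oU U0) => u Uu.
have [[w [wE /orbitP[g gu [y /foliation_of_eq[c c0 yw] yE]]]] du imm] := UE u Uu.
have [k Sk] := cov g gu; split=> //.
  have Sw : S k (set_val w) by rewrite yw; apply: (coneS _ _ _ c0); rewrite yE.
  by exists k; rewrite wE in Sw.
by have := form_neq0 w; rewrite wE.
Qed.

Lemma dim_G_le x al be e : set_val x = G_form al be ->
  contains_manifold (PGL3_orbit (foliation_of x)) e -> (e <= 7)%N.
Proof.
move=> xE; have [F FE] := G_piece_param al be.
rewrite -ltnS; apply: (manifold_dim_lt (S := G_piece al be) (F := F)) => //.
  by move=> k w c; exact: G_piece_cone.
by move=> g gu; have [j gj] := unit_row dY gu; exists j; exists g; rewrite ?xE.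
Qed.

Lemma dim_F1_le x e : set_val x = F1_form ->
  contains_manifold (PGL3_orbit (foliation_of x)) e -> (e <= 6)%N.
Proof.
move=> xE; have [F FE] := @F1_piece_param C.
rewrite -ltnS; apply: (manifold_dim_lt (S := @F1_piece C) (F := F)) => //.
  by move=> k w c; exact: F1_piece_cone.
move=> g gu; have [j gj] := unit_row dX gu; have [j' gj'] := unit_row dY gu.
by exists (j, j'); exists g; rewrite ?xE.
Qed.

Lemma has_dim_G x al be : al != 0 -> be != 0 -> al != be -> set_val x = G_form al be ->
  has_dim (PGL3_orbit (foliation_of x)) 7.
Proof.
move=> al0 be0 ab xE; split; last by move=> e; exact: dim_G_le xE.
by apply: (contains_manifold_G al0 be0 ab); rewrite xE; exact: degenerates_refl.
Qed.

Lemma has_dim_F1 x : set_val x = F1_form -> has_dim (PGL3_orbit (foliation_of x)) 6.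
Proof.
move=> xE; split; last by move=> e; exact: dim_F1_le xE.
by apply: contains_manifold_F1; rewrite xE; exact: degenerates_refl.
Qed.

(** A polynomial in the coordinates of a form that is not homogeneous still defines a
Zariski closed set of foliations, the common zeros of its homogeneous components: outside
it the polynomial is nonzero at some multiple of the form. *)
Lemma generic_forms (Q : 'M[C]_(3, 10) -> Prop) :
  generically (fun x : 'I_15 -> C => no_singularity_on_Z0 (form15 x) /\ Q (form15 x)) ->
  generic (fun F : foliation R => exists2 x, foliation_of x = F & Q (set_val x)).
Proof.
move=> [P [pP [x0 Px0] PQ]].
pose P' (v : 'I_(3 * 10) -> C) := P (coord15 (vec_mx (\row_k v k))).
have pP' : polyfun P'.
  apply: (polyfun_comp pP); apply: polyfun_coord15 => i k.
  by apply: (polyfun_eq (polyfun_var C (mxvec_index i k))) => v; rewrite !mxE.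
have [p pE] := polyfunP pP'.
have pw (w : 'M[C]_(3, 10)) t : meval (fun i => t * mxvec w 0 i) p = P (coord15 (t *: w)).
  rewrite -pE /P'; congr (P (coord15 _)); apply: (can_inj mxvecK); rewrite vec_mxK linearZ /=.
  by apply/rowP => k; rewrite !mxE.
pose S := [set q | exists2 d, (d < mmeasure mdeg p)%N & q = pihomog mdeg d p].
exists [set F : foliation R | forall w : @foliation_form R, foliation_of w = F ->
  forall q, S q -> meval (mxvec (set_val w) 0) q = 0].
split.
- exists S; split=> // q [d _ ->].
  by exists d; exact: pihomogP.
- apply/eqP => ZT; have [ns _] := PQ x0 Px0.
  have [x xE] := foliation_form_ex (foliation_form_generic (radial_form15 x0) ns).
  have Zx : forall q, S q -> meval (mxvec (set_val x) 0) q = 0.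
    have : [set F : foliation R | forall w : @foliation_form R, foliation_of w = F ->
      forall q, S q -> meval (mxvec (set_val w) 0) q = 0] (foliation_of x) by rewrite ZT.
    exact.
  have := homogeneous_components p (mxvec (set_val x) 0) 1.
  rewrite pw scale1r xE (_ : coord15 _ = x0); last by apply/funext => l; rewrite coord15_form15.
  rewrite horner_poly big1 => [E|d _]; last by rewrite -xE Zx ?mul0r //; exists d.
  by rewrite E eqxx in Px0.
move=> F nZ; apply: contrapT => nQ; apply: nZ => w wF q [d dp ->].
have van t : t != 0 -> P (coord15 (t *: set_val w)) = 0.
  move=> t0; apply/eqP/negPn/negP => /PQ.
  have rw : radial (t *: set_val w) by apply: radialZ; have /foliation_formE[] := foliation_form_set_val w.
  rewrite (radial_coord rw) => -[_ Qw]; apply: nQ.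
  have [x xE] := foliation_form_ex (foliation_formZ t0 (foliation_form_set_val w)).
  exists x; last by rewrite xE.
  by rewrite -wF; apply/esym/foliation_of_eq; exists t.
pose r := \poly_(d < mmeasure mdeg p) meval (mxvec (set_val w) 0) (pihomog mdeg d p).
have r0 : r = 0.
  apply/eqP/negPn/negP => r0.
  have /poly_nonroot[t] : 'X * r != 0 by rewrite mulf_neq0 // polyX_eq0.
  rewrite hornerM hornerX mulf_eq0 negb_or => /andP[t0].
  by rewrite -homogeneous_components pw van // eqxx.
by have := congr1 (fun r : {poly C} => r`_d) r0; rewrite coef_poly dp coef0.
Qed.

Lemma described_F1 x : set_val x = F1_form ->
  described_in_chart_Z1 (foliation_of x) (omega1_dx R) (omega1_dy R).
Proof.
move=> xE; exists x; split=> //; apply: mpoly_ext => v;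
  rewrite comp_mpoly_meval xE /omega1_dx /omega1_dy ?mevalB ?mevalM ?mevalXn /var ?mevalXU meval_coef
    cub_F1 !(tnth_nth 0) /= !mevalXU ?meval1; ring.
Qed.

Lemma F1_ex : exists x, set_val x = F1_form.
Proof. exact: foliation_form_ex (foliation_form_F1 R). Qed.

Lemma principal_orbits x g : g \in unitmx -> principal (act g (set_val x)) ->
  act g (set_val x) dX YYY != 0 ->
  [/\ act g (set_val x) dZ XXY = 0, act g (set_val x) dY XXZ = 0 & act g (set_val x) dZ XXX != 0] \/
    nonresonant (act g (set_val x)) ->
  (exists2 h, h \in unitmx & F1_form = act h (set_val x)) \/
  contains_manifold (PGL3_orbit (foliation_of x)) 7.
Proof.
move=> gu pr a6; have /foliation_formE[rx _] := foliation_form_set_val x.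
have rg := radial_act g rx; case=> [[c1 b2 c0]|nr].
  have [h hu hE] := principal_F1 rg pr a6 c1 b2 c0; left.
  by exists (g *m h); rewrite ?unitmx_mul ?gu // -actM hE.
have [h hu [al [be [al0 be0 ab] hE]]] := principal_G rg pr a6 nr; right.
apply: (contains_manifold_G al0 be0 ab); rewrite -hE actM.
by apply: degenerates_act; [rewrite unitmx_mul gu | exact: degenerates_refl].
Qed.

Lemma seven_orbits x : radial (set_val x) -> no_invariant_line (set_val x) ->
  simple_singularities (set_val x) -> framed (set_val x) ->
  (`I_7 #<= [set O | [/\ is_orbit O, O `<=` closure (PGL3_orbit (foliation_of x)) & has_dim O 7]])%card.
Proof.
move=> rx li sing fr; have [al [be [deg distinct]]] := framed_degenerates rx li sing fr.
have : forall i, exists y : @foliation_form R, set_val y = G_form (al i) (be i).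
  move=> i; have [al0 be0 _ _] := deg i.
  exact: foliation_form_ex (foliation_form_G al0 be0).
move=> /choice[y yE]; pose O k := PGL3_orbit (foliation_of (y (inord k))).
have Oinj : {in `I_7 &, injective O}.
  move=> k l; rewrite !inE /= => k7 l7 /orbit_eqP[g gu]; rewrite !yE => /esym E.
  have [a0 b0 ab _] := deg (inord k); have [a0' _ _ _] := deg (inord l).
  have kl := G_conjugate a0 b0 ab a0' gu E.
  have [/(congr1 val)|ne] := eqVneq (inord k : 'I_8) (inord l); last by have := distinct _ _ ne; rewrite kl eqxx.
  by rewrite /= !inordK // ltnW.
rewrite -(card_le_eql (inj_card_eq Oinj)); apply: subset_card_le => _ [k _ <-].
have [a0 b0 ab dk] := deg (inord k); split; first by exists (foliation_of (y (inord k))).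
  by apply/orbit_closureP; rewrite yE.
by apply: has_dim_G (yE _).
Qed.

(** The orbit of x and those of the forms G contain manifolds of dimension 7, so that
only the orbit of F1 remains. *)
Lemma six_dimensional_orbits x y : radial (set_val x) -> no_invariant_line (set_val x) ->
  simple_singularities (set_val x) -> framed (set_val x) -> set_val y = F1_form ->
  [set O | [/\ is_orbit O, O `<=` closure (PGL3_orbit (foliation_of x)) & has_dim O 6]]
    = [set PGL3_orbit (foliation_of y)].
Proof.
move=> rx li sing fr yE; have [al [be [deg _]]] := framed_degenerates rx li sing fr.
have [a0 b0 ab d0] := deg ord0.
apply/seteqP; split=> [A [[F AF] sub [_ dim6]]|A AE]; last first.
  rewrite AE.
  split; first by exists (foliation_of y).
    apply/orbit_closureP; rewrite yE; apply: (degenerates_trans d0).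
    exact: degenerates_G_F1.
  exact: has_dim_F1.
have [z zF] := foliation_ex F; rewrite AF -zF in sub dim6; rewrite /= AF -zF.
have not7 : ~ contains_manifold (PGL3_orbit (foliation_of z)) 7 by move/dim6.
have /foliation_formE[rz _] := foliation_form_set_val z.
have dxz := (orbit_closureP x z).1 sub.
have [[g gu zE]|[g gu [pr a6 cases]]] := degenerations rx rz (foliation_form_set_val z) li sing dxz.
  case: not7; apply: (contains_manifold_G a0 b0 ab); apply: degenerates_trans d0.
  rewrite -[set_val x](actK gu) -zE.
  by apply: degenerates_act; [rewrite unitmx_inv | exact: degenerates_refl].
have [|[h hu hE]|//] := principal_orbits gu pr a6.
  by case: cases => [[c1 [b2 c0]]|nr]; [left | right].
by apply/orbit_eqP; exists h => //; rewrite yE.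
Qed.

End Orbits.

Local Open Scope card_scope.

Theorem mainTheorem4 (R : realType) :
  exists F1 : foliation R,
    described_in_chart_Z1 F1 (omega1_dx R) (omega1_dy R) /\
    generic (fun F : foliation R =>
      `I_7 #<= [set O | [/\ is_orbit O, O `<=` closure (PGL3_orbit F)
                            & has_dim O 7]]
      /\
      [set O | [/\ is_orbit O, O `<=` closure (PGL3_orbit F) & has_dim O 6]]
        = [set PGL3_orbit F1]).
Proof.
have [y yE] := F1_ex R; exists (foliation_of y); split; first exact: described_F1.
pose Q (w : 'M[Cplx R]_(3, 10)) := [/\ no_invariant_line w, simple_singularities w & framed w].
have : generically (fun x : 'I_15 -> Cplx R => no_singularity_on_Z0 (form15 x) /\ Q (form15 x)).
  have [P [pP Pne PQ]] := generically_and (no_singularity_on_Z0_generic (Cplx R))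
    (generically_and (no_invariant_line_generic (Cplx R))
      (generically_and (simple_singularities_generic (Cplx R)) (framed_generic (Cplx R)))).
  by exists P; split=> // x /PQ[? [? [? ?]]].
move=> /generic_forms[Z [cZ ZT ZQ]]; exists Z; split=> // F /ZQ[x <- [li sing fr]].
have /foliation_formE[rx _] := foliation_form_set_val x.
by split; [exact: seven_orbits | exact: six_dimensional_orbits].
Qed.
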